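(* Assume in addition $\mathbb E X_0^3<\infty$ and $\mathbb E\varepsilon_1^3<\infty$. Then $\sqrt n(\tilde\alpha_n-\alpha)\to\mathcal N(0,\sigma_{\alpha,\varepsilon}^2)$ in distribution. Moreover, conditionally on the values $(Y_{s-1},Y_{s+2})$, $$\begin{bmatrix}\sqrt n(\tilde\theta_{1,n}-L_1)\\ \sqrt n(\tilde\theta_{2,n}-L_2)\end{bmatrix}\to\mathcal N\Big(\begin{bmatrix}0\\0\end{bmatrix},\sigma_{\alpha,\varepsilon}^2\,f_{\alpha,\varepsilon}f_{\alpha,\varepsilon}^\top\Big),$$ where $L_1=Y_s+\frac{-\alpha(1+\alpha^2)Y_{s-1}-\alpha^2Y_{s+2}-(1-\alpha^3)\mu_\varepsilon}{1+\alpha^2+\alpha^4}$, $L_2=Y_{s+1}+\frac{-\alpha^2Y_{s-1}-\alpha(1+\alpha^2)Y_{s+2}-(1-\alpha^3)\mu_\varepsilon}{1+\alpha^2+\alpha^4}$, and $$f_{\alpha,\varepsilon}=\frac{1}{(1+\alpha^2+\alpha^4)^2}\begin{bmatrix}(\alpha^2-1)(\alpha^4+3\alpha^2+1)Y_{s-1}+2\alpha(\alpha^4-1)Y_{s+2}+\alpha(2-\alpha)(1+\alpha+\alpha^2)^2\mu_\varepsilon\\ 2\alpha(\alpha^4-1)Y_{s-1}+(\alpha^2-1)(\alpha^4+3\alpha^2+1)Y_{s+2}+\alpha(2-\alpha)(1+\alpha+\alpha^2)^2\mu_\varepsilon\end{bmatrix}.$$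
   Context: INAR(1) process: Let $\alpha\in(0,1)$. Let $(\varepsilon_k)_{k\in\mathbb N}$ be i.i.d. non-negative integer-valued random variables with $\mathbb E\varepsilon_1^2<\infty$ and $\mathbb P(\varepsilon_1\ne 0)>0$; write $\mu_\varepsilon=\mathbb E\varepsilon_1$ (assumed known), $\sigma_\varepsilon^2=\operatorname{Var}\varepsilon_1$. For each $k\in\mathbb N$ let $(\xi_{k,j})_{j\in\mathbb N}$ be i.i.d. Bernoulli random variables with mean $\alpha$, these sequences being mutually independent and independent of $(\varepsilon_k)$. Let $X_0$ be a non-negative integer-valued random variable with $\mathbb E X_0^2<\infty$, independent of all $\xi_{k,j}$ and $\varepsilon_k$, and set $X_k=\sum_{j=1}^{X_{k-1}}\xi_{k,j}+\varepsilon_k$ for $k\in\mathbb N$. This Markov chain has a unique stationary distribution; $\tilde X$ denotes a random variable with it, and $\sigma_{\alpha,\varepsilon}^2=\frac{\alpha(1-\alpha)\mathbb E\tilde X^3+\sigma_\varepsilon^2\mathbb E\tilde X^2}{(\mathbb E\tilde X^2)^2}$. Two neighbouring additive outliers: fix known $s\in\mathbb N$ and $\theta_1,\theta_2\in\mathbb N$; $Y_k=X_k+\delta_{k,s}\theta_1+\delta_{k,s+1}\theta_2$; $\mathbf Y_n=(Y_0,\dots,Y_n)$. For $n\ge s+2$, $$Q_n(\mathbf y_n;\alpha',\theta_1',\theta_2')=\sum_{\substack{k=1\\k\notin\{s,s+1,s+2\}}}^n(y_k-\alpha'y_{k-1}-\mu_\varepsilon)^2+(y_s-\alpha'y_{s-1}-\mu_\varepsilon-\theta_1')^2+(y_{s+1}-\alpha'y_s-\mu_\varepsilon+\alpha'\theta_1'-\theta_2')^2+(y_{s+2}-\alpha'y_{s+1}-\mu_\varepsilon+\alpha'\theta_2')^2,$$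 and $(\tilde\alpha_n,\tilde\theta_{1,n},\tilde\theta_{2,n})$ is the unique global minimizer over $\mathbb R^3$ of $Q_n(\mathbf Y_n;\cdot)$ when it exists uniquely, and $(0,0,0)$ otherwise. Conditional convergence: for random vectors $\zeta_n$ and a random vector $\eta$ with values in $\mathbb Z_+^d$, ''conditionally on the values $\eta$, $\zeta_n\to\mathcal N(0,\Sigma(\eta))$'' means: for every $m$ with $\mathbb P(\eta=m)>0$, the conditional distribution of $\zeta_n$ given $\{\eta=m\}$ converges weakly to $\mathcal N(0,\Sigma(m))$. *)

(* Defs.v *)
From HB Require Import structures.
From mathcomp Require Import all_boot all_order all_algebra.
From mathcomp Require Import all_classical all_reals all_analysis.
From mathcomp Require Import normal_distribution.

Set Implicit Arguments.
Unset Strict Implicit.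
Unset Printing Implicit Defensive.

Import Order.TTheory GRing.Theory Num.Theory.
Import numFieldNormedType.Exports.

Local Open Scope classical_set_scope.
Local Open Scope ring_scope.

Definition nat_rv d (T : measurableType d) (Z : T -> nat) : Prop :=
  forall m : nat, measurable (Z @^-1` [set m]).

Definition mutually_independent d (T : measurableType d) (R : realType)
    (P : probability T R) (I : Type) (Z : I -> T -> nat) : Prop :=
  forall (n : nat) (f : 'I_n -> I), injective f ->
  forall A : 'I_n -> set nat,
    fine (P (\bigcap_(k in [set: 'I_n]) (Z (f k) @^-1` A k)))
    = \prod_(k < n) fine (P (Z (f k) @^-1` A k)).

Definition is_normal0 (R : realType) (nu : set R -> \bar R) (v : R) : Prop :=
  forall A : set R, measurable A ->
    nu A = if 0 < v then normal_prob 0 (Num.sqrt v) A else ((\1_A (0:R))%:E)%E.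

(* nu is the centered bivariate normal law N(0, [[s11, s12],[s12, s22]])
   on R^2 (possibly degenerate): every linear combination t1 x1 + t2 x2 is
   N(0, t' S t) (Cramer-Wold definition of the multivariate normal law). *)
Definition is_normal0_2 (R : realType) (nu : probability (R * R)%type R)
    (s11 s12 s22 : R) : Prop :=
  forall t1 t2 : R,
    is_normal0 (pushforward nu (fun x : R * R => t1 * x.1 + t2 * x.2))
      (t1 ^+ 2 * s11 + 2 * t1 * t2 * s12 + t2 ^+ 2 * s22).

Definition cond_cvg_law d (T : measurableType d) (R : realType)
    (P : probability T R) (B : set T) (Z : nat -> T -> R)
    (nu : probability R R) : Prop :=
  forall g : R -> R, continuous g -> (exists M : R, forall x, `|g x| <= M) ->
    (fun n => fine (\int[P]_(w in B) (g (Z n w))%:E)%E / fine (P B))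
      @ \oo --> fine (\int[nu]_x (g x)%:E)%E.

Definition cond_cvg_law2 d (T : measurableType d) (R : realType)
    (P : probability T R) (B : set T) (Z : nat -> T -> (R * R)%type)
    (nu : probability (R * R)%type R) : Prop :=
  forall g : (R * R)%type -> R, continuous g ->
    (exists M : R, forall x, `|g x| <= M) ->
    (fun n => fine (\int[P]_(w in B) (g (Z n w))%:E)%E / fine (P B))
      @ \oo --> fine (\int[nu]_x (g x)%:E)%E.

(* Indices of the primitive random variables:
   X_0, eps_{k+1} (index IE k), xi_{k+1,j+1} (index IXi k j). *)
Inductive inar_index : Type :=
| I0 : inar_index
| IE : nat -> inar_index
| IXi : nat -> nat -> inar_index.

Definition inar_family d (T : measurableType d) (X0 : T -> nat)
    (eps : nat -> T -> nat) (xi : nat -> nat -> T -> nat)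
    (i : inar_index) : T -> nat :=
  match i with
  | I0 => X0
  | IE k => eps k
  | IXi k j => xi k j
  end.

(* X_0 = X0 and X_{k+1} = sum_{j=1}^{X_k} xi_{k+1,j} + eps_{k+1},
   where eps k stands for eps_{k+1} and xi k j for xi_{k+1,j+1}. *)
Fixpoint inar_X d (T : measurableType d) (X0 : T -> nat)
    (eps : nat -> T -> nat) (xi : nat -> nat -> T -> nat) (k : nat) (w : T)
    : nat :=
  match k with
  | 0 => X0 w
  | k'.+1 => (\sum_(j < inar_X X0 eps xi k' w) xi k' j w + eps k' w)%N
  end.

Definition eps_pmf d (T : measurableType d) (R : realType)
    (P : probability T R) (eps : nat -> T -> nat) (m : nat) : R :=
  fine (P (eps 0 @^-1` [set m])).

(* Transition probabilities of the INAR(1) chain: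
   K n m = P(Bin(n, alpha) + eps_1 = m). *)
Definition inar_kernel (R : realType) (alpha : R) (peps : nat -> R)
    (n m : nat) : R :=
  \sum_(i < (minn n m).+1)
     ('C(n, i)%:R * alpha ^+ i * (1 - alpha) ^+ (n - i) * peps (m - i)%N).

Definition is_stationary (R : realType) (K : nat -> nat -> R) (pi : nat -> R)
    : Prop :=
  (forall n, 0 <= pi n) /\
  (\sum_(0 <= n <oo) (pi n)%:E = 1)%E /\
  (forall m, (pi m)%:E = \sum_(0 <= n <oo) (pi n * K n m)%:E)%E.

Definition pmf_moment (R : realType) (pi : nat -> R) (k : nat) : R :=
  fine (\sum_(0 <= n <oo) (pi n * (n%:R) ^+ k)%:E)%E.

Definition sigma2_ae (R : realType) (alpha sig2eps : R) (pi : nat -> R) : R :=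
  (alpha * (1 - alpha) * pmf_moment pi 3 + sig2eps * pmf_moment pi 2)
  / (pmf_moment pi 2) ^+ 2.

Definition obs_Y d (T : measurableType d) (R : realType) (X : nat -> T -> nat)
    (s th1 th2 : nat) (k : nat) (w : T) : R :=
  (X k w)%:R + (k == s)%:R * th1%:R + (k == s.+1)%:R * th2%:R.

Definition Qn (R : realType) (mu : R) (s n : nat) (y : nat -> R)
    (p : (R * R * R)%type) : R :=
  let: (a, t1, t2) := p in
  \sum_(1 <= k < n.+1 | (k != s) && (k != s.+1) && (k != s.+2))
      (y k - a * y k.-1 - mu) ^+ 2
  + (y s - a * y s.-1 - mu - t1) ^+ 2
  + (y s.+1 - a * y s - mu + a * t1 - t2) ^+ 2
  + (y s.+2 - a * y s.+1 - mu + a * t2) ^+ 2.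

(* The unique global minimizer of f over R^3 if it exists, (0,0,0) else. *)
Definition unique_argmin (R : realType) (f : (R * R * R)%type -> R)
    : (R * R * R)%type :=
  xget (0, 0, 0)
    [set p | (forall q, f p <= f q) /\
             (forall p', (forall q, f p' <= f q) -> p' = p)].

(* Main.v *)
Require Import Defs.
From HB Require Import structures.
From mathcomp Require Import all_boot all_order all_algebra.
From mathcomp Require Import all_classical all_reals all_analysis.
From mathcomp Require Import normal_distribution measurable_realfun.
From mathcomp Require Import ring lra zify.
Import Order.TTheory GRing.Theory Num.Theory.
Import numFieldNormedType.Exports.
Local Open Scope classical_set_scope.
Local Open Scope ring_scope.
Set Implicit Arguments.
Unset Strict Implicit.
Unset Printing Implicit Defensive.

(* Minimizing Q_n first over (theta_1, theta_2) leaves a function of alpha' alone: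
   S (alpha' - beta)^2 plus a fixed rational function, where S is the sum of the
   squared regressors and beta the least squares estimator built from the residuals
   outside {s, s+1, s+2}. Since S grows linearly in n, the minimizer is eventually
   unique and within O(1/S) of beta, and the estimated outlier sizes are smooth
   functions of it, of which L_1, L_2 are the values at alpha and f the derivative.
   The error sqrt n (beta - alpha) is a martingale over sqrt n, divided by S/n.
   Adding one individual changes the next state of the chain by a Bernoulli(alpha)
   variable, so the transition kernel contracts Lipschitz functions at rate alpha.
   This ergodicity gives the law of large numbers for S/n, and it allows one to
   replace the conditional variances by their stationary mean in a one-step Taylor
   expansion of the characteristic function. The argument carries along any bounded
   weight depending on finitely many coordinates, which settles the conditioning on
   (Y_(s-1), Y_(s+2)). *)

(** * Discrete random variables and independence *)

(** Only third moments are available, while a cubic Taylor remainder for the martingale increment x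
    (y - alpha x - mu) would need higher moments of the chain. Hence states above a level C receive
    only a quadratic remainder, whose mean is at most a multiple of E X_k^3 on {X_k > C}. This is
    small uniformly in k because the third moments of the chain converge to the stationary one,
    whose finiteness is itself obtained from truncated moments. The same truncation serves the law
    of large numbers for X_k^2, which may have infinite variance. Characteristic functions are kept
    real: cos (t x + theta) with a free phase theta replaces the complex exponential. Bernstein
    polynomials in (1 + sin)/2 lead from cosines to bounded continuous functions. The covariance f
    f^T has rank one, so the limit of the outlier estimators is the image of one normal law under x
    -> (f_1 x, f_2 x), and both assertions reduce to a one-dimensional limit theorem for the
    martingale started at time s + 2, when the conditioning event is already decided. *)

Section discrete_variables.
Context d (T : measurableType d) (R : realType) (P : probability T R).

Lemma nat_rv_preimage (N : T -> nat) (A : set nat) :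
  nat_rv N -> measurable (N @^-1` A).
Proof.
move=> mN; have -> : N @^-1` A = \bigcup_(n in A) N @^-1` [set n].
  by apply/seteqP; split => [w Aw|w [n An /= Nn]] /=; [exists (N w)|rewrite Nn].
by apply: bigcup_measurable => n _; exact: mN.
Qed.

Lemma nat_rv_measurable d' (T' : measurableType d') (N : T -> nat)
    (f : nat -> T') : nat_rv N -> measurable_fun setT (f \o N).
Proof.
by move=> mN _ A mA; rewrite setTI; exact: (@nat_rv_preimage N (f @^-1` A)).
Qed.

Lemma integral_nat_rv (N : T -> nat) (f : T -> \bar R) : nat_rv N ->
  (forall w, 0 <= f w)%E -> measurable_fun setT f ->
  (\int[P]_w f w = \sum_(n <oo) \int[P]_(w in N @^-1` [set n]) f w)%E.
Proof.
move=> mN f0 mf.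
have UT : \bigcup_n (N @^-1` [set n]) = [set: T].
  by apply/seteqP; split => // w _; exists (N w).
rewrite -UT ge0_integral_bigcup // ?UT //.
apply/trivIsetP => i j _ _ ij; apply/seteqP; split => // w [/= wi wj].
by move: ij; rewrite -wi -wj eqxx.
Qed.

(* [V u] needs to be independent of [N = u] only, so that the second variable
   may be selected by the value of the first one. *)
Lemma integral_indep_selected (N : T -> nat) (V : nat -> T -> nat)
    (G : nat -> nat -> \bar R) : nat_rv N -> (forall u, nat_rv (V u)) ->
  (forall u v, P (N @^-1` [set u] `&` V u @^-1` [set v]) =
    P (N @^-1` [set u]) * P (V u @^-1` [set v]))%E ->
  (forall u v, 0 <= G u v)%E ->
  (\int[P]_w G (N w) (V (N w) w) =
   \int[P]_w \int[P]_w' G (N w) (V (N w) w'))%E.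
Proof.
move=> mN mV ind G0.
have mGV u : measurable_fun setT (fun w => G u (V u w)).
  exact: (nat_rv_measurable (G u) (mV u)).
have mL : measurable_fun setT (fun w => G (N w) (V (N w) w)).
  move=> _ A mA; rewrite setTI.
  rewrite (_ : _ @^-1` A = \bigcup_u (N @^-1` [set u] `&`
      (fun w => G u (V u w)) @^-1` A)); last first.
    by apply/seteqP; split => [w Aw|w [u _ [/= <-]]] //; exists (N w).
  apply: bigcup_measurable => u _; apply: measurableI; first exact: mN.
  by rewrite -[X in measurable X]setTI; exact: mGV.
rewrite (integral_nat_rv mN) // (integral_nat_rv mN); first last.
- exact: (nat_rv_measurable (fun u => \int[P]_w' G u (V u w'))%E mN).
- by move=> w; exact: integral_ge0.
apply: eq_eseriesr => u _.
transitivity (\int[P]_(w in N @^-1` [set u]) G u (V u w))%E.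
  by apply: eq_integral => w /set_mem /= ->.
rewrite [RHS](_ : _ = \int[P]_(w in N @^-1` [set u])
    (cst (\int[P]_w' G u (V u w')) w))%E; last first.
  by apply: eq_integral => w /set_mem /= ->.
rewrite integral_cst //.
rewrite integral_mkcond [LHS](integral_nat_rv (mV u)); first last.
- apply/(measurable_restrictT _ _).1; first exact: mN.
  exact: measurable_funTS.
- by move=> w; exact: erestrict_ge0.
rewrite [in RHS](integral_nat_rv (mV u)) // muleC.
rewrite [X in (X * _)%E](_ : _ = (fine (P (N @^-1` [set u])))%:E); last first.
  by rewrite fineK // fin_num_measure.
rewrite -nneseriesZl; last by move=> v _; exact: integral_ge0.
apply: eq_eseriesr => v _; rewrite fineK ?fin_num_measure //.
rewrite -integral_mkcondr.
transitivity (\int[P]_(w in N @^-1` [set u] `&` V u @^-1` [set v]) cst (G u v) w)%E.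
  by rewrite setIC; apply: eq_integral => w /set_mem [_ /= ->].
transitivity (P (N @^-1` [set u]) *
   \int[P]_(w in V u @^-1` [set v]) cst (G u v) w)%E; last first.
  by congr (_ * _)%E; apply: eq_integral => w /set_mem /= ->.
rewrite integral_cst; last by apply: measurableI; [exact: mN|exact: mV].
rewrite integral_cst; last exact: mV.
transitivity (G u v * P (N @^-1` [set u] `&` V u @^-1` [set v]))%E => //.
by rewrite ind muleCA.
Qed.

Lemma integral_eq_law (V V' : T -> nat) (g : nat -> \bar R) :
  nat_rv V -> nat_rv V' ->
  (forall v, P (V @^-1` [set v]) = P (V' @^-1` [set v])) ->
  (forall v, 0 <= g v)%E -> (\int[P]_w g (V w) = \int[P]_w g (V' w))%E.
Proof.
move=> mV mV' VV' g0.
rewrite (integral_nat_rv mV) ?(integral_nat_rv mV') //; first last.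
- exact: (nat_rv_measurable g).
- exact: (nat_rv_measurable g).
apply: eq_eseriesr => v _.
transitivity (\int[P]_(w in V @^-1` [set v]) cst (g v) w)%E.
  by apply: eq_integral => w /set_mem /= ->.
transitivity (\int[P]_(w in V' @^-1` [set v]) cst (g v) w)%E; last first.
  by apply: eq_integral => w /set_mem /= ->.
rewrite integral_cst; last exact: mV.
rewrite integral_cst; last exact: mV'.
congr (_ * _)%E; exact: VV'.
Qed.

End discrete_variables.

(** Independence is used for finite lists of indices without repetition, so [uniq] and [\in] must
    make sense for them; equality is decided classically. *)
HB.instance Definition _ := gen_eqMixin inar_index.

Section finite_independence.
Context d (T : measurableType d) (R : realType) (P : probability T R).
Context (I : eqType) (Z : I -> T -> nat).
Hypotheses (mZ : forall i, nat_rv (Z i)) (iZ : mutually_independent P Z).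

Definition vals (l : seq I) (w : T) : seq nat := [seq Z i w | i <- l].

(** Dependence on finitely many coordinates, expressed pointwise. It stands for membership in the
    sigma-algebra generated by the variables in [l]; measurability follows since only countably many
    lists of values exist. *)
Definition determined (l : seq I) (A : set T) : Prop :=
  forall w w', vals l w = vals l w' -> A w -> A w'.

Lemma measurable_vals l v : measurable (vals l @^-1` [set v]).
Proof.
elim: l v => [|i l IH] [|a v] /=.
- by rewrite (_ : _ @^-1` _ = setT) //; apply/seteqP; split.
- by rewrite (_ : _ @^-1` _ = set0) //; apply/seteqP; split.
- by rewrite (_ : _ @^-1` _ = set0) //; apply/seteqP; split.
rewrite (_ : _ @^-1` _ = Z i @^-1` [set a] `&` vals l @^-1` [set v]).
  by apply: measurableI; [exact: mZ|exact: IH].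
by apply/seteqP; split => [w [<- <-]|w [/= <- <-]].
Qed.

(** Lists of naturals are countable, so [pickle] turns a finite family of variables into one
    natural-valued variable, to which [integral_indep_selected] applies. *)
Lemma nat_rv_vals l : nat_rv (fun w => pickle (vals l w)).
Proof.
move=> m; case E : (@pickle_inv (seq nat) m) => [v|].
  rewrite (_ : _ @^-1` _ = vals l @^-1` [set v]); first exact: measurable_vals.
  apply/seteqP; split => w /=.
    by move=> h; move: E; rewrite -h pickleK_inv => -[].
  by move=> ->; have := @pickle_invK (seq nat) m; rewrite E.
rewrite (_ : _ @^-1` _ = set0) //; apply/seteqP; split => w //= h.
by move: E; rewrite -h pickleK_inv.
Qed.

Lemma prob_vals l v : uniq l -> size v = size l ->
  fine (P (vals l @^-1` [set v])) =
  \prod_(p <- zip l v) fine (P (Z p.1 @^-1` [set p.2])).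
Proof.
move=> ul sv; pose f (k : 'I_(size l)) := tnth (in_tuple l) k.
have fI : injective f by apply/tuple_uniqP.
transitivity (\prod_(k < size l) fine (P (Z (f k) @^-1` [set nth 0%N v k]))).
  rewrite -(iZ fI (fun k => [set nth 0%N v k])); congr (fine (P _)).
  apply/seteqP; split => w /=.
    move=> vw k _ /=; rewrite -vw /f /vals.
    by rewrite (tnth_nth (f k)) /= (nth_map (f k)).
  move=> h; apply: (@eq_from_nth _ 0%N); first by rewrite size_map sv.
  rewrite size_map => k kl; have := h (Ordinal kl) Logic.I.
  rewrite /= /f (tnth_nth (f (Ordinal kl))) /= => <-.
  by rewrite (nth_map (f (Ordinal kl))).
(* A nonempty list supplies the default index that [nth] requires. *)
case: l ul sv @f fI => [|i0 l] ul sv f fI; first by rewrite (size0nil sv) big_ord0 big_nil.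
rewrite (big_nth (i0, 0%N)) size_zip sv minnn big_mkord; apply: eq_bigr => k _.
by rewrite nth_zip ?sv // /f (tnth_nth i0).
Qed.

Lemma vals_indep l1 l2 v1 v2 : uniq (l1 ++ l2) ->
  (P (vals l1 @^-1` [set v1] `&` vals l2 @^-1` [set v2]) =
   P (vals l1 @^-1` [set v1]) * P (vals l2 @^-1` [set v2]))%E.
Proof.
move=> u12; have [s1|s1] := eqVneq (size v1) (size l1); last first.
  have -> : vals l1 @^-1` [set v1] = set0.
    by apply/seteqP; split => // w /= h; move: s1; rewrite -h size_map eqxx.
  by rewrite set0I measure0 mul0e.
have [s2|s2] := eqVneq (size v2) (size l2); last first.
  have -> : vals l2 @^-1` [set v2] = set0.
    by apply/seteqP; split => // w /= h; move: s2; rewrite -h size_map eqxx.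
  by rewrite setI0 measure0 mule0.
have -> : vals l1 @^-1` [set v1] `&` vals l2 @^-1` [set v2] =
    vals (l1 ++ l2) @^-1` [set v1 ++ v2].
  apply/seteqP; split => w /=; first by move=> [<- <-]; rewrite /vals map_cat.
  rewrite /vals map_cat => /eqP; rewrite eqseq_cat ?size_map //.
  by move=> /andP[/eqP ? /eqP ?].
have fn A : measurable A -> P A \is a fin_num by exact: fin_num_measure.
rewrite -[LHS]fineK; last by apply: fn; exact: measurable_vals.
rewrite -[X in (_ = X * _)%E]fineK; last by apply: fn; exact: measurable_vals.
rewrite -[X in (_ = _ * X)%E]fineK; last by apply: fn; exact: measurable_vals.
rewrite -EFinM; congr EFin.
have [u1 u2] : uniq l1 /\ uniq l2 by move: u12; rewrite cat_uniq => /and3P[].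
by rewrite !prob_vals ?size_cat ?s1 ?s2 // zip_cat // big_cat.
Qed.

Lemma determined_measurable l A : determined l A -> measurable A.
Proof.
move=> dA; pose U w := pickle (vals l w).
have -> : A = U @^-1` (U @` A).
  apply/seteqP; split => [w Aw|w [w' Aw' /(pcan_inj pickleK) h]]; last exact: dA Aw'.
  by exists w.
exact: (nat_rv_preimage _ (nat_rv_vals l)).
Qed.

(** Each event is the preimage of a set of codes, and for single codes independence is [vals_indep].
    Integrating the product of two indicators passes from single codes to arbitrary sets of
    codes. *)
Lemma determined_indep l1 l2 A B : uniq (l1 ++ l2) ->
  determined l1 A -> determined l2 B -> (P (A `&` B) = P A * P B)%E.
Proof.
move=> u12 dA dB.
pose U1 w := pickle (vals l1 w); pose U2 w := pickle (vals l2 w).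
pose S1 := U1 @` A; pose S2 := U2 @` B.
have EA : U1 @^-1` S1 = A.
  apply/seteqP; split => [w [w' Aw' /(pcan_inj pickleK) h]|w Aw]; first exact: dA Aw'.
  by exists w.
have EB : U2 @^-1` S2 = B.
  apply/seteqP; split => [w [w' Aw' /(pcan_inj pickleK) h]|w Aw]; first exact: dB Aw'.
  by exists w.
have mA := determined_measurable dA; have mB := determined_measurable dB.
have := @integral_indep_selected _ T R P U1 (fun _ => U2)
  (fun u v => (\1_S1 u * \1_S2 v)%:E) (nat_rv_vals l1) (fun _ => nat_rv_vals l2).
have I1 w : \1_S1 (U1 w) = \1_A w :> R.
  by rewrite -EA !indicE; congr (nat_of_bool _)%:R; apply/idP/idP => /set_mem h; apply/mem_set.
have I2 w : \1_S2 (U2 w) = \1_B w :> R.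
  by rewrite -EB !indicE; congr (nat_of_bool _)%:R; apply/idP/idP => /set_mem h; apply/mem_set.
have -> : (\int[P]_w (\1_S1 (U1 w) * \1_S2 (U2 w))%:E = P (A `&` B))%E.
  rewrite -[in RHS](setIT (A `&` B)) -integral_indic //; last exact: measurableI.
  by apply: eq_integral => w _; rewrite I1 I2 indicI.
have -> : (\int[P]_w \int[P]_w' (\1_S1 (U1 w) * \1_S2 (U2 w'))%:E = P A * P B)%E.
  transitivity (\int[P]_w ((\1_A w)%:E * P B))%E.
    apply: eq_integral => w _.
    transitivity (\int[P]_w' ((\1_A w)%:E * (\1_B w')%:E))%E.
      by apply: eq_integral => w' _; rewrite I1 I2 EFinM.
    rewrite ge0_integralZl_EFin //; first by rewrite integral_indic // setIT.
    exact/measurable_EFinP.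
  rewrite -(fineK (fin_num_measure P B mB)) ge0_integralZr //.
  - by rewrite integral_indic // setIT fineK // fin_num_measure.
  - exact/measurable_EFinP.
  - by rewrite lee_fin fine_ge0.
apply; last by move=> u v; rewrite lee_fin mulr_ge0 // indicE.
move=> u v.
have [[v1 e1]|n1] := pselect (exists v1 : seq nat, pickle v1 = u); last first.
  have -> : U1 @^-1` [set u] = set0.
    by apply/seteqP; split => // w /= h; apply: n1; exists (vals l1 w).
  by rewrite set0I measure0 mul0e.
have [[v2 e2]|n2] := pselect (exists v2 : seq nat, pickle v2 = v); last first.
  have -> : U2 @^-1` [set v] = set0.
    by apply/seteqP; split => // w /= h; apply: n2; exists (vals l2 w).
  by rewrite setI0 measure0 mule0.
have E l v' u' : pickle v' = u' ->
    (fun w => pickle (vals l w)) @^-1` [set u'] = vals l @^-1` [set v'].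
  by move=> <-; apply/seteqP; split => w /= => [/(pcan_inj pickleK)|->].
by rewrite (E _ _ _ e1) (E _ _ _ e2); exact: vals_indep.
Qed.

End finite_independence.

(** * Expectations of real random variables *)

Section expectation.
Context d (T : measurableType d) (R : realType) (P : probability T R).
Implicit Types (f g : T -> R).

Definition itg f := P.-integrable [set: T] (fun w => (f w)%:E).

Lemma itg_measurable f : itg f -> measurable_fun setT f.
Proof. by move=> /measurable_int/measurable_EFinP. Qed.

Lemma itgD f g : itg f -> itg g -> itg (fun w => f w + g w).
Proof. by move=> hf hg; apply: eq_integrable (integrableD _ hf hg). Qed.

Lemma itgZ c f : itg f -> itg (fun w => c * f w).
Proof. by move=> hf; apply: eq_integrable (integrableZl _ c hf). Qed.

Lemma itgN f : itg f -> itg (fun w => - f w).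
Proof. by move=> hf; apply: eq_integrable (integrableN hf). Qed.

Lemma itgB f g : itg f -> itg g -> itg (fun w => f w - g w).
Proof. by move=> hf hg; apply: itgD => //; exact: itgN. Qed.

Lemma itg_cst c : itg (fun=> c).
Proof. exact: finite_measure_integrable_cst. Qed.

Lemma itg_le f g : measurable_fun setT f -> itg g ->
  (forall w, `|f w| <= g w) -> itg f.
Proof.
move=> mf hg fg; apply: (le_integrable _ _ _ hg) => //.
  exact/measurable_EFinP.
by move=> w _; rewrite /= lee_fin (le_trans (fg w)) // ler_norm.
Qed.

Lemma itg_bounded f M : measurable_fun setT f -> (forall w, `|f w| <= M) -> itg f.
Proof. by move=> mf fM; exact: (itg_le mf (itg_cst M)). Qed.

Lemma itg_norm f : itg f -> itg (fun w => `|f w|).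
Proof.
move=> hf; apply: (@itg_le _ (fun w => `|f w|)).
- by apply: measurableT_comp => //; exact: itg_measurable.
- by apply: eq_integrable (integrable_abse hf).
- by move=> w; rewrite normr_id.
Qed.

Lemma itg_sum (I : Type) (r : seq I) (Q : pred I) (F : I -> T -> R) :
  (forall i, Q i -> itg (F i)) -> itg (fun w => \sum_(i <- r | Q i) F i w).
Proof.
move=> hF; elim: r => [|i r IH].
  rewrite (_ : (fun _ => _) = fun=> 0); first exact: itg_cst.
  by apply/funext => w; rewrite big_nil.
case/boolP: (Q i) => Qi.
  rewrite (_ : (fun _ => _) = fun w => F i w + \sum_(j <- r | Q j) F j w).
    by apply: itgD => //; exact: hF.
  by apply/funext => w; rewrite big_cons Qi.
rewrite (_ : (fun _ => _) = fun w => \sum_(j <- r | Q j) F j w) //.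
by apply/funext => w; rewrite big_cons (negbTE Qi).
Qed.

Lemma itg_ge0 f : measurable_fun setT f -> (forall w, 0 <= f w) ->
  (\int[P]_w (f w)%:E < +oo)%E -> itg f.
Proof.
move=> mf f0 fi; apply/integrableP; split; first exact/measurable_EFinP.
by under eq_integral do rewrite /= ger0_norm //.
Qed.

Lemma expD f g : itg f -> itg g ->
  \int[P]_w (f w + g w) = \int[P]_w f w + \int[P]_w g w.
Proof. by move=> hf hg; rewrite RintegralD. Qed.

Lemma expB f g : itg f -> itg g ->
  \int[P]_w (f w - g w) = \int[P]_w f w - \int[P]_w g w.
Proof. by move=> hf hg; rewrite RintegralB. Qed.

Lemma expZ c f : itg f -> \int[P]_w (c * f w) = c * \int[P]_w f w.
Proof. by move=> hf; rewrite RintegralZl. Qed.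

Lemma exp_cst c : \int[P]_w c = c.
Proof.
rewrite Rintegral_cst //; transitivity (c * fine (P setT)) => //.
by rewrite probability_setT mulr1.
Qed.

Lemma exp_le f g : itg f -> itg g -> (forall w, f w <= g w) ->
  \int[P]_w f w <= \int[P]_w g w.
Proof. by move=> hf hg fg; apply: le_Rintegral. Qed.

Lemma exp_norm f : itg f -> `|\int[P]_w f w| <= \int[P]_w `|f w|.
Proof. by move=> hf; apply: le_normr_Rintegral. Qed.

Lemma exp_norm_le f g : itg f -> itg g -> (forall w, `|f w| <= g w) ->
  `|\int[P]_w f w| <= \int[P]_w g w.
Proof.
move=> hf hg fg; apply: le_trans (exp_norm hf) _.
by apply: exp_le => //; exact: itg_norm.
Qed.

Lemma exp_ge0 f : (forall w, 0 <= f w) -> 0 <= \int[P]_w f w.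
Proof. by move=> f0; apply: Rintegral_ge0. Qed.

Lemma exp_sum (I : Type) (r : seq I) (Q : pred I) (F : I -> T -> R) :
  (forall i, Q i -> itg (F i)) ->
  \int[P]_w (\sum_(i <- r | Q i) F i w) = \sum_(i <- r | Q i) \int[P]_w F i w.
Proof.
move=> hF; elim: r => [|i r IH].
  by under eq_Rintegral do rewrite big_nil; rewrite exp_cst big_nil.
under eq_Rintegral do rewrite big_cons.
rewrite big_cons; case: ifP => // Qi; rewrite -IH -expD //; first exact: hF.
exact: itg_sum.
Qed.

Lemma expE f : itg f -> (\int[P]_w (f w)%:E)%E = (\int[P]_w f w)%:E.
Proof. by move=> hf; rewrite /Rintegral fineK //; exact: integrable_fin_num. Qed.

Lemma exp_indic A : measurable A -> \int[P]_w \1_A w = fine (P A).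
Proof. by move=> mA; rewrite /Rintegral integral_indic // setIT. Qed.

Lemma exp_on A f : \int[P]_(w in A) f w = \int[P]_w (\1_A w * f w).
Proof.
rewrite Rintegral_mkcond; apply: eq_Rintegral => w _.
by rewrite patchE indicE; case: ifP; rewrite ?mul1r ?mul0r.
Qed.

Lemma measurable_indicR (A : set T) : measurable A ->
  measurable_fun setT (\1_A : T -> R).
Proof. by move=> mA; exact: measurable_indic. Qed.

(** The form in which convergence in probability acts on bounded functions: [e] is the error off the
    exceptional event [A], and [M] the crude bound on it. *)
Lemma exp_norm_split f A e M : itg f -> measurable A ->
  (forall w, `|f w| <= M) -> (forall w, ~ A w -> `|f w| <= e) -> 0 <= e ->
  \int[P]_w `|f w| <= e + M * fine (P A).
Proof.
move=> hf mA fM fe e0; rewrite -exp_indic //.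
have h1 : itg (\1_A : T -> R).
  apply: (@itg_bounded _ 1); first exact: measurable_indicR.
  by move=> w; rewrite indicE; case: (_ \in _); rewrite ?normr1 ?normr0.
rewrite -[X in X + _]exp_cst -expZ // -expD //; [|exact: itg_cst|exact: itgZ].
apply: exp_le; [exact: itg_norm|by apply: itgD; [exact: itg_cst|exact: itgZ]|].
move=> w; rewrite indicE; have [wA|wA] := boolP (w \in A).
  by rewrite mulr1 (le_trans (fM w)) // lerDr.
by rewrite mulr0 addr0 fe // => /mem_set; exact/negP.
Qed.

Lemma prob_fine_le A B : measurable A -> measurable B -> A `<=` B ->
  fine (P A) <= fine (P B).
Proof.
move=> mA mB AB; apply: fine_le; rewrite ?fin_num_measure //.
by apply: le_measure; rewrite ?inE.
Qed.

Lemma markov_norm f c : itg f -> 0 < c ->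
  fine (P [set w | c <= `|f w|]) <= \int[P]_w `|f w| / c.
Proof.
move=> hf c0; have mA : measurable [set w | c <= `|f w|].
  rewrite (_ : [set w | _] =
      [set: T] `&` (fun w => `|f w|) @^-1` `[c, +oo[%classic).
    apply: measurableT_comp => //; exact: itg_measurable.
  by apply/seteqP; split => w; rewrite /= in_itv /= andbT; [split|case].
rewrite ler_pdivlMr // mulrC -exp_indic // -expZ; last first.
  apply: (@itg_bounded _ 1); first exact: measurable_indicR.
  by move=> w; rewrite indicE; case: (_ \in _); rewrite ?normr1 ?normr0.
apply: exp_le; last 1 first.
- move=> w; rewrite indicE; have [/set_mem /=|wA] := boolP (w \in _).
    by rewrite mulr1.
  by rewrite mulr0.
- apply: itgZ; apply: (@itg_bounded _ 1); first exact: measurable_indicR.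
  by move=> w; rewrite indicE; case: (_ \in _); rewrite ?normr1 ?normr0.
- exact: itg_norm.
Qed.

End expectation.

(** * Taylor bounds for cosine, sine and the exponential *)

Section trigonometry.
Context (R : realType).
Implicit Types (x h c : R).

Lemma sin_mvt x : exists2 c, `|c| <= `|x| & sin x = cos c * x.
Proof.
have pos (y : R) : 0 < y -> exists2 c, `|c| <= `|y| & sin y = cos c * y.
  move=> y0.
  have [|c /itvP cI] := @MVT R sin cos 0 y y0 (fun z _ => is_derive_sin z).
    by apply: continuous_subspaceT => z; exact: continuous_sin.
  rewrite sin0 !subr0 => h; exists c => //.
  by rewrite !ger0_norm ?cI // ltW.
have [x0|x0|x0] := ltgtP 0 x.
- exact: pos.
- have [|c cx h] := pos (- x); first by rewrite oppr_gt0.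
  exists c; first by rewrite -(normrN x).
  by apply: oppr_inj; rewrite -sinN h mulrN.
- by exists 0; rewrite -x0 ?mulr0 ?sin0.
Qed.

Lemma norm_sin_le x : `|sin x| <= `|x|.
Proof.
have [c _ ->] := sin_mvt x; rewrite normrM -[leRHS]mul1r ler_wpM2r //.
exact: cos_max.
Qed.

Lemma cos_half x : cos x = 1 - 2 * sin (x / 2) ^+ 2.
Proof.
have {1}-> : x = x / 2 + x / 2 by rewrite -splitr.
by rewrite cosD -!expr2 cos2sin2; ring.
Qed.

Lemma cos_sub1_le x : `|cos x - 1| <= x ^+ 2 / 2.
Proof.
rewrite cos_half addrAC subrr add0r normrN normrM normrX ger0_norm //.
have h : `|sin (x / 2)| ^+ 2 <= (x / 2) ^+ 2.
  by rewrite -[leRHS]real_normK ?num_real // lerXn2r ?nnegrE // norm_sin_le.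
apply: le_trans (ler_wpM2l _ h) _ => //; rewrite le_eqVlt; apply/orP; left.
by apply/eqP; field.
Qed.

(** With sin x = x cos c and |c| <= |x|, the difference is x (cos c - 1). *)
Lemma sin_sub_le3 x : `|sin x - x| <= `|x| ^+ 3 / 2.
Proof.
have [c cx ->] := sin_mvt x.
rewrite -[X in _ - X]mul1r -mulrBl normrM exprSr mulrAC ler_wpM2r //.
apply: le_trans (cos_sub1_le c) _; rewrite ler_wpM2r ?invr_ge0 //.
by rewrite -[leLHS]real_normK ?num_real // lerXn2r ?nnegrE.
Qed.

Lemma sin_sub_le2 x : `|sin x - x| <= 2 * x ^+ 2.
Proof.
have n0 := normr_ge0 x; have E : x ^+ 2 = `|x| ^+ 2 by rewrite real_normK ?num_real.
have [x1|x1] := lerP `|x| 1.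
  apply: le_trans (sin_sub_le3 x) _; rewrite E.
  by move: (`|x|) n0 x1 => y y0 y1; nra.
apply: le_trans (ler_normB _ _) _; have := norm_sin_le x; rewrite E.
by move: (`|sin x|) (`|x|) x1 => z y y1 zy; nra.
Qed.

Lemma cos_taylor2_le x : `|cos x - 1 + x ^+ 2 / 2| <= `|x| ^+ 3.
Proof.
have [y ->] : exists y, x = 2 * y by exists (x / 2); rewrite mulrC divfK.
rewrite cos_half (_ : 2 * y / 2 = y); last by field.
have -> : 1 - 2 * sin y ^+ 2 - 1 + (2 * y) ^+ 2 / 2 =
    2 * ((y - sin y) * (y + sin y)) by field.
rewrite !normrM (ger0_norm (ler0n _ 2)) exprMn distrC.
have h1 := sin_sub_le2 y; have h2 : `|y + sin y| <= 2 * `|y|.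
  by apply: le_trans (ler_normD _ _) _; have := norm_sin_le y; lra.
have E : y ^+ 2 = `|y| ^+ 2 by rewrite real_normK ?num_real.
rewrite E in h1; have := ler_pM (normr_ge0 _) (normr_ge0 _) h1 h2.
by move: (`|y|) => z; lra.
Qed.

(** The remainder of one expansion is bounded twice, by h^3 here and by h^2 in the next lemma. The
    cubic bound is negligible over n steps when h is of order n^(-1/2); the quadratic one requires
    no third moment of h. *)
Lemma cos_shift_taylor3 c h :
  `|cos (c + h) - (cos c - h * sin c - h ^+ 2 / 2 * cos c)| <= 3 * `|h| ^+ 3.
Proof.
have -> : cos (c + h) - (cos c - h * sin c - h ^+ 2 / 2 * cos c) =
    cos c * (cos h - 1 + h ^+ 2 / 2) - sin c * (sin h - h).
  by rewrite cosD; ring.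
apply: le_trans (ler_normB _ _) _; rewrite !normrM.
have h3 : 0 <= `|h| ^+ 3 by rewrite exprn_ge0.
have := ler_pM (normr_ge0 _) (normr_ge0 _) (cos_max c) (cos_taylor2_le h).
have := ler_pM (normr_ge0 _) (normr_ge0 _) (sin_max c) (sin_sub_le3 h).
lra.
Qed.

Lemma cos_shift_taylor2 c h :
  `|cos (c + h) - (cos c - h * sin c - h ^+ 2 / 2 * cos c)| <= 3 * h ^+ 2.
Proof.
have -> : cos (c + h) - (cos c - h * sin c - h ^+ 2 / 2 * cos c) =
    cos c * (cos h - 1 + h ^+ 2 / 2) - sin c * (sin h - h).
  by rewrite cosD; ring.
apply: le_trans (ler_normB _ _) _; rewrite !normrM.
have h3 : 0 <= h ^+ 2 by rewrite exprn_even_ge0.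
have h2 : `|cos h - 1 + h ^+ 2 / 2| <= h ^+ 2.
  apply: le_trans (ler_normD _ _) _; have := cos_sub1_le h.
  by rewrite (@ger0_norm _ (h ^+ 2 / 2)) ?divr_ge0 //; lra.
have := ler_pM (normr_ge0 _) (normr_ge0 _) (cos_max c) h2.
have := ler_pM (normr_ge0 _) (normr_ge0 _) (sin_max c) (sin_sub_le2 h).
lra.
Qed.

Lemma cos_lip x y : `|cos x - cos y| <= `|x - y|.
Proof.
have -> : cos x - cos y = - 2 * sin ((x - y) / 2) * sin ((x + y) / 2).
  have {1}-> : x = (x + y) / 2 + (x - y) / 2 by field.
  have {3}-> : y = (x + y) / 2 - (x - y) / 2 by field.
  by rewrite cosD cosB; ring.
rewrite !normrM normrN (ger0_norm (ler0n _ 2)).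
have := norm_sin_le ((x - y) / 2); rewrite normrM (@ger0_norm _ 2^-1) ?invr_ge0 //.
have := sin_max ((x + y) / 2).
have := normr_ge0 (sin ((x - y) / 2)); have := normr_ge0 (sin ((x + y) / 2)).
move: (`|sin ((x - y) / 2)|) (`|sin ((x + y) / 2)|) (`|x - y|) => a b e b0 a0 b1 ae.
have ab : a * b <= a by rewrite ler_piMr.
by rewrite -mulrA; lra.
Qed.

(** exp (-y) lies between 1 - y and 1/(1 + y), whose distance is y^2/(1 + y). *)
Lemma expRN_taylor (y : R) : 0 <= y -> `|expR (- y) - (1 - y)| <= y ^+ 2.
Proof.
move=> y0; have l := expR_ge1Dx (- y).
have y1 : 0 < 1 + y by lra.
have u : expR (- y) <= (1 + y)^-1.
  by rewrite expRN lef_pV2 ?posrE ?expR_gt0 //; exact: expR_ge1Dx.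
rewrite ger0_norm; last by rewrite subr_ge0.
suff : (1 + y)^-1 <= 1 - y + y ^+ 2 by lra.
by rewrite -div1r ler_pdivrMr //; nra.
Qed.

End trigonometry.

Section limits_sqrt.
Context (R : realType).

Lemma cvg_invsqrt : (Num.sqrt (n%:R : R))^-1 @[n --> \oo] --> 0.
Proof.
apply/cvgr0Pnorm_le => e e0.
exists (Num.truncn (e^-1 ^+ 2)).+1 => // n /= nN.
have ein : e^-1 ^+ 2 <= n%:R.
  by rewrite (le_trans (ltW (truncnS_gt _))) // ler_nat.
have h : e^-1 <= Num.sqrt n%:R.
  by rewrite -[leLHS]ger0_norm ?invr_ge0 ?(ltW e0) // -sqrtr_sqr ler_wsqrtr.
have s0 : 0 < Num.sqrt (n%:R : R) by rewrite (lt_le_trans _ h) // invr_gt0.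
by rewrite ger0_norm ?invr_ge0 ?(ltW s0) // -[leRHS]invrK lef_pV2 // posrE ?invr_gt0.
Qed.

(** [D] may depend on [e]: truncation levels and lags are fixed before n grows, and the part of the
    error that depends on them is then of order n^(-1/2). *)
Lemma cvg_approx (u v : nat -> R) (l : R) : v n @[n --> \oo] --> l ->
  (forall e, 0 < e -> exists D N, forall n, (N <= n)%N ->
    `|u n - v n| <= e + D / Num.sqrt n%:R) ->
  u n @[n --> \oo] --> l.
Proof.
move=> vl h; apply/cvgrPdist_le => e e0.
have e30 : 0 < e / 3 by rewrite divr_gt0.
have [D [N hN]] := h _ e30.
have /cvgrPdist_le/(_ _ e30)[N1 _ h1] := vl.
have /cvgr0Pnorm_le/(_ _ e30)[N2 _ h2] : D / Num.sqrt (n%:R : R) @[n --> \oo] --> 0.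
  by rewrite -(mulr0 D); apply: cvgMr; exact: cvg_invsqrt.
exists (maxn N (maxn N1 N2)) => // n /=; rewrite !geq_max => /and3P[nN n1 n2].
rewrite (le_trans (ler_distD (v n) _ _)) //.
have := h1 n n1; have := hN n nN; have := h2 n n2; rewrite /= (distrC (v n)).
by move=> /(le_trans (ler_norm _)); lra.
Qed.

End limits_sqrt.

Section more_expectation.
Context d (T : measurableType d) (R : realType) (P : probability T R).

Lemma exp_dominated (f : nat -> T -> R) (F g : T -> R) :
  (forall n, measurable_fun setT (f n)) -> measurable_fun setT F -> itg P g ->
  (forall w, f n w @[n --> \oo] --> F w) -> (forall n w, `|f n w| <= g w) ->
  \int[P]_w f n w @[n --> \oo] --> \int[P]_w F w.
Proof.
move=> mf mF hg fF fg.
have [] := @dominated_convergence _ T R P setT measurableT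
  (fun n w => (f n w)%:E) (fun w => (F w)%:E) (fun w => (g w)%:E).
- by move=> n; exact/measurable_EFinP.
- exact/measurable_EFinP.
- by apply: aeW => w _; apply: cvg_EFin; [exact: nearW|exact: fF].
- exact: hg.
- by apply: aeW => w n _; rewrite /= lee_fin.
by move=> hF _; rewrite (expE hF) => /fine_cvg.
Qed.

Lemma truncation_cvg (N : T -> nat) (f : T -> R) : nat_rv N -> itg P f ->
  \int[P]_w (\1_[set v | N v <= C]%N w * f w) @[C --> \oo] --> \int[P]_w f w.
Proof.
move=> mN hf; apply: (exp_dominated _ _ (itg_norm hf)).
- move=> C; apply: measurable_funM; last exact: itg_measurable hf.
  apply: measurable_indic; exact: (nat_rv_preimage (fun v => (v <= C)%N) mN).
- exact: itg_measurable hf.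
- move=> w; apply: cvg_near_cst; exists (N w) => // C /= NC.
  by rewrite indicE mem_set // mul1r.
- move=> C w; rewrite normrM indicE ler_piMl //.
  by case: (_ \in _); rewrite ?normr1 ?normr0.
Qed.

(** Monotone convergence along the truncations N <= C. *)
Lemma itg_truncation (N : T -> nat) (f : T -> R) A : nat_rv N ->
  measurable_fun setT f -> (forall w, 0 <= f w) ->
  (forall C, itg P (fun w => \1_[set v | N v <= C]%N w * f w)) ->
  (forall C, \int[P]_w (\1_[set v | N v <= C]%N w * f w) <= A) ->
  itg P f.
Proof.
move=> mN mf f0 hC hA; apply: itg_ge0 => //.
apply: le_lt_trans (ltry A).
have lf w : limn (fun C => (\1_[set v | N v <= C]%N w * f w)%:E) = (f w)%:E.
  apply/cvg_lim => //; apply: cvg_near_cst; exists (N w) => // C /= NC.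
  by rewrite indicE mem_set // mul1r.
rewrite -(eq_integral _ _ (fun w _ => lf w)).
rewrite monotone_convergence //.
- apply: lime_le; last first.
    by apply: nearW => C; rewrite (expE (hC C)) lee_fin.
  apply: ereal_nondecreasing_is_cvgn => C C' CC'.
  apply: ge0_le_integral => //.
  + by move=> w _; rewrite lee_fin mulr_ge0 // indicE.
  + exact: (measurable_int P (hC C)).
  + exact: (measurable_int P (hC C')).
  + move=> w _; rewrite lee_fin ler_wpM2r // !indicE ler_nat.
    have [/set_mem /= h|//] := boolP (w \in [set v | (N v <= C)%N]).
    by rewrite mem_set //= (leq_trans h).
- by move=> C; exact: (measurable_int P (hC C)).
- by move=> C w _; rewrite lee_fin mulr_ge0 // indicE.
- move=> w _ C C' CC'; rewrite lee_fin ler_wpM2r // !indicE ler_nat.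
  have [/set_mem /= h|//] := boolP (w \in [set v | (N v <= C)%N]).
  by rewrite mem_set //= (leq_trans h).
Qed.

Lemma itg_pow (N : T -> nat) p : (forall f : nat -> R, measurable_fun setT (f \o N)) ->
  (p <= 3)%N -> itg P (fun w => (N w)%:R ^+ 3) -> itg P (fun w => (N w)%:R ^+ p).
Proof.
move=> mN p3 h3.
apply: (itg_le (mN (fun n => n%:R ^+ p)) (itgD (itg_cst P 1) h3)) => w.
rewrite ger0_norm ?exprn_ge0 //= -!natrX -[X in X + _]/(1%:R) -natrD ler_nat.
case: (N w) => [|n]; first by case: p p3 => // p _; rewrite exp0n.
by rewrite (leq_trans (leq_pexp2l _ p3)) // leq_addl.
Qed.

End more_expectation.

(** * Linear recursions with a contracting factor *)

Section recursions.
Context (R : realType).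
Implicit Types (u e : nat -> R).

Lemma rec_bounded u rho b : 0 <= rho < 1 -> 0 <= b -> 0 <= u 0%N ->
  (forall k, u k.+1 <= rho * u k + b) -> forall k, u k <= u 0%N + b / (1 - rho).
Proof.
move=> /andP[r0 r1] b0 u0 h; have r1' : 0 < 1 - rho by rewrite subr_gt0.
elim=> [|k IH]; first by rewrite lerDl divr_ge0 // ltW.
apply: le_trans (h k) _.
have -> : u 0%N + b / (1 - rho) = (rho * (u 0%N + b / (1 - rho)) + b) +
   (1 - rho) * u 0%N by field; rewrite gt_eqF.
rewrite -[leLHS]addr0 lerD ?mulr_ge0 ?(ltW r1') // lerD2r.
by rewrite ler_wpM2l.
Qed.

Lemma rec_cvg0 u e rho : 0 <= rho < 1 -> (forall k, u k.+1 = rho * u k + e k) ->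
  e n @[n --> \oo] --> 0 -> u n @[n --> \oo] --> 0.
Proof.
move=> /andP[r0 r1] h e0; have r1' : 0 < 1 - rho by rewrite subr_gt0.
apply/cvgr0Pnorm_le => eps eps0.
(* A forcing term of at most (1 - rho) eps/2 adds up along the geometric series to at most eps/2. *)
have d0 : 0 < (1 - rho) * (eps / 2) by rewrite mulr_gt0 // divr_gt0.
have /cvgr0Pnorm_le/(_ _ d0)[N _ hN] := e0.
have b j : `|u (N + j)%N| <= rho ^+ j * `|u N| + eps / 2.
  elim: j => [|j IH]; first by rewrite addn0 expr0 mul1r lerDl divr_ge0 // ltW.
  rewrite addnS h (le_trans (ler_normD _ _)) // normrM (ger0_norm r0).
  have := hN (N + j)%N (leq_addr _ _); move: IH.
  move: (`|u (N + j)%N|) (`|e (N + j)%N|) => x y /(ler_wpM2l r0) IH hy.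
  apply: le_trans (lerD IH hy) _; rewrite exprS; lra.
have /cvgr0Pnorm_le : rho ^+ j * `|u N| @[j --> \oo] --> 0.
  rewrite -[X in _ --> X](mul0r `|u N|); apply: cvgMl.
  by apply: cvg_expr; rewrite ger0_norm.
have e2 : 0 < eps / 2 by rewrite divr_gt0.
move=> /(_ _ e2)[J _ hJ]; exists (N + J)%N => // n /= Nn.
have -> : n = (N + (n - N))%N by rewrite subnKC // (leq_trans (leq_addr _ _) Nn).
apply: le_trans (b _) _.
have hh : `|rho ^+ (n - N) * `|u N| | <= eps / 2.
  by apply: hJ; rewrite /= leq_subRL // (leq_trans (leq_addr _ _) Nn).
rewrite [leRHS]splitr lerD //; exact: le_trans (ler_norm _) hh.
Qed.

Lemma cvg_dist_le u c l : (forall k, `|u k - l| <= c k) ->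
  c n @[n --> \oo] --> 0 -> u n @[n --> \oo] --> l.
Proof.
move=> h c0; apply/cvgrPdist_le => eps eps0.
have /cvgr0Pnorm_le/(_ _ eps0)[N _ hN] := c0.
exists N => // n Nn; rewrite distrC (le_trans (h n)) // (le_trans (ler_norm _)) //.
exact: hN.
Qed.

Lemma cvg_to_le u l B : u n @[n --> \oo] --> l -> (forall k, u k <= B) -> l <= B.
Proof.
move=> h uB; apply: (closed_cvg (fun x => x <= B)) h.
  exact: closed_le.
exact: nearW.
Qed.

End recursions.

(** The history as a list takes countably many values; the Markov property, the weights and the
    conditioning event are all expressed through it. *)
Definition path_of (T : Type) (X : nat -> T -> nat) (k : nat) (w : T) : seq nat :=
  [seq X i w | i <- iota 0 k.+1].

Lemma nth_path_of (T : Type) (X : nat -> T -> nat) k i w : (i <= k)%N ->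
  nth 0%N (path_of X k w) i = X i w.
Proof.
by move=> ik; rewrite (nth_map 0%N) ?size_iota // nth_iota.
Qed.

Lemma take_path_of (T : Type) (X : nat -> T -> nat) k i w : (i <= k)%N ->
  take i.+1 (path_of X k w) = path_of X i w.
Proof.
by move=> ik; rewrite /path_of -map_take take_iota; congr map; rewrite (minn_idPl _).
Qed.

(** * Ergodicity and central limit theorem *)

Section ergodic.
Context d (T : measurableType d) (R : realType) (P : probability T R).
Context (alpha : R) (W X : nat -> T -> nat) (Q : probability nat R).
Notation path := (path_of X).
(** The chain enters only through these hypotheses, in which [W x] models the state that follows
    [x]. [WS] is the coupling of neighbouring states: the conditional moments and the contraction of
    the kernel are both derived from it, without the binomial law. *)
Hypothesis a01 : 0 < alpha < 1.
Hypothesis mW : forall x, nat_rv (W x).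
Hypothesis pathM : forall k (f : seq nat -> R),
  measurable_fun setT (fun w => f (path k w)).
Hypothesis markov : forall k (G : seq nat -> nat -> \bar R),
  (forall p v, 0 <= G p v)%E ->
  (\int[P]_w G (path k w) (X k.+1 w) =
   \int[P]_w \int[P]_w' G (path k w) (W (X k w) w'))%E.
Hypothesis WS : forall x (g : nat -> \bar R), (forall v, 0 <= g v)%E ->
  (\int[P]_w g (W x.+1 w) =
   \int[P]_w (alpha%:E * g (W x w).+1 + (1 - alpha)%:E * g (W x w)))%E.
Hypothesis stat : forall g : nat -> \bar R, (forall n, 0 <= g n)%E ->
  (\int[Q]_n \int[P]_w g (W n w) = \int[Q]_n g n)%E.
Hypothesis W3 : itg P (fun w => (W 0 w)%:R ^+ 3).
Hypothesis X3 : itg P (fun w => (X 0 w)%:R ^+ 3).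

Let a0 : 0 < alpha. Proof. by case/andP: a01. Qed.
Let a1 : alpha < 1. Proof. by case/andP: a01. Qed.

Lemma path_itg k (f : seq nat -> R) M : (forall p, `|f p| <= M) ->
  itg P (fun w => f (path k w)).
Proof. by move=> fM; apply: (@itg_bounded _ _ _ _ _ M). Qed.

Lemma XM k (f : nat -> R) : measurable_fun setT (fun w => f (X k w)).
Proof.
apply: eq_measurable_fun (pathM k (fun p => f (nth 0%N p k))) => w _.
by rewrite nth_path_of.
Qed.

Lemma X_itg k (f : nat -> R) M : (forall p, `|f p| <= M) ->
  itg P (fun w => f (X k w)).
Proof. by move=> fM; apply: (@itg_bounded _ _ _ _ _ M) => //; exact: XM. Qed.

Lemma WM x (f : nat -> R) : measurable_fun setT (fun w => f (W x w)).
Proof. exact: (nat_rv_measurable f (mW x)). Qed.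

Lemma W_itg x (f : nat -> R) M : (forall p, `|f p| <= M) ->
  itg P (fun w => f (W x w)).
Proof. by move=> fM; apply: (@itg_bounded _ _ _ _ _ M) => //; exact: WM. Qed.

Lemma Q_itg (f : nat -> R) M : (forall p, `|f p| <= M) -> itg Q f.
Proof. by move=> fM; apply: (@itg_bounded _ _ _ _ _ M). Qed.

Definition K (g : nat -> R) (x : nat) : R := \int[P]_w g (W x w).

Let shift_ge0 (M y : R) : `|y| <= M -> 0 <= y + M.
Proof. by rewrite ler_norml => /andP[h _]; rewrite -lerBlDr sub0r. Qed.

(** Adding M makes a bounded function nonnegative, so that [markov] applies; the constant is
    cancelled afterwards. *)
Lemma markov_bounded k (F : seq nat -> nat -> R) M : (forall p v, `|F p v| <= M) ->
  \int[P]_w F (path k w) (X k.+1 w) =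
  \int[P]_w \int[P]_w' F (path k w) (W (X k w) w').
Proof.
move=> FM.
have bW p x : itg P (fun w' => F p (W x w')) := W_itg x (FM p).
have i1 : itg P (fun w => F (path k w) (X k.+1 w)).
  apply: (@itg_bounded _ _ _ _ _ M) => //.
  apply: eq_measurable_fun
    (pathM k.+1 (fun p => F (take k.+1 p) (nth 0%N p k.+1))) => w _.
  by rewrite nth_path_of // take_path_of.
have i2 : itg P (fun w => \int[P]_w' F (path k w) (W (X k w) w')).
  apply: (@itg_bounded _ _ _ _ _ M).
    apply: eq_measurable_fun (pathM k
     (fun p => \int[P]_w' F p (W (nth 0%N p k) w'))) => w _.
    by rewrite nth_path_of.
  move=> w; rewrite -[leRHS](exp_cst P M).
  by apply: exp_norm_le => //; exact: itg_cst.
have cM := itg_cst P M.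
have E1 : (\int[P]_w \int[P]_w' (F (path k w) (W (X k w) w') + M)%:E =
    ((\int[P]_w \int[P]_w' F (path k w) (W (X k w) w')) + M)%:E)%E.
  transitivity (\int[P]_w ((\int[P]_w' F (path k w) (W (X k w) w') + M)%R)%:E)%E.
    apply: eq_integral => w _; rewrite expE; last exact: itgD.
    by rewrite expD // exp_cst.
  by rewrite expE ?expD ?exp_cst //; exact: itgD.
have := @markov k (fun p v => (F p v + M)%:E) (fun p v => shift_ge0 (FM p v)).
rewrite E1 expE; last exact: itgD.
by rewrite expD // exp_cst => -[] /addIr.
Qed.

Lemma K_bounded g M x : (forall y, `|g y| <= M) -> `|K g x| <= M.
Proof.
move=> gM; rewrite -[leRHS](exp_cst P M); apply: exp_norm_le => //.
- exact: W_itg gM.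
- exact: itg_cst.
Qed.

Lemma WS_real x (g : nat -> R) : (forall v, 0 <= g v) ->
  itg P (fun w => g (W x w)) -> itg P (fun w => g (W x w).+1) ->
  itg P (fun w => g (W x.+1 w)) /\
  \int[P]_w g (W x.+1 w) =
    alpha * \int[P]_w g (W x w).+1 + (1 - alpha) * \int[P]_w g (W x w).
Proof.
move=> g0 i1 i2.
have E := @WS x (fun v => (g v)%:E) (fun v => g0 v).
have E' : (\int[P]_w (g (W x.+1 w))%:E = (alpha * \int[P]_w g (W x w).+1 +
    (1 - alpha) * \int[P]_w g (W x w))%:E)%E.
  rewrite E -expZ // -(expZ _ i1) -expD; [|exact: itgZ|exact: itgZ].
  by rewrite -expE //; apply: itgD; exact: itgZ.
have i3 : itg P (fun w => g (W x.+1 w)).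
  by apply: itg_ge0; [exact: WM|by []|rewrite E' ltry].
by split => //; apply: EFin_inj; rewrite -expE.
Qed.

Lemma K_diff g M x : (forall y, `|g y| <= M) ->
  K g x.+1 - K g x = alpha * \int[P]_w (g (W x w).+1 - g (W x w)).
Proof.
move=> gM; have i1 := W_itg x gM.
have i2 : itg P (fun w => g (W x w).+1) by apply: (W_itg x (f := fun y => g y.+1)).
have c := itg_cst P M.
have [_ h] := @WS_real x (fun v => g v + M) (fun v => shift_ge0 (gM v)) (itgD i1 c)
  (itgD i2 c).
have i3 := W_itg x.+1 gM.
rewrite (expD i1 c) (expD i2 c) (expD i3 c) !exp_cst in h.
by rewrite expB // /K; apply: (addIr (\int[P]_w g (W x w) + M)); rewrite addrA subrK h; ring.
Qed.

(** By [K_diff] an increment of [K g] is alpha times a mean of increments of [g]: with probability 1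
    - alpha the additional individual leaves no trace. *)
Lemma K_lip g M L : (forall y, `|g y| <= M) -> (forall y, `|g y.+1 - g y| <= L) ->
  forall x, `|K g x.+1 - K g x| <= alpha * L.
Proof.
move=> gM gL x; rewrite (K_diff _ gM) normrM (gtr0_norm a0) ler_pM2l //.
rewrite -[leRHS](exp_cst P L); apply: exp_norm_le => //; last exact: itg_cst.
apply: itgB; first exact: (W_itg x (f := fun y => g y.+1)).
exact: W_itg gM.
Qed.

Lemma iterK_bounded m g M x : (forall y, `|g y| <= M) -> `|iter m K g x| <= M.
Proof.
by move=> gM; elim: m x => [|m IH] x //; rewrite iterS; exact: K_bounded.
Qed.

Lemma iterK_lip m g M : (forall y, `|g y| <= M) ->
  forall x, `|iter m K g x.+1 - iter m K g x| <= alpha ^+ m * (2 * M).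
Proof.
move=> gM; elim: m => [|m IH] x.
  (* A function bounded by M is Lipschitz on the integers with constant 2 M. *)
  by rewrite expr0 mul1r mulr_natl mulr2n (le_trans (ler_normB _ _)) // lerD.
rewrite exprS -mulrA; apply: (K_lip (M := M)) => // y.
exact: iterK_bounded.
Qed.

(** Passing through 0 gives x + y instead of |x - y|, which is enough since first moments are
    finite. *)
Lemma lip_dist (g : nat -> R) L x y : (forall y, `|g y.+1 - g y| <= L) ->
  `|g x - g y| <= L * (x%:R + y%:R).
Proof.
move=> gL; have h z : `|g z - g 0%N| <= L * z%:R.
  elim: z => [|z IH]; first by rewrite subrr normr0 mulr0.
  rewrite -(subrK (g z) (g z.+1)) -addrA (le_trans (ler_normD _ _)) //.
  by rewrite -natr1 mulrDr mulr1 [leRHS]addrC lerD.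
rewrite (le_trans (ler_distD (g 0%N) _ _)) // mulrDr lerD //.
by rewrite distrC.
Qed.

Lemma stat_bounded g M : (forall y, `|g y| <= M) ->
  \int[Q]_n K g n = \int[Q]_n g n.
Proof.
move=> gM.
have c := itg_cst P M; have cQ := itg_cst Q M.
have i1 : itg Q (K g) by apply: (@Q_itg _ M) => n; exact: K_bounded.
have i2 : itg Q g := Q_itg gM.
have E1 : (\int[Q]_n \int[P]_w (g (W n w) + M)%:E = (\int[Q]_n K g n + M)%:E)%E.
  transitivity (\int[Q]_n (K g n + M)%:E)%E.
    apply: eq_integral => n _; have h := W_itg n gM.
    by rewrite expE ?expD ?exp_cst //; exact: itgD.
  by rewrite expE ?expD ?exp_cst //; exact: itgD.
have := @stat (fun v => (g v + M)%:E) (fun v => shift_ge0 (gM v)).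
rewrite E1 expE; last exact: itgD.
by rewrite expD // exp_cst => -[] /addIr.
Qed.

Lemma stat_iter m g M : (forall y, `|g y| <= M) ->
  \int[Q]_n iter m K g n = \int[Q]_n g n.
Proof.
move=> gM; elim: m => [|m IH] //=; rewrite -IH.
by apply: (@stat_bounded _ M) => y; exact: iterK_bounded.
Qed.

(** The weight sees the path up to [k] only, so each of the [m] later steps acts on [g] alone, as
    one application of the kernel. *)
Lemma markov_iter k m (F : seq nat -> R) MF (g : nat -> R) M :
  (forall p, `|F p| <= MF) -> (forall y, `|g y| <= M) ->
  \int[P]_w (F (path k w) * g (X (k + m) w)) =
  \int[P]_w (F (path k w) * iter m K g (X k w)).
Proof.
move=> FM; elim: m g => [|m IH] g gM; first by rewrite addn0.
rewrite iterSr -IH; last by move=> y; exact: K_bounded.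
transitivity (\int[P]_w (F (take k.+1 (path (k + m) w)) * g (X (k + m).+1 w))).
  by apply: eq_Rintegral => w _; rewrite addnS take_path_of // leq_addr.
rewrite (@markov_bounded _ (fun p v => F (take k.+1 p) * g v) (MF * M)).
  apply: eq_Rintegral => w _; rewrite take_path_of ?leq_addr //.
  by rewrite expZ //; exact: W_itg gM.
by move=> p v; rewrite normrM ler_pM.
Qed.

Let e1 := \int[P]_w (W 0 w)%:R.
Let e2 := \int[P]_w (W 0 w)%:R ^+ 2.
Let e3 := \int[P]_w (W 0 w)%:R ^+ 3.

(** The first three conditional moments of the next state, as polynomials in the present one. They
    solve the recursion in x that [WS] imposes, starting from the moments of the innovation
    [W 0]. *)
Definition q1 (x : R) := e1 + alpha * x.
Definition q2 (x : R) :=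
  alpha ^+ 2 * x ^+ 2 + (2 * alpha * e1 + alpha - alpha ^+ 2) * x + e2.
Definition q3 (x : R) := alpha ^+ 3 * x ^+ 3
  + (3 * alpha ^+ 2 * (e1 + 1 - alpha)) * x ^+ 2
  + (2 * alpha ^+ 3 - 3 * alpha ^+ 2 * e1 - 3 * alpha ^+ 2 + 3 * alpha * e2
     + 3 * alpha * e1 + alpha) * x + e3.

Lemma W_pow x p : (p <= 3)%N -> itg P (fun w => (W x w)%:R ^+ 3) ->
  itg P (fun w => (W x w)%:R ^+ p).
Proof. by move=> p3 h3; apply: itg_pow => // f; exact: WM. Qed.

Lemma W_moments x : [/\ itg P (fun w => (W x w)%:R ^+ 3),
  \int[P]_w (W x w)%:R = q1 x%:R, \int[P]_w (W x w)%:R ^+ 2 = q2 x%:R &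
  \int[P]_w (W x w)%:R ^+ 3 = q3 x%:R].
Proof.
elim: x => [|x [i3 E1 E2 E3]].
  by split => //; rewrite /q1 /q2 /q3 ?expr0n /= ?mulr0 ?addr0 ?add0r.
have i1 : itg P (fun w => (W x w)%:R) := W_pow (p := 1) isT i3.
have i2 := W_pow (p := 2) isT i3.
have c := itg_cst P 1.
have j1 : itg P (fun w => (W x w).+1%:R).
  by under eq_fun do rewrite -natr1; exact: itgD.
have s2 (n : nat) : n.+1%:R ^+ 2 = n%:R ^+ 2 + (2 * n%:R + 1) :> R.
  by rewrite -natr1; ring.
have s3 (n : nat) : n.+1%:R ^+ 3 = n%:R ^+ 3 + (3 * n%:R ^+ 2 + (3 * n%:R + 1)) :> R.
  by rewrite -natr1; ring.
have t2 : itg P (fun w => 2 * (W x w)%:R + 1) by apply: itgD => //; exact: itgZ.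
have t3 : itg P (fun w => 3 * (W x w)%:R + 1) by apply: itgD => //; exact: itgZ.
have t3' : itg P (fun w => 3 * (W x w)%:R ^+ 2 + (3 * (W x w)%:R + 1)).
  by apply: itgD => //; exact: itgZ.
have j2 : itg P (fun w => (W x w).+1%:R ^+ 2).
  by under eq_fun do rewrite s2; exact: itgD.
have j3 : itg P (fun w => (W x w).+1%:R ^+ 3).
  by under eq_fun do rewrite s3; exact: itgD.
have F1 : \int[P]_w (W x w).+1%:R = q1 x%:R + 1.
  by under eq_Rintegral do rewrite -natr1; rewrite expD // exp_cst E1.
have F2 : \int[P]_w (W x w).+1%:R ^+ 2 = q2 x%:R + (2 * q1 x%:R + 1).
  under eq_Rintegral do rewrite s2.
  by rewrite expD // expD ?expZ ?exp_cst ?E1 ?E2 //; exact: itgZ.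
have F3 : \int[P]_w (W x w).+1%:R ^+ 3 =
    q3 x%:R + (3 * q2 x%:R + (3 * q1 x%:R + 1)).
  under eq_Rintegral do rewrite s3.
  rewrite expD // expD ?expZ // ?E2 ?E3; last exact: itgZ.
  by rewrite expD ?expZ ?exp_cst ?E1 //; exact: itgZ.
have [_ ->] := @WS_real x (fun n => n%:R) (fun n => ler0n _ n) i1 j1.
have [_ ->] := @WS_real x (fun n => n%:R ^+ 2) (fun n => exprn_ge0 2 (ler0n _ n)) i2 j2.
have [-> ->] := @WS_real x (fun n => n%:R ^+ 3) (fun n => exprn_ge0 3 (ler0n _ n)) i3 j3.
rewrite F1 F2 F3 E1 E2 E3 -natr1; split => //; rewrite /q1 /q2 /q3; ring.
Qed.

Lemma e_ge0 : [/\ 0 <= e1, 0 <= e2 & 0 <= e3].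
Proof. by split; apply: exp_ge0 => w; rewrite ?exprn_ge0. Qed.

(* Truncate, iterate the kernel and use stationarity. *)
Lemma Q_itg1 : itg Q (fun n => n%:R).
Proof.
have a1' : 0 < 1 - alpha by rewrite subr_gt0.
have [e10 _ _] := e_ge0.
(* The fixed point of x -> e1 + alpha x, which is the value expected for the stationary mean. *)
pose A := e1 / (1 - alpha); have A0 : 0 <= A by rewrite divr_ge0 // ltW.
have c1 n : itg Q (fun y => ((n < y)%N)%:R : R).
  by apply: (@Q_itg _ 1) => y; rewrite normr_nat; case: (n < y)%N.
have tail : \int[Q]_n ((N < n)%N)%:R @[N --> \oo] --> (0 : R).
  have := @truncation_cvg _ _ R Q (fun n => n) (fun=> 1) (fun m => I) (itg_cst Q 1).
  rewrite exp_cst => h; rewrite -(subrr 1).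
  have : 1 - \int[Q]_n (\1_[set v | v <= N]%N n * 1) @[N --> \oo] --> (1 - 1 : R).
    by apply: cvgB => //; exact: cvg_cst.
  apply: cvg_trans; apply: near_eq_cvg; apply: nearW => N /=.
  rewrite -[X in X - _](exp_cst Q) -expB; [|exact: itg_cst|]; last first.
    apply: (@Q_itg _ 1) => y; rewrite mulr1 indicE normr_nat.
    by case: (_ \in _).
  apply: eq_Rintegral => n _; rewrite mulr1 indicE ltnNge.
  have [h'|h'] := boolP (n <= N)%N; first by rewrite mem_set // subrr.
  by rewrite memNset ?subr0 //; apply/negP.
have bound (C : nat) : \int[Q]_n (minn n C)%:R <= A.
  pose h (n : nat) : R := (minn n C)%:R.
  have hC y : `|h y| <= C%:R by rewrite normr_nat ler_nat geq_minr.
  (* Since h n <= n, iterating the affine conditional mean bounds K^m h from above, and the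
     dependence on x dies out like alpha^m. *)
  have key m x : iter m K h x <= A * (1 - alpha ^+ m) + alpha ^+ m * x%:R.
    elim: m x => [|m IH] x; first by rewrite expr0 subrr mulr0 add0r mul1r ler_nat geq_minl.
    have [i3 E1 _ _] := W_moments x.
    have i1 : itg P (fun w => (W x w)%:R) := W_pow (p := 1) isT i3.
    have cA := itg_cst P (A * (1 - alpha ^+ m)).
    have : iter m.+1 K h x <=
        \int[P]_w (A * (1 - alpha ^+ m) + alpha ^+ m * (W x w)%:R).
      apply: exp_le => //.
      - by apply: W_itg => y; exact: (iterK_bounded m y hC).
      - by apply: itgD => //; exact: itgZ.
      - by move=> w; exact: IH.
    rewrite (expD cA (itgZ _ i1)) exp_cst (expZ _ i1) E1.
    move/le_trans; apply; rewrite /q1 /A exprS le_eqVlt; apply/orP; left.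
    by apply/eqP; field; rewrite gt_eqF.
  apply/ler_addgt0Pr => eps eps0.
  have e20 : 0 < eps / 2 by rewrite divr_gt0.
  have : \int[Q]_n ((N < n)%N)%:R * C%:R @[N --> \oo] --> (0 : R).
    by rewrite -[X in _ --> X](mul0r C%:R); apply: cvgMl.
  move=> /cvgr0Pnorm_le/(_ _ e20)[N _ /(_ N (leqnn N)) hN].
  have : alpha ^+ m * N%:R @[m --> \oo] --> (0 : R).
    rewrite -[X in _ --> X](mul0r N%:R); apply: cvgMl.
    by apply: cvg_expr; rewrite gtr0_norm.
  move=> /cvgr0Pnorm_le/(_ _ e20)[m _ /(_ m (leqnn m)) hm].
  rewrite -(stat_iter m hC).
  (* States up to N are covered by [key]; above N the iterate is at most C and the mass under Q is
     small. *)
  apply: (@le_trans _ _ (\int[Q]_n (A + alpha ^+ m * N%:R + C%:R * ((N < n)%N)%:R))).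
    apply: exp_le.
    - by apply: (@Q_itg _ C%:R) => n; exact: iterK_bounded.
    - by apply: itgD; [exact: itg_cst|exact: itgZ].
    - move=> n; have am0 : 0 <= alpha ^+ m by rewrite exprn_ge0 // ltW.
      have [Nn|nN] := ltnP N n.
        rewrite mulr1 (le_trans (ler_norm _)) // (le_trans (iterK_bounded m n hC)) //.
        by rewrite lerDr addr_ge0 // mulr_ge0.
      rewrite mulr0 addr0 (le_trans (key _ _)) // lerD //; last first.
        by rewrite ler_wpM2l // ler_nat.
      by rewrite ler_piMr // lerBlDr lerDl.
  rewrite expD ?exp_cst ?expZ //; [|exact: itg_cst|exact: itgZ].
  rewrite -addrA lerD2l [leRHS]splitr lerD //.
    by rewrite (le_trans (ler_norm _)).
  by rewrite mulrC (le_trans (ler_norm _)).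
have mi (f : nat -> R) : measurable_fun setT f by [].
have ib (C : nat) : itg Q (fun n => \1_[set v | v <= C]%N n * n%:R).
  apply: (@Q_itg _ C%:R) => n; rewrite indicE.
  have [/set_mem /= h|_] := boolP (n \in _); last by rewrite mul0r normr0.
  by rewrite mul1r normr_nat ler_nat.
apply: (@itg_truncation _ _ R Q (fun n => n) (fun n => n%:R) A) => // C.
apply: le_trans (bound C); apply: exp_le => //.
  by apply: (@Q_itg _ C%:R) => n; rewrite normr_nat ler_nat geq_minr.
move=> n; rewrite indicE.
have [/set_mem /= h|_] := boolP (n \in _); last by rewrite mul0r.
by rewrite mul1r ler_nat leq_min leqnn h.
Qed.

Let m1 := \int[Q]_n n%:R.

(** By stationarity the mean of g is that of K^m g, so the difference is the average over n of K^m g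
    x - K^m g n, where K^m g has Lipschitz constant 2 M alpha^m. *)
Lemma K_ergodic g M m x : (forall y, `|g y| <= M) ->
  `|iter m K g x - \int[Q]_n g n| <= alpha ^+ m * (2 * M) * (x%:R + m1).
Proof.
move=> gM; have cx := itg_cst Q (iter m K g x).
have ci : itg Q (fun n => iter m K g n) by apply: (@Q_itg _ M) => n; exact: iterK_bounded.
rewrite -(stat_iter m gM) -[X in X - _](exp_cst Q) -expB //.
have h : itg Q (fun n => alpha ^+ m * (2 * M) * (x%:R + n%:R)).
  by apply: itgZ; apply: itgD; [exact: itg_cst|exact: Q_itg1].
have -> : alpha ^+ m * (2 * M) * (x%:R + m1) =
    \int[Q]_n (alpha ^+ m * (2 * M) * (x%:R + n%:R)).
  rewrite expZ; last by apply: itgD; [exact: itg_cst|exact: Q_itg1].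
  by rewrite expD ?exp_cst //; [exact: itg_cst|exact: Q_itg1].
apply: exp_norm_le => //; first exact: itgB.
by move=> n; apply: lip_dist; exact: iterK_lip.
Qed.

Lemma last_path_of k w : nth 0%N (path k w) k = X k w.
Proof. exact: nth_path_of. Qed.

Lemma path_stepM k (G : seq nat -> nat -> R) :
  measurable_fun setT (fun w => G (path k w) (X k.+1 w)).
Proof.
apply: eq_measurable_fun
  (pathM k.+1 (fun p => G (take k.+1 p) (nth 0%N p k.+1))) => w _.
by rewrite nth_path_of // take_path_of.
Qed.

(** For unbounded functions, integrability of the conditional mean yields integrability of the
    function; this is how moments propagate along the chain. *)
Lemma markov_ge0 k (G : seq nat -> nat -> R) : (forall p v, 0 <= G p v) ->
  (forall p x, itg P (fun w => G p (W x w))) ->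
  itg P (fun w => \int[P]_w' G (path k w) (W (X k w) w')) ->
  itg P (fun w => G (path k w) (X k.+1 w)) /\
  \int[P]_w G (path k w) (X k.+1 w) =
  \int[P]_w \int[P]_w' G (path k w) (W (X k w) w').
Proof.
move=> G0 iW iK.
have E : (\int[P]_w (G (path k w) (X k.+1 w))%:E =
    (\int[P]_w \int[P]_w' G (path k w) (W (X k w) w'))%:E)%E.
  rewrite -expE // (@markov k (fun p v => (G p v)%:E)) => [|p v]; last first.
    by rewrite lee_fin.
  by apply: eq_integral => w _; rewrite expE.
have i : itg P (fun w => G (path k w) (X k.+1 w)).
  by apply: itg_ge0; [exact: path_stepM|by []|rewrite E ltry].
by split => //; apply: EFin_inj; rewrite -expE.
Qed.

Lemma X_pow k p : (p <= 3)%N -> itg P (fun w => (X k w)%:R ^+ 3) ->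
  itg P (fun w => (X k w)%:R ^+ p).
Proof. by move=> p3 h3; apply: itg_pow => // f; exact: XM. Qed.

Definition qp (p : nat) : R -> R :=
  match p with 1 => q1 | 2 => q2 | _ => q3 end.

Lemma K_pow p x : (0 < p <= 3)%N ->
  \int[P]_w (W x w)%:R ^+ p = qp p x%:R.
Proof.
by case: p => [|[|[|[|p]]]] //= _; have [] := W_moments x.
Qed.

Lemma itg_qp d' (T' : measurableType d') (P' : probability T' R) (N : T' -> nat) p :
  (0 < p <= 3)%N -> (forall f : nat -> R, measurable_fun setT (f \o N)) ->
  itg P' (fun w => (N w)%:R ^+ p) -> itg P' (fun w => qp p (N w)%:R).
Proof.
move=> p3 mN hp.
have lo q : (q <= p)%N -> itg P' (fun w => (N w)%:R ^+ q).
  move=> qp'; apply: (itg_le (mN (fun n => n%:R ^+ q)) (itgD (itg_cst P' 1) hp)) => w.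
  rewrite ger0_norm ?exprn_ge0 //= -!natrX -[X in X + _]/(1%:R) -natrD ler_nat.
  case: (N w) => [|n]; first by case: q qp' => // q _; rewrite exp0n.
  by rewrite (leq_trans (leq_pexp2l _ qp')) // leq_addl.
case: p p3 hp lo => [|[|[|[|p]]]] //= _ hp lo.
- by apply: itgD; [exact: itg_cst|apply: itgZ; exact: (lo 1%N)].
- apply: itgD; last exact: itg_cst.
  by apply: itgD; apply: itgZ; [exact: (lo 2%N)|exact: (lo 1%N)].
- apply: itgD; last exact: itg_cst.
  apply: itgD; last by apply: itgZ; exact: (lo 1%N).
  by apply: itgD; apply: itgZ; [exact: (lo 3%N)|exact: (lo 2%N)].
Qed.

Lemma X_itg3 k : itg P (fun w => (X k w)%:R ^+ 3).
Proof.
elim: k => [//|k IH].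
have [] // := @markov_ge0 k (fun _ v => v%:R ^+ 3).
- by move=> _ x; have [] := W_moments x.
- have -> : (fun w => \int[P]_w' (W (X k w) w')%:R ^+ 3) =
      (fun w => qp 3 (X k w)%:R).
    by apply/funext => w; rewrite (@K_pow 3).
  by apply: itg_qp => // f; exact: XM.
Qed.

Lemma EX_rec k p : (0 < p <= 3)%N ->
  \int[P]_w (X k.+1 w)%:R ^+ p = \int[P]_w qp p (X k w)%:R.
Proof.
move=> p3; have p3' : (p <= 3)%N by case/andP: p3.
have E : (fun w => \int[P]_w' (W (X k w) w')%:R ^+ p) =
    (fun w => qp p (X k w)%:R).
  by apply/funext => w; rewrite K_pow.
have [] := @markov_ge0 k (fun _ v => v%:R ^+ p).
- by move=> _ x; rewrite exprn_ge0.
- by move=> _ x; apply: W_pow => //; have [] := W_moments x.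
- rewrite E; apply: itg_qp => //; first by move=> f; exact: XM.
  by apply: X_pow => //; exact: X_itg3.
by move=> _ ->; rewrite E.
Qed.

Let a p k := \int[P]_w (X k w)%:R ^+ p.

Lemma expq1 d' (T' : measurableType d') (P' : probability T' R) (N : T' -> nat) :
  itg P' (fun w => (N w)%:R) ->
  \int[P']_w qp 1 (N w)%:R = alpha * \int[P']_w (N w)%:R + e1.
Proof.
by move=> i; rewrite /= /q1 expD ?exp_cst ?expZ 1?addrC //; [exact: itg_cst|exact: itgZ].
Qed.

Lemma expq2 d' (T' : measurableType d') (P' : probability T' R) (N : T' -> nat) :
  itg P' (fun w => (N w)%:R) -> itg P' (fun w => (N w)%:R ^+ 2) ->
  \int[P']_w qp 2 (N w)%:R = alpha ^+ 2 * \int[P']_w (N w)%:R ^+ 2 +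
    ((2 * alpha * e1 + alpha - alpha ^+ 2) * \int[P']_w (N w)%:R + e2).
Proof.
move=> i1 i2; rewrite /= /q2 expD ?exp_cst; [|by apply: itgD; exact: itgZ|exact: itg_cst].
by rewrite (expD (itgZ _ i2) (itgZ _ i1)) (expZ _ i1) (expZ _ i2) addrA.
Qed.

Lemma expq3 d' (T' : measurableType d') (P' : probability T' R) (N : T' -> nat) :
  itg P' (fun w => (N w)%:R) -> itg P' (fun w => (N w)%:R ^+ 2) ->
  itg P' (fun w => (N w)%:R ^+ 3) ->
  \int[P']_w qp 3 (N w)%:R = alpha ^+ 3 * \int[P']_w (N w)%:R ^+ 3 +
    ((3 * alpha ^+ 2 * (e1 + 1 - alpha)) * \int[P']_w (N w)%:R ^+ 2 +
    ((2 * alpha ^+ 3 - 3 * alpha ^+ 2 * e1 - 3 * alpha ^+ 2 + 3 * alpha * e2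
     + 3 * alpha * e1 + alpha) * \int[P']_w (N w)%:R + e3)).
Proof.
move=> i1 i2 i3; rewrite /= /q3 expD ?exp_cst; [| |exact: itg_cst]; last first.
  by apply: itgD; [apply: itgD; exact: itgZ|exact: itgZ].
rewrite expD; [|by apply: itgD; exact: itgZ|exact: itgZ].
by rewrite (expD (itgZ _ i3) (itgZ _ i2)) (expZ _ i1) (expZ _ i2) (expZ _ i3) !addrA.
Qed.

Lemma X_i k p : (p <= 3)%N -> itg P (fun w => (X k w)%:R ^+ p).
Proof. by move=> p3; apply: X_pow => //; exact: X_itg3. Qed.

(** The recursion is triangular: order p has diagonal factor alpha^p < 1 and is driven by the lower
    orders. Boundedness and convergence are therefore obtained order by order. *)
Lemma aS p k : (0 < p <= 3)%N -> a p k.+1 =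
  match p with
  | 1 => alpha * a 1 k + e1
  | 2 => alpha ^+ 2 * a 2 k +
    ((2 * alpha * e1 + alpha - alpha ^+ 2) * a 1 k + e2)
  | _ => alpha ^+ 3 * a 3 k +
    ((3 * alpha ^+ 2 * (e1 + 1 - alpha)) * a 2 k +
    ((2 * alpha ^+ 3 - 3 * alpha ^+ 2 * e1 - 3 * alpha ^+ 2 + 3 * alpha * e2
     + 3 * alpha * e1 + alpha) * a 1 k + e3))
  end.
Proof.
move=> p3; rewrite /a EX_rec //.
have i1 : itg P (fun w => (X k w)%:R) := @X_i k 1 isT.
case: p p3 => [|[|[|[|p]]]] // _.
- by rewrite expq1.
- by rewrite expq2 //; exact: X_i.
- by rewrite expq3 //; exact: X_i.
Qed.

Lemma a_ge0 p k : 0 <= a p k.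
Proof. by apply: exp_ge0 => w; rewrite exprn_ge0. Qed.

Let alphaX p : (0 < p)%N -> 0 <= alpha ^+ p < 1.
Proof.
move=> p0; rewrite exprn_ge0 ?(ltW a0) //=.
by rewrite exprn_ilt1 // ?ltW // -lt0n.
Qed.

Lemma a_bounded p : (p <= 3)%N -> exists B, forall k, a p k <= B.
Proof.
have step rho b u : 0 <= rho < 1 -> (forall k, 0 <= u k) ->
    (forall k, u k.+1 <= rho * u k + b) -> exists B : R, forall k, u k <= B.
  move=> r01 u0 h; exists (u 0%N + Num.max b 0 / (1 - rho)).
  apply: rec_bounded => // [|k]; first by rewrite le_max lexx orbT.
  by rewrite (le_trans (h k)) // lerD2l le_max lexx.
have [B1 h1] : exists B, forall k, a 1 k <= B.
  apply: (step alpha e1) => [||k]; [exact: (@alphaX 1)|exact: a_ge0|].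
  by rewrite aS.
have mul_le (c x B : R) : 0 <= x <= B -> c * x <= `|c| * B.
  move=> /andP[x0 xB]; apply: le_trans (ler_norm _) _.
  by rewrite normrM (ger0_norm x0) ler_wpM2l.
have [B2 h2] : exists B, forall k, a 2 k <= B.
  apply: (step (alpha ^+ 2) (`|2 * alpha * e1 + alpha - alpha ^+ 2| * B1 + e2))
    => [||k]; [exact: alphaX|exact: a_ge0|].
  by rewrite aS // lerD2l lerD2r mul_le // a_ge0 h1.
have [B3 h3] : exists B, forall k, a 3 k <= B.
  apply: (step (alpha ^+ 3) (`|3 * alpha ^+ 2 * (e1 + 1 - alpha)| * B2 +
    (`|2 * alpha ^+ 3 - 3 * alpha ^+ 2 * e1 - 3 * alpha ^+ 2 + 3 * alpha * e2
     + 3 * alpha * e1 + alpha| * B1 + e3))) => [||k]; [exact: alphaX|exact: a_ge0|].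
  by rewrite aS // lerD2l lerD ?lerD2r ?mul_le // a_ge0 ?h1 ?h2.
case: p => [|[|[|[|p]]]] // _; [|by exists B1|by exists B2|by exists B3].
by exists 1 => k; rewrite /a; under eq_Rintegral do rewrite expr0; rewrite exp_cst.
Qed.

Lemma X_ergodic g M k : (forall y, `|g y| <= M) ->
  `|\int[P]_w g (X k w) - \int[Q]_n g n| <= alpha ^+ k * (2 * M) * (a 1 0 + m1).
Proof.
move=> gM.
have F1 (p : seq nat) : `|1 : R| <= 1 by rewrite normr1.
have := @markov_iter 0 k (fun=> 1) 1 g M F1 gM.
under eq_Rintegral do rewrite mul1r add0n.
under [X in _ = X -> _]eq_Rintegral do rewrite mul1r.
move=> ->; rewrite -[X in _ - X](exp_cst P).
have ik : itg P (fun w => iter k K g (X 0 w)).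
  by apply: X_itg => y; exact: iterK_bounded.
rewrite -expB //; last exact: itg_cst.
have i0 : itg P (fun w => (X 0 w)%:R) := @X_i 0 1 isT.
have i1 : itg P (fun w => (X 0 w)%:R + m1) by apply: itgD => //; exact: itg_cst.
have -> : alpha ^+ k * (2 * M) * (a 1 0 + m1) =
    \int[P]_w (alpha ^+ k * (2 * M) * ((X 0 w)%:R + m1)).
  by rewrite (expZ _ i1) expD ?exp_cst //; exact: itg_cst.
apply: exp_norm_le; [by apply: itgB => //; exact: itg_cst|exact: itgZ|].
by move=> w; exact: K_ergodic.
Qed.

Lemma X_ergodic_cvg g M : (forall y, `|g y| <= M) ->
  \int[P]_w g (X k w) @[k --> \oo] --> \int[Q]_n g n.
Proof.
move=> gM; apply: (cvg_dist_le (fun k => @X_ergodic g M k gM)).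
rewrite -(mul0r (a 1 0 + m1)); apply: cvgMl.
rewrite -(mul0r (2 * M)); apply: cvgMl.
by apply: cvg_expr; rewrite gtr0_norm.
Qed.

Lemma trunc_bounded p (C n : nat) :
  `|\1_[set v | v <= C]%N n * n%:R ^+ p| <= (C%:R ^+ p : R).
Proof.
rewrite indicE; have [/set_mem /= h|_] := boolP (n \in _); last first.
  by rewrite mul0r normr0 exprn_ge0.
by rewrite mul1r ger0_norm ?exprn_ge0 // lerXn2r ?nnegrE // ler_nat.
Qed.

(** Finiteness of the stationary moments is derived from the chain: the moment truncated at C under
    Q is the limit of the truncated moments of X_k, and these are bounded uniformly in C and k. *)
Lemma Q_itgp p : (p <= 3)%N -> itg Q (fun n => n%:R ^+ p).
Proof.
move=> p3; have [B hB] := a_bounded p3.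
apply: (@itg_truncation _ _ R Q (fun n => n) (fun n => n%:R ^+ p) B) => //.
- by move=> C; apply: (@Q_itg _ (C%:R ^+ p)) => n; exact: trunc_bounded.
move=> C; apply: (cvg_to_le (X_ergodic_cvg (@trunc_bounded p C))) => k.
apply: le_trans (hB k); apply: exp_le; last 1 first.
- move=> w; rewrite indicE ler_piMl ?exprn_ge0 //.
  by case: (_ \in _); rewrite ?ler01.
- by apply: (@X_itg k (fun n => \1_[set v | v <= C]%N n * n%:R ^+ p) (C%:R ^+ p)) => n; exact: trunc_bounded.
- exact: X_i.
Qed.

Let mm p := \int[Q]_n n%:R ^+ p.

Lemma mm_rec p : (0 < p <= 3)%N -> mm p = \int[Q]_n qp p n%:R.
Proof.
move=> p3; have p3' : (p <= 3)%N by case/andP: p3.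
have E : (\int[Q]_n (n%:R ^+ p)%:E = \int[Q]_n (qp p n%:R)%:E)%E.
  rewrite -(@stat (fun n => (n%:R ^+ p)%:E)); last first.
    by move=> n; rewrite lee_fin exprn_ge0.
  apply: eq_integral => n _; rewrite expE ?K_pow //.
  by apply: W_pow => //; have [] := W_moments n.
by rewrite /mm /Rintegral E.
Qed.

(** The stationary moments are a fixed point of the recursion [aS], by [mm_rec], so the differences
    obey a contracting recursion forced by the differences of lower order. *)
Lemma X_moment_cvg p : (0 < p <= 3)%N -> a p k @[k --> \oo] --> mm p.
Proof.
have i1 : itg Q (fun n => n%:R) := @Q_itgp 1 isT.
have i2 := @Q_itgp 2 isT; have i3 := @Q_itgp 3 isT.
have mm1 : \int[Q]_n n%:R = mm 1 by [].
have sub0 (u : nat -> R) l : u n - l @[n --> \oo] --> 0 -> u n @[n --> \oo] --> l.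
  move=> h; rewrite -(add0r l) -[X in X @ _ --> _](_ : (fun n => (u n - l) + l) = _).
    by apply: cvgD => //; exact: cvg_cst.
  by apply/funext => n; rewrite subrK.
have h1 : a 1 k - mm 1 @[k --> \oo] --> 0.
  apply: (@rec_cvg0 _ _ (fun=> 0) alpha (@alphaX 1 isT)); last exact: cvg_cst.
  by move=> k; rewrite aS // [X in _ - X = _]mm_rec // expq1 // mm1; ring.
have h2 : a 2 k - mm 2 @[k --> \oo] --> 0.
  apply: (@rec_cvg0 _ _ (fun k => (2 * alpha * e1 + alpha - alpha ^+ 2) *
    (a 1 k - mm 1)) _ (@alphaX 2 isT)).
    by move=> k; rewrite aS // [X in _ - X = _]mm_rec // expq2 // mm1 -/(mm 2); ring.
  by rewrite -(mulr0 (2 * alpha * e1 + alpha - alpha ^+ 2)); apply: cvgMr.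
have h3 : a 3 k - mm 3 @[k --> \oo] --> 0.
  apply: (@rec_cvg0 _ _ (fun k => (3 * alpha ^+ 2 * (e1 + 1 - alpha)) *
    (a 2 k - mm 2) + (2 * alpha ^+ 3 - 3 * alpha ^+ 2 * e1 - 3 * alpha ^+ 2 + 3 * alpha * e2
     + 3 * alpha * e1 + alpha) * (a 1 k - mm 1)) _ (@alphaX 3 isT)).
    by move=> k; rewrite aS // [X in _ - X = _]mm_rec // expq3 // mm1 -/(mm 2) -/(mm 3); ring.
  rewrite -(addr0 0); apply: cvgD.
    by rewrite -(mulr0 (3 * alpha ^+ 2 * (e1 + 1 - alpha))); apply: cvgMr.
  rewrite -(mulr0 (2 * alpha ^+ 3 - 3 * alpha ^+ 2 * e1 - 3 * alpha ^+ 2 + 3 * alpha * e2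
     + 3 * alpha * e1 + alpha)); exact: cvgMr.
by case: p => [|[|[|[|p]]]] // _; apply: sub0.
Qed.

Lemma Q_tail p eps : (p <= 3)%N -> 0 < eps -> exists C0, forall C, (C0 <= C)%N ->
  mm p - \int[Q]_n (\1_[set v | v <= C]%N n * n%:R ^+ p) <= eps.
Proof.
move=> p3 eps0.
have /cvgrPdist_le/(_ _ eps0)[C0 _ h] :=
  @truncation_cvg _ _ R Q (fun n => n) _ (fun m => I) (Q_itgp p3).
by exists C0 => C CC; apply: le_trans (ler_norm _) (h C CC).
Qed.

(** The tail is the full third moment minus the truncated one. Both converge as k grows, so for late
    k the tail is close to the tail under Q. Convergence of the full moment is what excludes an
    escape of mass. *)
Lemma X_uniformly_integrable eps : 0 < eps -> exists C0, forall C k, (C0 <= C)%N ->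
  \int[P]_w (\1_[set v | C < v]%N (X k w) * (X k w)%:R ^+ 3) <= eps.
Proof.
move=> eps0; have e20 : 0 < eps / 3 by rewrite divr_gt0.
pose t C k := \int[P]_w (\1_[set v | v <= C]%N (X k w) * (X k w)%:R ^+ 3).
have it C k : itg P (fun w => \1_[set v | v <= C]%N (X k w) * (X k w)%:R ^+ 3).
  apply: (@X_itg k (fun n => \1_[set v | v <= C]%N n * n%:R ^+ 3) (C%:R ^+ 3)) => n.
  exact: trunc_bounded.
have E C k : \int[P]_w (\1_[set v | C < v]%N (X k w) * (X k w)%:R ^+ 3) = a 3 k - t C k.
  rewrite -expB //; last exact: X_i.
  apply: eq_Rintegral => w _; rewrite !indicE.
  have [h|h] := leqP (X k w) C.
    by rewrite memNset ?mem_set //= ?mul0r ?mul1r ?subrr //; apply/negP; rewrite -leqNgt.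
  by rewrite mem_set // memNset ?mul0r ?mul1r ?subr0 //; apply/negP; rewrite -ltnNge.
have tmono C C' k : (C <= C')%N -> t C k <= t C' k.
  move=> CC; apply: exp_le => // w; rewrite ler_wpM2r ?exprn_ge0 // !indicE ler_nat.
  have [/set_mem /= h|//] := boolP (X k w \in _).
  by rewrite mem_set //= (leq_trans h).
have [C1 hC1] := @Q_tail 3 _ isT e20.
have /cvgrPdist_le/(_ _ e20)[k1 _ hk1] := @X_moment_cvg 3 isT.
have /cvgrPdist_le/(_ _ e20)[k2 _ hk2] := X_ergodic_cvg (@trunc_bounded 3 C1).
have small k : exists C, a 3 k - t C k <= eps.
  have nX : nat_rv (X k).
    move=> m; have := XM k (fun n => n%:R) measurableT (measurable_set1 m%:R).
    rewrite setTI; congr measurable; apply/seteqP; split => w /=.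
      by move=> /eqP; rewrite eqr_nat => /eqP.
    by move=> ->.
  have /cvgrPdist_le/(_ _ eps0)[C _ h] := truncation_cvg nX (X_itg3 k).
  by exists C; apply: le_trans (ler_norm _) (h C (leqnn C)).
have /choice [Cs hCs] := small.
(* Late times share the level [C1] obtained from the limits; the finitely many early times have
   levels [Cs] of their own. *)
exists (maxn C1 (\max_(k < maxn k1 k2) Cs k)) => C k.
rewrite geq_max => /andP[C1C CsC]; rewrite E.
have [kk|kk] := ltnP k (maxn k1 k2).
  apply: le_trans (hCs k); rewrite lerD2l lerN2; apply: tmono.
  apply: leq_trans CsC; exact: (@leq_bigmax _ (fun i : 'I__ => Cs i) (Ordinal kk)).
move: kk; rewrite geq_max => /andP[kk1 kk2].
apply: (@le_trans _ _ (a 3 k - t C1 k)); first by rewrite lerD2l lerN2 tmono.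
have := hk1 k kk1; have := hk2 k kk2; have := hC1 C1 (leqnn C1).
rewrite -/(t C1 k) !ler_norml => h1 /andP[h2 h2'] /andP[h3 h3'].
move: h1 h2 h2' h3 h3'; rewrite /mm; lra.
Qed.

Let s2 := e2 - e1 ^+ 2.

(** Regressor times prediction error: the term that one transition contributes to the normal
    equation of least squares, with conditional mean zero. *)
Definition zeta (x y : nat) : R := x%:R * (y%:R - alpha * x%:R - e1).

(** The conditional variance of [zeta], with a binomial part alpha (1 - alpha) x and an innovation
    part [s2]. *)
Definition Vx (x : nat) : R := x%:R ^+ 2 * (alpha * (1 - alpha) * x%:R + s2).

Lemma itg_W x p : (p <= 3)%N -> itg P (fun w => (W x w)%:R ^+ p).
Proof. by move=> p3; apply: W_pow => //; have [] := W_moments x. Qed.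

Lemma itg_zeta3 x : itg P (fun w => `|zeta x (W x w)| ^+ 3).
Proof.
pose c := alpha * x%:R + e1.
have c0 : 0 <= c.
  by have [e10 _ _] := e_ge0; rewrite addr_ge0 // mulr_ge0 // ltW.
apply: (@itg_le _ _ _ _ _ (fun w => x%:R ^+ 3 * ((W x w)%:R ^+ 3 +
   (3 * c * (W x w)%:R ^+ 2 + (3 * c ^+ 2 * (W x w)%:R ^+ 1 + c ^+ 3))))).
- exact: (WM x (fun y => `|zeta x y| ^+ 3)).
- apply: itgZ; apply: itgD; first exact: itg_W.
  apply: itgD; first by apply: itgZ; exact: itg_W.
  by apply: itgD; [apply: itgZ; exact: itg_W|exact: itg_cst].
- move=> w; rewrite normrX normr_id /zeta normrM normr_nat exprMn.
  apply: ler_wpM2l; first exact: exprn_ge0.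
  have -> : (W x w)%:R ^+ 3 + (3 * c * (W x w)%:R ^+ 2 +
      (3 * c ^+ 2 * (W x w)%:R ^+ 1 + c ^+ 3)) = ((W x w)%:R + c) ^+ 3 by ring.
  have le1 : `|(W x w)%:R - alpha * x%:R - e1| <= (W x w)%:R + c.
    have -> : (W x w)%:R - alpha * x%:R - e1 = (W x w)%:R - c by rewrite /c; ring.
    by rewrite (le_trans (ler_normB _ _)) // normr_nat lerD2l ger0_norm.
  by rewrite lerXn2r ?nnegrE // addr_ge0.
Qed.

Lemma itg_zeta1 x : itg P (fun w => zeta x (W x w)).
Proof.
apply: itgZ; apply: itgB; last exact: itg_cst.
by apply: itgB; [exact: (@itg_W x 1)|exact: itg_cst].
Qed.

Lemma E_zeta x : \int[P]_w zeta x (W x w) = 0.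
Proof.
have [_ E1 _ _] := W_moments x; have i1 := @itg_W x 1 isT.
rewrite /zeta expZ; last by do 2?[apply: itgB; last exact: itg_cst].
rewrite expB ?exp_cst; [|by apply: itgB; last exact: itg_cst|exact: itg_cst].
rewrite expB ?exp_cst //; last exact: itg_cst.
by rewrite E1 /q1; ring.
Qed.

Lemma itg_zeta2 x : itg P (fun w => zeta x (W x w) ^+ 2).
Proof.
have E w : zeta x (W x w) ^+ 2 = x%:R ^+ 2 * ((W x w)%:R ^+ 2 +
   (- (2 * (alpha * x%:R + e1)) * (W x w)%:R ^+ 1 + (alpha * x%:R + e1) ^+ 2)).
  by rewrite /zeta; ring.
under eq_fun do rewrite E.
apply: itgZ; apply: itgD; first exact: itg_W.
by apply: itgD; [apply: itgZ; exact: itg_W|exact: itg_cst].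
Qed.

Lemma E_zeta2 x : \int[P]_w zeta x (W x w) ^+ 2 = Vx x.
Proof.
have E w : zeta x (W x w) ^+ 2 = x%:R ^+ 2 * ((W x w)%:R ^+ 2 +
   (- (2 * (alpha * x%:R + e1)) * (W x w)%:R + (alpha * x%:R + e1) ^+ 2)).
  by rewrite /zeta; ring.
under eq_Rintegral do rewrite E.
have [_ E1 E2 _] := W_moments x.
have i1 := @itg_W x 1 isT; have i2 := @itg_W x 2 isT.
have c := itg_cst P ((alpha * x%:R + e1) ^+ 2).
have j1 := itgZ (- (2 * (alpha * x%:R + e1))) i1.
rewrite (expZ _ (itgD i2 (itgD j1 c))) (expD i2 (itgD j1 c)) (expD j1 c) exp_cst.
by rewrite (expZ _ i1) E1 E2 /Vx /s2 /q1 /q2; ring.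
Qed.

Let kap := alpha * (1 - alpha) + s2.

Lemma s2_ge0 : 0 <= s2.
Proof.
have i1 : itg P (fun w => (W 0 w)%:R) := @itg_W 0 1 isT; have i2 := @itg_W 0 2 isT.
have E w : ((W 0 w)%:R - e1) ^+ 2 = (W 0 w)%:R ^+ 2 +
   (- (2 * e1) * (W 0 w)%:R + e1 ^+ 2) by ring.
have c := itg_cst P (e1 ^+ 2); have j1 := itgZ (- (2 * e1)) i1.
have : 0 <= \int[P]_w ((W 0 w)%:R - e1) ^+ 2.
  by apply: exp_ge0 => w; rewrite sqr_ge0.
under eq_Rintegral do rewrite E.
rewrite (expD i2 (itgD j1 c)) (expD j1 c) exp_cst (expZ _ i1) -/e1 -/e2 /s2.
by move: e1 e2 => u v; lra.
Qed.

Let a1' : 0 < 1 - alpha. Proof. by rewrite subr_gt0. Qed.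

Lemma kap_ge0 : 0 <= kap.
Proof. by rewrite addr_ge0 ?s2_ge0 // mulr_ge0 // ltW. Qed.

Lemma Vx_ge0 x : 0 <= Vx x.
Proof.
rewrite mulr_ge0 ?exprn_ge0 // addr_ge0 ?s2_ge0 //.
by rewrite mulr_ge0 // mulr_ge0 // ltW.
Qed.

Lemma Vx_le x : Vx x <= kap * x%:R ^+ 3.
Proof.
have h : x%:R ^+ 2 <= x%:R ^+ 3 :> R.
  rewrite -!natrX ler_nat; case: x => // x; exact: leq_pexp2l.
have -> : Vx x = alpha * (1 - alpha) * x%:R ^+ 3 + s2 * x%:R ^+ 2.
  by rewrite /Vx; ring.
by rewrite /kap [leRHS]mulrDl lerD2l ler_wpM2l // s2_ge0.
Qed.

Lemma itg_VX k : itg P (fun w => Vx (X k w)).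
Proof.
apply: (itg_le (XM k Vx) (itgZ kap (X_itg3 k))) => w.
by rewrite ger0_norm ?Vx_ge0 // Vx_le.
Qed.

Lemma E_VX_bounded : exists2 B, 0 <= B & forall k, \int[P]_w Vx (X k w) <= B.
Proof.
have [B hB] := @a_bounded 3 isT; exists (kap * `|B|).
  by rewrite mulr_ge0 // kap_ge0.
move=> k; apply: (@le_trans _ _ (\int[P]_w (kap * (X k w)%:R ^+ 3))).
  apply: exp_le; [exact: itg_VX|apply: itgZ; exact: X_itg3|].
  by move=> w; exact: Vx_le.
rewrite (expZ _ (X_itg3 k)) ler_wpM2l ?kap_ge0 // (le_trans (hB k)) //.
exact: ler_norm.
Qed.

(* For the finitely many states [x <= C] the Taylor remainder is cubic in [u];
   for [x > C] only the quadratic remainder is uniform in [x]. *)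
Lemma step_cos C : exists2 A : R, 0 <= A & forall (x : nat) (u c : R),
  `|\int[P]_w cos (c + u * zeta x (W x w)) - cos c * (1 - u ^+ 2 / 2 * Vx x)| <=
  A * `|u| ^+ 3 + 3 * kap * u ^+ 2 * (\1_[set v | C < v]%N x * x%:R ^+ 3).
Proof.
pose m3 x := \int[P]_w `|zeta x (W x w)| ^+ 3.
have m30 x : 0 <= m3 x by apply: exp_ge0 => w; rewrite exprn_ge0.
exists (\sum_(x < C.+1) 3 * m3 x).
  by apply: sumr_ge0 => x _; rewrite mulr_ge0.
move=> x u c; have i1 := itg_zeta1 x; have i2 := itg_zeta2 x.
have ic : itg P (fun w => cos (c + u * zeta x (W x w))).
  apply: (@W_itg x (fun y => cos (c + u * zeta x y)) 1) => y; exact: cos_max.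
have E w : cos c - u * zeta x (W x w) * sin c - (u * zeta x (W x w)) ^+ 2 / 2 * cos c
   = cos c + (- (u * sin c) * zeta x (W x w) + - (u ^+ 2 / 2 * cos c) * zeta x (W x w) ^+ 2).
  by rewrite exprMn; ring.
have j1 := itgZ (- (u * sin c)) i1; have j2 := itgZ (- (u ^+ 2 / 2 * cos c)) i2.
have j3 : itg P (fun w => cos c - u * zeta x (W x w) * sin c
    - (u * zeta x (W x w)) ^+ 2 / 2 * cos c).
  by under eq_fun do rewrite E; apply: itgD; [exact: itg_cst|exact: itgD].
have -> : cos c * (1 - u ^+ 2 / 2 * Vx x) = \int[P]_w (cos c
   - u * zeta x (W x w) * sin c - (u * zeta x (W x w)) ^+ 2 / 2 * cos c).
  under [RHS]eq_Rintegral do rewrite E.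
  rewrite (expD (itg_cst _ _) (itgD j1 j2)) (expD j1 j2) exp_cst.
  by rewrite (expZ _ i1) (expZ _ i2) E_zeta E_zeta2; ring.
rewrite -(expB ic j3).
have [xC|Cx] := leqP x C.
  apply: (@le_trans _ _ (\int[P]_w (3 * `|u| ^+ 3 * `|zeta x (W x w)| ^+ 3))).
    apply: exp_norm_le; [exact: itgB|by apply: itgZ; exact: itg_zeta3|].
    move=> w; apply: le_trans (cos_shift_taylor3 _ _) _.
    by rewrite normrM exprMn mulrA.
  rewrite (expZ _ (itg_zeta3 x)) -/(m3 x).
  rewrite -[leLHS]addr0 lerD //; last first.
    apply: mulr_ge0; last by rewrite mulr_ge0 ?exprn_ge0 // indicE.
    by apply: mulr_ge0; [rewrite mulr_ge0 ?kap_ge0|exact: sqr_ge0].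
  rewrite mulrAC ler_wpM2r ?exprn_ge0 //.
  have xC' : (x < C.+1)%N by [].
  rewrite (bigD1 (Ordinal xC')) //=.
  by rewrite lerDl sumr_ge0 // => y _; rewrite mulr_ge0.
apply: (@le_trans _ _ (\int[P]_w (3 * u ^+ 2 * zeta x (W x w) ^+ 2))).
  apply: exp_norm_le; [exact: itgB|exact: itgZ|].
  move=> w; apply: le_trans (cos_shift_taylor2 _ _) _.
  by rewrite exprMn mulrA.
rewrite (expZ _ i2) E_zeta2 indicE mem_set // mul1r.
rewrite -[leLHS]add0r lerD //.
  by rewrite mulr_ge0 ?exprn_ge0 // sumr_ge0 // => y _; rewrite mulr_ge0.
have -> : 3 * kap * u ^+ 2 * x%:R ^+ 3 = 3 * u ^+ 2 * (kap * x%:R ^+ 3) by ring.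
by rewrite ler_wpM2l ?Vx_le // mulr_ge0 // sqr_ge0.
Qed.

(** * Central limit theorem for the martingale *)

Section clt.
Context (k0 : nat).

(** Starting the sum at [k0] lets a weight that depends on the path up to [k0] factor out of every
    conditioning step. *)
Definition Smart (k : nat) (w : T) : R :=
  \sum_(k0 <= j < k) zeta (X j w) (X j.+1 w).

(** The same sum read off a list of states, so that it can be part of a function of the past in the
    Markov property. *)
Definition SF (k : nat) (p : seq nat) : R :=
  \sum_(k0 <= j < k) zeta (nth 0%N p j) (nth 0%N p j.+1).

Lemma SF_path k k' w : (k <= k')%N -> SF k (path k' w) = Smart k w.
Proof.
move=> kk; apply: eq_big_nat => j /andP[_ jk].
by rewrite !nth_path_of // ?(leq_trans jk) // ltnW // (leq_trans jk).
Qed.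

Lemma Smart_recr k w : (k0 <= k)%N ->
  Smart k.+1 w = Smart k w + zeta (X k w) (X k.+1 w).
Proof. by move=> kk; rewrite /Smart big_nat_recr. Qed.

Lemma zetaX j : itg P (fun w => zeta (X j w) (X j.+1 w) ^+ 2) /\
  \int[P]_w zeta (X j w) (X j.+1 w) ^+ 2 = \int[P]_w Vx (X j w).
Proof.
have E : (fun w => \int[P]_w' zeta (nth 0%N (path j w) j) (W (X j w) w') ^+ 2) =
    (fun w => Vx (X j w)).
  by apply/funext => w; rewrite last_path_of E_zeta2.
have [] := @markov_ge0 j (fun p v => zeta (nth 0%N p j) v ^+ 2).
- by move=> p v; exact: sqr_ge0.
- move=> p x; have c := itg_cst P 1.
  have E' w : zeta (nth 0%N p j) (W x w) ^+ 2 = (nth 0%N p j)%:R ^+ 2 *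
   ((W x w)%:R ^+ 2 + (- (2 * (alpha * (nth 0%N p j)%:R + e1)) * (W x w)%:R ^+ 1
    + (alpha * (nth 0%N p j)%:R + e1) ^+ 2)) by rewrite /zeta; ring.
  under eq_fun do rewrite E'.
  apply: itgZ; apply: itgD; first exact: itg_W.
  by apply: itgD; [apply: itgZ; exact: itg_W|exact: itg_cst].
- by rewrite E; exact: itg_VX.
have -> : (fun w => zeta (nth 0%N (path j w) j) (X j.+1 w) ^+ 2) =
    (fun w => zeta (X j w) (X j.+1 w) ^+ 2).
  by apply/funext => w; rewrite last_path_of.
by rewrite E.
Qed.

Lemma zetaM j : measurable_fun setT (fun w => zeta (X j w) (X j.+1 w)).
Proof.
have := @path_stepM j (fun p v => zeta (nth 0%N p j) v).
by apply: eq_measurable_fun => w _; rewrite last_path_of.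
Qed.

(** A uniform L^1 bound, from |z| <= 1 + z^2 and the bounded second moments. *)
Lemma zetaX1 : exists2 Z, 0 <= Z & forall j,
  itg P (fun w => `|zeta (X j w) (X j.+1 w)|) /\
  \int[P]_w `|zeta (X j w) (X j.+1 w)| <= Z.
Proof.
have [B B0 hB] := E_VX_bounded; exists (1 + B); first by rewrite addr_ge0.
move=> j; have [i2 E2] := zetaX j; have i3 := itgD (itg_cst P 1) i2.
have le w : `|zeta (X j w) (X j.+1 w)| <= 1 + zeta (X j w) (X j.+1 w) ^+ 2.
  rewrite -[X in _ + X]real_normK ?num_real //.
  by move: (`|_|) (normr_ge0 (zeta (X j w) (X j.+1 w))) => y y0; nra.
have i1 : itg P (fun w => `|zeta (X j w) (X j.+1 w)|).
  apply: (itg_le _ i3); first exact: measurableT_comp (zetaM j).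
  by move=> w; rewrite normr_id.
split => //; apply: le_trans (exp_le i1 i3 le) _.
by rewrite (expD (itg_cst _ _) i2) exp_cst E2 lerD2l.
Qed.

(** Forgetting the last m increments costs m Z in L^1, which is negligible once multiplied by a u of
    order n^(-1/2). *)
Lemma itg_Smart_sub k m : (m <= k)%N -> (k0 <= k - m)%N -> forall Z,
  (forall j, itg P (fun w => `|zeta (X j w) (X j.+1 w)|) /\
  \int[P]_w `|zeta (X j w) (X j.+1 w)| <= Z) ->
  itg P (fun w => `|Smart k w - Smart (k - m) w|) /\
  \int[P]_w `|Smart k w - Smart (k - m) w| <= m%:R * Z.
Proof.
move=> mk k0k Z hZ.
have E w : Smart k w - Smart (k - m) w =
    \sum_(k - m <= j < k) zeta (X j w) (X j.+1 w).
  rewrite /Smart (big_cat_nat _ (n := (k - m)%N)) //= ?leq_subr //.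
  by rewrite addrAC subrr add0r.
have i1 : itg P (fun w => \sum_(k - m <= j < k) `|zeta (X j w) (X j.+1 w)|).
  by apply: itg_sum => j _; exact: (hZ j).1.
have le w : `|Smart k w - Smart (k - m) w| <=
    \sum_(k - m <= j < k) `|zeta (X j w) (X j.+1 w)|.
  by rewrite E; exact: ler_norm_sum.
have i2 : itg P (fun w => `|Smart k w - Smart (k - m) w|).
  apply: (itg_le _ i1) => [|w]; last by rewrite normr_id.
  apply: measurableT_comp => //.
  apply: eq_measurable_fun (pathM k (fun p => SF k p - SF (k - m) p)) => w _.
  by rewrite !SF_path ?leq_subr.
split => //; apply: le_trans (exp_le i2 i1 le) _.
rewrite exp_sum; last by move=> j _; exact: (hZ j).1.
apply: (@le_trans _ _ (\sum_(k - m <= j < k) Z)).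
  by apply: ler_sum => j _; exact: (hZ j).2.
by rewrite sumr_const_nat subKn // mulr_natl.
Qed.

(** The increments are orthogonal: given the past, the cross term has mean zero. *)
Lemma Smart_sq k : itg P (fun w => Smart (k0 + k) w ^+ 2) /\
  \int[P]_w Smart (k0 + k) w ^+ 2 = \sum_(k0 <= j < k0 + k) \int[P]_w Vx (X j w).
Proof.
elim: k => [|k [IHi IHe]].
  rewrite addn0 big_geq //.
  have E w : Smart k0 w ^+ 2 = 0 by rewrite /Smart big_geq // expr0n.
  split; first by under eq_fun do rewrite E; exact: itg_cst.
  by under eq_Rintegral do rewrite E; rewrite exp_cst.
set n := (k0 + k)%N in IHi IHe *; have k0n : (k0 <= n)%N by rewrite leq_addr.
rewrite addnS -/n.
have iz p x : itg P (fun w' => (SF n p + zeta x (W x w')) ^+ 2) /\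
    \int[P]_w' (SF n p + zeta x (W x w')) ^+ 2 = SF n p ^+ 2 + Vx x.
  have E w' : (SF n p + zeta x (W x w')) ^+ 2 = SF n p ^+ 2 +
     (2 * SF n p * zeta x (W x w') + zeta x (W x w') ^+ 2) by ring.
  have i1 := itgZ (2 * SF n p) (itg_zeta1 x); have i2 := itg_zeta2 x.
  have c := itg_cst P (SF n p ^+ 2).
  split; first by under eq_fun do rewrite E; apply: itgD => //; exact: itgD.
  under eq_Rintegral do rewrite E.
  rewrite (expD c (itgD i1 i2)) (expD i1 i2) exp_cst E_zeta2 (expZ _ (itg_zeta1 x)).
  by rewrite E_zeta mulr0 add0r.
have iVS : itg P (fun w => Smart n w ^+ 2 + Vx (X n w)) by apply: itgD => //; exact: itg_VX.
have E1 : (fun w => \int[P]_w' (SF n (path n w) +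
    zeta (nth 0%N (path n w) n) (W (X n w) w')) ^+ 2) =
    (fun w => Smart n w ^+ 2 + Vx (X n w)).
  by apply/funext => w; rewrite last_path_of (iz _ _).2 SF_path.
have [] := @markov_ge0 n (fun p v => (SF n p + zeta (nth 0%N p n) v) ^+ 2).
- by move=> p v; exact: sqr_ge0.
- move=> p x.
  have E w' : (SF n p + zeta (nth 0%N p n) (W x w')) ^+ 2 =
     (nth 0%N p n)%:R ^+ 2 * (W x w')%:R ^+ 2 + (2 * (nth 0%N p n)%:R *
      (SF n p - (nth 0%N p n)%:R * (alpha * (nth 0%N p n)%:R + e1)) * (W x w')%:R ^+ 1
     + (SF n p - (nth 0%N p n)%:R * (alpha * (nth 0%N p n)%:R + e1)) ^+ 2).
    by rewrite /zeta; ring.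
  under eq_fun do rewrite E.
  apply: itgD; first by apply: itgZ; exact: itg_W.
  by apply: itgD; [apply: itgZ; exact: itg_W|exact: itg_cst].
- by rewrite E1.
rewrite E1 => i2 e.
have E2 : (fun w => (SF n (path n w) + zeta (nth 0%N (path n w) n) (X n.+1 w)) ^+ 2) =
    (fun w => Smart n.+1 w ^+ 2).
  by apply/funext => w; rewrite last_path_of SF_path // Smart_recr.
rewrite E2 in i2 e; split => //.
rewrite e (expD IHi (itg_VX n)) IHe big_nat_recr //.
Qed.

Let v := \int[Q]_n Vx n.

Lemma itg_VQ : itg Q Vx.
Proof.
apply: (itg_le (g := fun n => kap * n%:R ^+ 3)) => //.
  by apply: itgZ; exact: (@Q_itgp 3).
by move=> n; rewrite ger0_norm ?Vx_ge0 // Vx_le.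
Qed.

Lemma v_ge0 : 0 <= v. Proof. by apply: exp_ge0 => n; exact: Vx_ge0. Qed.

Context (b : seq nat -> R) (theta : R).
Hypothesis b1 : forall p, `|b p| <= 1.

(** A real substitute for exp (i u S): the phases theta = 0 and theta = -pi/2 give its real and
    imaginary parts. *)
Definition cosS (u : R) (k : nat) (w : T) : R := cos (u * Smart k w + theta).

Definition phi (u : R) (k : nat) : R :=
  \int[P]_w (b (path k0 w) * cosS u k w).

Let F (u : R) (k : nat) (p : seq nat) : R :=
  b (take k0.+1 p) * cos (u * SF k p + theta).

Let F1 u k p : `|F u k p| <= 1.
Proof.
rewrite /F normrM -(mulr1 1); apply: ler_pM => //; exact: cos_max.
Qed.

Let FE u k k' w : (k0 <= k <= k')%N ->
  F u k (path k' w) = b (path k0 w) * cosS u k w.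
Proof.
move=> /andP[k0k kk]; rewrite /F take_path_of ?SF_path //.
exact: leq_trans kk.
Qed.

Let bcos1 u k w : `|b (path k0 w) * cosS u k w| <= 1.
Proof. by rewrite normrM -(mulr1 1); apply: ler_pM => //; exact: cos_max. Qed.

Let bcosM u k : (k0 <= k)%N ->
  measurable_fun setT (fun w => b (path k0 w) * cosS u k w).
Proof.
move=> k0k; apply: eq_measurable_fun (pathM k (F u k)) => w _.
by rewrite FE ?k0k ?leqnn.
Qed.

Let itg_mul (h : T -> R) u k : (k0 <= k)%N -> itg P h ->
  itg P (fun w => b (path k0 w) * cosS u k w * h w).
Proof.
move=> k0k ih; apply: (itg_le _ (itg_norm ih)).
  by apply: measurable_funM; [exact: bcosM|exact: itg_measurable ih].
by move=> w; rewrite normrM ler_piMl.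
Qed.

Let itg_bcos u k : (k0 <= k)%N -> itg P (fun w => b (path k0 w) * cosS u k w).
Proof. by move=> k0k; apply: (@itg_bounded _ _ _ _ _ 1) => //; exact: bcosM. Qed.

Let tailX C k := \int[P]_w (\1_[set n | C < n]%N (X k w) * (X k w)%:R ^+ 3).

Let itg_tail C k : itg P (fun w => \1_[set n | C < n]%N (X k w) * (X k w)%:R ^+ 3).
Proof.
apply: (itg_le (XM k (fun n => \1_[set n | C < n]%N n * n%:R ^+ 3)) (X_itg3 k)) => w /=.
rewrite ger0_norm; last by rewrite mulr_ge0 ?exprn_ge0 // indicE.
by rewrite indicE ler_piMl ?exprn_ge0 //; case: (_ \in _); rewrite ?ler01.
Qed.

Lemma phi_step C A : 0 <= A -> (forall (x : nat) (u c : R),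
  `|\int[P]_w cos (c + u * zeta x (W x w)) - cos c * (1 - u ^+ 2 / 2 * Vx x)| <=
  A * `|u| ^+ 3 + 3 * kap * u ^+ 2 * (\1_[set v | C < v]%N x * x%:R ^+ 3)) ->
  forall u k, (k0 <= k)%N ->
  `|phi u k.+1 - (phi u k - u ^+ 2 / 2 *
     \int[P]_w (b (path k0 w) * cosS u k w * Vx (X k w)))| <=
  A * `|u| ^+ 3 + 3 * kap * u ^+ 2 * tailX C k.
Proof.
move=> A0 hA u k k0k.
pose G p y := b (take k0.+1 p) * cos (u * SF k p + theta + u * zeta (nth 0%N p k) y).
have G1 p y : `|G p y| <= 1.
  by rewrite /G normrM -(mulr1 1); apply: ler_pM => //; exact: cos_max.
have -> : phi u k.+1 = \int[P]_w G (path k w) (X k.+1 w).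
  apply: eq_Rintegral => w _; rewrite /G take_path_of // SF_path // last_path_of.
  by rewrite /cosS Smart_recr // mulrDr addrAC.
rewrite (markov_bounded k G1).
pose H w := \int[P]_w' cos (u * Smart k w + theta + u * zeta (X k w) (W (X k w) w')).
have EH w : \int[P]_w' G (path k w) (W (X k w) w') = b (path k0 w) * H w.
  rewrite /G /H take_path_of // SF_path // last_path_of expZ //.
  by apply: (@W_itg (X k w) (fun y => cos (u * Smart k w + theta + u * zeta (X k w) y)) 1) => y; exact: cos_max.
under eq_Rintegral do rewrite EH.
have iV := itg_mul u k0k (itg_VX k); have ib := itg_bcos u k0k.
have iH : itg P (fun w => b (path k0 w) * H w).
  apply: (@itg_bounded _ _ _ _ _ 1).
    apply: eq_measurable_fun (pathM k (fun p => \int[P]_w' G p (W (nth 0%N p k) w'))) => w _.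
    by rewrite last_path_of EH.
  move=> w; rewrite -EH -[leRHS](exp_cst P 1).
  apply: exp_norm_le; [exact: (W_itg _ (G1 _))|exact: itg_cst|by move=> w'].
rewrite /phi -(expZ _ iV) -(expB ib (itgZ _ iV)) -(expB iH (itgB ib (itgZ _ iV))).
have it := itg_tail C k.
have -> : A * `|u| ^+ 3 + 3 * kap * u ^+ 2 * tailX C k = \int[P]_w (A * `|u| ^+ 3
   + 3 * kap * u ^+ 2 * (\1_[set v | C < v]%N (X k w) * (X k w)%:R ^+ 3)).
  by rewrite (expD (itg_cst _ _) (itgZ _ it)) exp_cst (expZ _ it).
apply: exp_norm_le.
- by apply: itgB => //; apply: itgB => //; exact: itgZ.
- by apply: itgD; [exact: itg_cst|exact: itgZ].
move=> w; have -> : b (path k0 w) * H w - (b (path k0 w) * cosS u k w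
    - u ^+ 2 / 2 * (b (path k0 w) * cosS u k w * Vx (X k w))) =
  b (path k0 w) * (H w - cosS u k w * (1 - u ^+ 2 / 2 * Vx (X k w))) by ring.
rewrite normrM; apply: le_trans (hA (X k w) u (u * Smart k w + theta)).
by rewrite ler_piMl.
Qed.

Let gC C n : R := \1_[set v | v <= C]%N n * Vx n.
Let GC C : R := kap * C%:R ^+ 3.

Lemma gC_bounded C n : `|gC C n| <= GC C.
Proof.
rewrite /gC indicE; have [/set_mem /= h|_] := boolP (n \in _); last first.
  by rewrite mul0r normr0 mulr_ge0 ?kap_ge0 ?exprn_ge0.
rewrite mul1r ger0_norm ?Vx_ge0 // (le_trans (Vx_le n)) // ler_wpM2l ?kap_ge0 //.
by rewrite lerXn2r ?nnegrE // ler_nat.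
Qed.

Let pg C := \int[Q]_n gC C n.

Lemma pg_bounded C : `|pg C| <= GC C.
Proof.
rewrite -[leRHS](exp_cst Q); apply: exp_norm_le => //.
- exact: Q_itg (gC_bounded C).
- exact: itg_cst.
- exact: gC_bounded.
Qed.

(** The conditional variance is first truncated to the bounded function [gC C], which costs the
    first two error terms. For the bounded part the past is cut [m] steps earlier, so that the
    kernel has time to mix. When fewer than [m] steps have elapsed since [k0], only the crude bound
    2 [GC C] is available. *)
Lemma variance_replacement C m Z u k : (k0 <= k)%N ->
  (forall j, itg P (fun w => `|zeta (X j w) (X j.+1 w)|) /\
   \int[P]_w `|zeta (X j w) (X j.+1 w)| <= Z) ->
  `|\int[P]_w (b (path k0 w) * cosS u k w * Vx (X k w)) - v * phi u k| <=
  kap * tailX C k + `|v - pg C| +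
  (if (k0 + m <= k)%N then 2 * GC C * (m%:R * `|u| * Z)
       + alpha ^+ m * (2 * GC C) * (a 1 (k - m) + m1) else 2 * GC C).
Proof.
move=> k0k hZ.
have ib := itg_bcos u k0k; have iV := itg_mul u k0k (itg_VX k).
have ig : itg P (fun w => gC C (X k w)) := X_itg k (gC_bounded C).
have it := itg_tail C k.
have igp : itg P (fun w => gC C (X k w) - pg C) by apply: itgB => //; exact: itg_cst.
have j1 := itg_mul u k0k (itgB (itg_VX k) ig).
have j2 := itg_mul u k0k igp.
have VgE w : Vx (X k w) - gC C (X k w) = \1_[set n | C < n]%N (X k w) * Vx (X k w).
  rewrite /gC !indicE; have [h|h] := leqP (X k w) C.
    by rewrite mem_set // memNset /= ?mul1r ?mul0r ?subrr //; apply/negP; rewrite -leqNgt.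
  by rewrite memNset ?mem_set //= ?mul1r ?mul0r ?subr0 //; apply/negP; rewrite -ltnNge.
have -> : \int[P]_w (b (path k0 w) * cosS u k w * Vx (X k w)) - v * phi u k =
  \int[P]_w (b (path k0 w) * cosS u k w * (Vx (X k w) - gC C (X k w))) +
  - (v - pg C) * phi u k + \int[P]_w (b (path k0 w) * cosS u k w * (gC C (X k w) - pg C)).
  rewrite /phi -(expZ v ib) -(expB iV (itgZ v ib)) -(expZ _ ib).
  rewrite -(expD j1 (itgZ _ ib)) -(expD (itgD j1 (itgZ _ ib)) j2).
  by apply: eq_Rintegral => w _; ring.
apply: le_trans (ler_normD _ _) _; apply: lerD.
  apply: le_trans (ler_normD _ _) _; apply: lerD.
    rewrite -(expZ kap it); apply: exp_norm_le => //; first exact: itgZ.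
    move=> w; rewrite VgE normrM -[leRHS]mul1r; apply: ler_pM => //.
    rewrite indicE; case: (_ \in _); last by rewrite !mul0r normr0 mulr0.
    by rewrite !mul1r ger0_norm ?Vx_ge0 // Vx_le.
  rewrite normrM normrN ler_piMr //.
  rewrite -[leRHS](exp_cst P 1); apply: exp_norm_le => //; exact: itg_cst.
have gp2 n : `|gC C n - pg C| <= 2 * GC C.
  rewrite (le_trans (ler_normB _ _)) // mulr_natl mulr2n lerD ?gC_bounded //.
  exact: pg_bounded.
have GC0 : 0 <= 2 * GC C by apply: le_trans (gp2 0%N).
case: ifPn => [k0m|_]; last first.
  rewrite -[leRHS](exp_cst P); apply: exp_norm_le => //; first exact: itg_cst.
  move=> w; rewrite normrM -[leRHS]mul1r; exact: ler_pM.
have mk : (m <= k)%N by rewrite (leq_trans _ k0m) // leq_addl.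
have k0km : (k0 <= k - m)%N by rewrite leq_subRL // addnC.
have km : (k - m <= k)%N by rewrite leq_subr.
have j3 := itg_mul u k0km igp.
(* The cosine is moved back m steps. The first summand is small because the martingale has changed
   little, the second because the chain has nearly forgotten its state at time k - m. *)
have -> : \int[P]_w (b (path k0 w) * cosS u k w * (gC C (X k w) - pg C)) =
  \int[P]_w (b (path k0 w) * (cosS u k w - cosS u (k - m) w) * (gC C (X k w) - pg C)) +
  \int[P]_w (b (path k0 w) * cosS u (k - m) w * (gC C (X k w) - pg C)).
  rewrite -(subrK (\int[P]_w (b (path k0 w) * cosS u (k - m) w * (gC C (X k w) - pg C)))
    (\int[P]_w (b (path k0 w) * cosS u k w * (gC C (X k w) - pg C)))).
  congr (_ + _); rewrite -(expB j2 j3); apply: eq_Rintegral => w _; ring.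
apply: le_trans (ler_normD _ _) _; apply: lerD.
  have [iS ES] := itg_Smart_sub mk k0km hZ.
  apply: (@le_trans _ _ (\int[P]_w (2 * GC C * `|u| * `|Smart k w - Smart (k - m) w|))).
    apply: exp_norm_le; last 1 first.
    - move=> w; rewrite normrM [leLHS]mulrC -[leRHS]mulrA; apply: ler_pM => //.
      rewrite normrM -[leRHS]mul1r; apply: ler_pM => //.
      rewrite -normrM (le_trans (cos_lip _ _)) //.
      by rewrite le_eqVlt; apply/orP; left; apply/eqP; congr (`|_|); ring.
    - have E w : b (path k0 w) * (cosS u k w - cosS u (k - m) w) * (gC C (X k w) - pg C)
        = b (path k0 w) * cosS u k w * (gC C (X k w) - pg C)
         - b (path k0 w) * cosS u (k - m) w * (gC C (X k w) - pg C) by ring.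
      by under eq_fun do rewrite E; exact: itgB.
    - exact: itgZ.
  rewrite (expZ _ iS).
  have -> : 2 * GC C * (m%:R * `|u| * Z) = 2 * GC C * `|u| * (m%:R * Z) by ring.
  by rewrite ler_wpM2l // mulr_ge0.
have gp2' n : `|gC C n - pg C| <= 2 * GC C by [].
have -> : \int[P]_w (b (path k0 w) * cosS u (k - m) w * (gC C (X k w) - pg C)) =
   \int[P]_w (F u (k - m) (path (k - m) w) * (gC C (X (k - m + m) w) - pg C)).
  by rewrite subnK //; apply: eq_Rintegral => w _; rewrite FE ?k0km ?leqnn.
have cF : itg P (fun w => F u (k - m) (path (k - m) w) * pg C).
  by apply: (@path_itg _ (fun p => F u (k - m) p * pg C) (GC C)) => p;
    rewrite normrM -[leRHS]mul1r; apply: ler_pM => //; exact: pg_bounded.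
have E1 : \int[P]_w (F u (k - m) (path (k - m) w) * (gC C (X (k - m + m) w) - pg C)) =
  \int[P]_w (F u (k - m) (path (k - m) w) * gC C (X (k - m + m) w)) -
  \int[P]_w (F u (k - m) (path (k - m) w) * pg C).
  rewrite -expB //; first by apply: eq_Rintegral => w _; ring.
  rewrite subnK //.
  have := itg_mul u k0km ig.
  by under eq_fun do rewrite -(@FE u _ (k - m)%N) ?k0km ?leqnn //.
rewrite E1 (markov_iter _ _ (F1 u (k - m)) (gC_bounded C)).
have iF : itg P (fun w => F u (k - m) (path (k - m) w) * iter m K (gC C) (X (k - m) w)).
  apply: (@itg_bounded _ _ _ _ _ (GC C)).
    apply: eq_measurable_fun (pathM (k - m) (fun p => F u (k - m) p *
      iter m K (gC C) (nth 0%N p (k - m)))) => w _.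
    by rewrite last_path_of.
  move=> w; rewrite normrM -[leRHS]mul1r; apply: ler_pM => //.
  by apply: iterK_bounded; exact: gC_bounded.
rewrite -expB //.
have iX := @X_i (k - m) 1 isT.
have -> : alpha ^+ m * (2 * GC C) * (a 1 (k - m) + m1) =
    \int[P]_w (alpha ^+ m * (2 * GC C) * ((X (k - m) w)%:R ^+ 1 + m1)).
  by rewrite (expZ _ (itgD iX (itg_cst _ _))) (expD iX (itg_cst _ _)) exp_cst.
apply: exp_norm_le; [exact: itgB|by apply: itgZ; apply: itgD => //; exact: itg_cst|].
move=> w; rewrite -mulrBr normrM -[leRHS]mul1r; apply: ler_pM => //.
by rewrite expr1; apply: K_ergodic; exact: gC_bounded.
Qed.

(** The larger error [r1] occurs only as long as the lag [m] does not fit between [k0] and the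
    present, hence at most [m] times. A factor q <= 1 does not amplify earlier errors. *)
Lemma phi_iter (u q r0 r1 : R) m : 0 <= q <= 1 -> 0 <= r0 -> 0 <= r1 ->
  (forall k, (k0 <= k)%N -> `|phi u k.+1 - q * phi u k| <=
     r0 + (if (k0 + m <= k)%N then 0 else r1)) ->
  forall j, `|phi u (k0 + j) - q ^+ j * phi u k0| <= j%:R * r0 + (minn j m)%:R * r1.
Proof.
move=> /andP[q0 q1] r00 r10 h; elim=> [|j IH].
  by rewrite addn0 expr0 mul1r subrr normr0 min0n !mul0r addr0.
have -> : phi u (k0 + j.+1) - q ^+ j.+1 * phi u k0 =
   (phi u (k0 + j).+1 - q * phi u (k0 + j)) + q * (phi u (k0 + j) - q ^+ j * phi u k0).
  by rewrite addnS exprS; ring.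
apply: le_trans (ler_normD _ _) _.
have h1 := h (k0 + j)%N (leq_addr _ _).
have h2 : `|q * (phi u (k0 + j) - q ^+ j * phi u k0)| <= j%:R * r0 + (minn j m)%:R * r1.
  by rewrite normrM (ger0_norm q0) (le_trans _ IH) // ler_piMl.
apply: le_trans (lerD h1 h2) _; rewrite leq_add2l.
have [mj|jm] := leqP m j.
  rewrite (minn_idPr (leq_trans mj (leqnSn j))) -natr1.
  by rewrite le_eqVlt; apply/orP; left; apply/eqP; ring.
rewrite (minn_idPl jm) -!natr1.
by rewrite le_eqVlt; apply/orP; left; apply/eqP; ring.
Qed.

(** The multiplier is exp (-u^2 v/2) rather than 1 - u^2 v/2 because it lies in [0, 1] for every u,
    as [phi_iter] demands; the exchange costs (u^2 v/2)^2. *)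
Lemma phi_contract C m A Z tau delta B u k : (k0 <= k)%N -> 0 <= A -> 0 <= Z ->
  (forall (x : nat) (u c : R),
  `|\int[P]_w cos (c + u * zeta x (W x w)) - cos c * (1 - u ^+ 2 / 2 * Vx x)| <=
  A * `|u| ^+ 3 + 3 * kap * u ^+ 2 * (\1_[set v | C < v]%N x * x%:R ^+ 3)) ->
  (forall j, itg P (fun w => `|zeta (X j w) (X j.+1 w)|) /\
   \int[P]_w `|zeta (X j w) (X j.+1 w)| <= Z) ->
  (forall k, tailX C k <= tau) -> `|v - pg C| <= delta ->
  (forall k, a 1 k + m1 <= B) ->
  `|phi u k.+1 - expR (- (u ^+ 2 / 2 * v)) * phi u k| <=
  (A * `|u| ^+ 3 + 3 * kap * u ^+ 2 * tau +
   u ^+ 2 / 2 * (kap * tau + delta + 2 * GC C * (m%:R * `|u| * Z) +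
     alpha ^+ m * (2 * GC C) * B) + (u ^+ 2 / 2 * v) ^+ 2) +
  (if (k0 + m <= k)%N then 0 else u ^+ 2 / 2 * (2 * GC C)).
Proof.
move=> k0k A0 Z0 hA hZ htau hdelta hB.
have u20 : 0 <= u ^+ 2 / 2 by rewrite divr_ge0 ?sqr_ge0.
have GC0 : 0 <= GC C by rewrite mulr_ge0 ?kap_ge0 ?exprn_ge0.
have al0 : 0 <= alpha ^+ m by rewrite exprn_ge0 // ltW.
set y := u ^+ 2 / 2 * v.
have y0 : 0 <= y by rewrite mulr_ge0 // v_ge0.
pose I := \int[P]_w (b (path k0 w) * cosS u k w * Vx (X k w)).
have -> : phi u k.+1 - expR (- y) * phi u k =
  (phi u k.+1 - (phi u k - u ^+ 2 / 2 * I)) + - (u ^+ 2 / 2) * (I - v * phi u k)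
   + - (expR (- y) - (1 - y)) * phi u k by rewrite /y; ring.
have p1 : `|phi u k| <= 1.
  rewrite -[leRHS](exp_cst P 1); apply: exp_norm_le; [exact: itg_bcos|exact: itg_cst|].
  by move=> w; exact: bcos1.
have h1 := phi_step A0 hA u k0k.
have h2 := variance_replacement C m u k0k hZ.
have h3 := expRN_taylor y0.
have n3 : `|- (expR (- y) - (1 - y)) * phi u k| <= y ^+ 2.
  by rewrite normrM normrN (le_trans _ h3) // ler_piMr.
have n2 : `|- (u ^+ 2 / 2) * (I - v * phi u k)| <= u ^+ 2 / 2 *
  (kap * tau + delta + (if (k0 + m <= k)%N then 2 * GC C * (m%:R * `|u| * Z)
       + alpha ^+ m * (2 * GC C) * B else 2 * GC C)).
  rewrite normrM normrN (ger0_norm u20) ler_wpM2l //; apply: le_trans h2 _.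
  apply: lerD; first by rewrite lerD // ler_wpM2l ?kap_ge0.
  case: ifP => // _; rewrite lerD2l ler_wpM2l //; apply: mulr_ge0 => //.
  exact: mulr_ge0.
have n1 : `|phi u k.+1 - (phi u k - u ^+ 2 / 2 * I)| <=
    A * `|u| ^+ 3 + 3 * kap * u ^+ 2 * tau.
  apply: le_trans h1 _; rewrite lerD2l ler_wpM2l //.
  by rewrite mulr_ge0 ?sqr_ge0 // mulr_ge0 ?kap_ge0.
apply: le_trans (ler_normD _ _) _.
apply: le_trans (lerD (le_trans (ler_normD _ _) (lerD n1 n2)) n3) _.
case: ifP => _; first by rewrite addr0 !addrA.
have B0 : 0 <= B.
  by rewrite (le_trans _ (hB 0%N)) // addr_ge0 ?a_ge0 //; apply: exp_ge0.
have e1' : 0 <= u ^+ 2 / 2 * (2 * GC C * (m%:R * `|u| * Z)).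
  apply: (mulr_ge0 u20); apply: mulr_ge0; first exact: mulr_ge0.
  by apply: mulr_ge0 => //; apply: mulr_ge0.
have e2' : 0 <= u ^+ 2 / 2 * (alpha ^+ m * (2 * GC C) * B).
  apply: (mulr_ge0 u20); apply: mulr_ge0 => //; apply: mulr_ge0 => //.
  exact: mulr_ge0.
by rewrite !mulrDr; move: e1' e2'; lra.
Qed.

Lemma phi0 u : phi u k0 = \int[P]_w b (path k0 w) * cos theta.
Proof.
rewrite /phi mulrC -expZ; last exact: (path_itg _ b1).
apply: eq_Rintegral => w _; rewrite /cosS /Smart big_geq // mulr0 add0r.
by rewrite mulrC.
Qed.

(** With u = t/sqrt n, about n contractions by exp (-t^2 v/(2 n)) are composed. The constants are
    chosen in the order tau, C, then A and m, and n last: the terms in tau and in alpha^m contribute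
    at most e together, and all others are O(n^(-1/2)). *)
Lemma clt_cos t :
  \int[P]_w (b (path k0 w) * cos (t / Num.sqrt n%:R * Smart n w + theta))
  @[n --> \oo] -->
  \int[P]_w b (path k0 w) * cos theta * expR (- (t ^+ 2 / 2 * v)).
Proof.
set p0 := _ * cos theta.
have p01 : `|p0| <= 1.
  rewrite /p0 normrM -[leRHS]mulr1; apply: ler_pM => //; last exact: cos_max.
  rewrite -[leRHS](exp_cst P 1); apply: exp_norm_le => //; last exact: itg_cst.
  exact: (path_itg _ b1).
pose u (n : nat) := t / Num.sqrt (n%:R : R).
have u2 n : (0 < n)%N -> u n ^+ 2 = t ^+ 2 / n%:R.
  by move=> n0; rewrite /u expr_div_n sqr_sqrtr.
apply: (@cvg_approx _ _
  (fun n => expR (- (u n ^+ 2 / 2 * v)) ^+ (n - k0) * p0)).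
  rewrite [X in _ --> X]mulrC; apply: cvgMl.
  have E : \forall n \near \oo, expR (- (t ^+ 2 / 2 * v * (1 - k0%:R / n%:R))) =
     expR (- (u n ^+ 2 / 2 * v)) ^+ (n - k0).
    exists k0.+1 => // n /= kn; have n0 : (0 < n)%N by rewrite (leq_trans _ kn).
    rewrite -expRM_natl u2 // natrB 1?ltnW //; congr expR.
    by field; rewrite pnatr_eq0 -lt0n.
  apply: cvg_trans (near_eq_cvg E) _.
  apply: continuous_cvg; first exact: continuous_expR.
  apply: cvgN; rewrite -[X in _ --> X]mulr1; apply: cvgMr.
  rewrite -[X in _ --> X]subr0; apply: cvgB; first exact: cvg_cst.
  rewrite -(mulr0 k0%:R); apply: cvgMr.
  have E2 : \forall n \near \oo, (Num.sqrt (n%:R : R))^-1 * (Num.sqrt (n%:R : R))^-1 = n%:R^-1.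
    by apply: nearW => n; rewrite -invfM -expr2 sqr_sqrtr.
  apply: cvg_trans (near_eq_cvg E2) _.
  by rewrite -(mulr0 0); apply: cvgM; exact: cvg_invsqrt.
move=> e e0.
have [Z Z0 hZ] := zetaX1.
have [B1 hB1] := @a_bounded 1 isT.
pose B := B1 + m1; have hB k : a 1 k + m1 <= B by rewrite lerD2r.
(* [L] dominates 4 kap t^2, the coefficient of tau in the total error: 3 kap from the Taylor
   remainder, and kap/2 twice from the truncation of the variance. The final + 1 keeps it positive
   when t = 0. *)
pose L := t ^+ 2 * (4 * kap + kap + 1) + 1.
have t20 : 0 <= t ^+ 2 by rewrite sqr_ge0.
have L0 : 0 < L.
  have k0' := kap_ge0; have : 0 <= t ^+ 2 * (4 * kap + kap + 1).
    by apply: mulr_ge0 => //; move: kap k0' => kk; lra.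
  by rewrite /L; move: (t ^+ 2 * _) => z; lra.
have tau0 : 0 < e / 2 / L by rewrite !divr_gt0.
pose tau := e / 2 / L.
have [C1 hC1] := X_uniformly_integrable tau0.
have [C2 hC2] := @Q_tail 3 _ isT tau0.
pose C := maxn C1 C2.
have htau k : tailX C k <= tau by apply: hC1; rewrite leq_maxl.
have hdelta : `|v - pg C| <= kap * tau.
  have := hC2 C (leq_maxr _ _).
  have it : itg Q (fun n => \1_[set v | v <= C]%N n * n%:R ^+ 3) := Q_itg (@trunc_bounded 3 C).
  have i3 := @Q_itgp 3 isT.
  rewrite /mm -(expB i3 it) => h; rewrite /v /pg -(expB itg_VQ (Q_itg (gC_bounded C))).
  apply: le_trans (ler_wpM2l kap_ge0 h); rewrite -(expZ _ (itgB i3 it)).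
  apply: exp_norm_le; [exact: itgB itg_VQ (Q_itg (gC_bounded C))|by apply: itgZ; exact: itgB|].
  move=> n; rewrite /gC indicE; case: (_ \in _).
    by rewrite !mul1r !subrr mulr0 normr0.
  by rewrite !mul0r !subr0 ger0_norm ?Vx_ge0 // Vx_le.
have [A A0 hA] := step_cos C.
have [m hm] : exists m, t ^+ 2 / 2 * (alpha ^+ m * (2 * GC C) * B) <= e / 2.
  have : t ^+ 2 / 2 * (alpha ^+ m * (2 * GC C) * B) @[m --> \oo] --> 0.
    rewrite -(mulr0 (t ^+ 2 / 2)); apply: cvgMr; rewrite -(mul0r B); apply: cvgMl.
    rewrite -(mul0r (2 * GC C)); apply: cvgMl.
    by apply: cvg_expr; rewrite gtr0_norm.
  have e20 : 0 < e / 2 by rewrite divr_gt0.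
  move=> /cvgr0Pnorm_le/(_ _ e20)[m _ /(_ m (leqnn m)) hm].
  by exists m; exact: le_trans (ler_norm _) hm.
exists (A * `|t| ^+ 3 + t ^+ 2 * (GC C) * m%:R * `|t| * Z + (t ^+ 2 / 2 * v) ^+ 2 +
  m%:R * (t ^+ 2 * GC C)), k0.+1 => n kn.
have n0 : (0 < n)%N by rewrite (leq_trans _ kn).
have nR0 : 0 < n%:R :> R by rewrite ltr0n.
have GC0 : 0 <= GC C by rewrite mulr_ge0 ?kap_ge0 ?exprn_ge0.
have v0 := v_ge0; have un20 : 0 <= u n ^+ 2 by rewrite sqr_ge0.
have step := fun k (k0k : (k0 <= k)%N) =>
  phi_contract m (u n) k0k A0 Z0 hA hZ htau hdelta hB.
set r0 := (A * _ + _ + _ + _) in step.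
have B0 : 0 <= B.
  by rewrite (le_trans _ (hB 0%N)) // addr_ge0 ?a_ge0 //; apply: exp_ge0.
have al0 : 0 <= alpha ^+ m by rewrite exprn_ge0 // ltW.
have kt0 : 0 <= kap * tau by rewrite mulr_ge0 ?kap_ge0 // ltW.
have k0' := kap_ge0; have tau0' := ltW tau0.
have un2 : 0 <= u n ^+ 2 / 2 by rewrite divr_ge0.
have b1' : 0 <= 2 * GC C * (m%:R * `|u n| * Z).
  apply: mulr_ge0; first exact: mulr_ge0.
  by apply: mulr_ge0 => //; apply: mulr_ge0.
have b2' : 0 <= alpha ^+ m * (2 * GC C) * B.
  by apply: mulr_ge0 => //; apply: mulr_ge0 => //; exact: mulr_ge0.
have r00 : 0 <= r0.
  apply: addr_ge0; last exact: sqr_ge0.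
  apply: addr_ge0; first apply: addr_ge0.
  - by apply: mulr_ge0 => //; exact: exprn_ge0.
  - by apply: mulr_ge0 => //; apply: mulr_ge0 => //; exact: mulr_ge0.
  - by apply: mulr_ge0 => //; rewrite !addr_ge0.
have q01 : 0 <= expR (- (u n ^+ 2 / 2 * v)) <= 1.
  by rewrite expR_ge0 /= -[leRHS]expR0 ler_expR oppr_le0 mulr_ge0.
have r10 : 0 <= u n ^+ 2 / 2 * (2 * GC C).
  by apply: mulr_ge0 => //; exact: mulr_ge0.
have := phi_iter q01 r00 r10 step (n - k0); rewrite subnKC 1?ltnW // phi0 -/p0 => h.
apply: le_trans h _.
set s := Num.sqrt n%:R.
have s0 : 0 < s by rewrite sqrtr_gt0.
have s1 : 1 <= s by rewrite -[leLHS]sqrtr1 ler_wsqrtr // ler1n.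
have ss : n%:R = s ^+ 2 by rewrite sqr_sqrtr.
have ua : `|u n| = `|t| / s.
  by rewrite /u normrM normfV (ger0_norm (sqrtr_ge0 _)).
have ub : u n ^+ 2 = t ^+ 2 / s ^+ 2 by rewrite u2 // ss.
apply: (@le_trans _ _ (n%:R * r0 + m%:R * (u n ^+ 2 / 2 * (2 * GC C)))).
  by apply: lerD; apply: ler_wpM2r => //; rewrite ler_nat ?leq_subr // geq_minr.
have -> : n%:R * r0 + m%:R * (u n ^+ 2 / 2 * (2 * GC C)) =
    4 * kap * t ^+ 2 * tau + t ^+ 2 / 2 * (alpha ^+ m * (2 * GC C) * B)
    + ((A * `|t| ^+ 3 + t ^+ 2 * GC C * m%:R * `|t| * Z) / s
    + ((t ^+ 2 / 2 * v) ^+ 2 + m%:R * (t ^+ 2 * GC C)) / s ^+ 2).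
  rewrite /r0 ua ub ss; move: (GC C) (`|t|) (alpha ^+ m) => g tt am.
  by field; rewrite gt_eqF.
have c1 : 4 * kap * t ^+ 2 * tau <= e / 2.
  have -> : e / 2 = L * tau by rewrite /tau [RHS]mulrC divfK // gt_eqF.
  apply: ler_wpM2r => //; rewrite /L; move: (t ^+ 2) kap t20 k0' => z kk z0 kk0.
  by nra.
have c2 : ((t ^+ 2 / 2 * v) ^+ 2 + m%:R * (t ^+ 2 * GC C)) / s ^+ 2 <=
   ((t ^+ 2 / 2 * v) ^+ 2 + m%:R * (t ^+ 2 * GC C)) / s.
  apply: ler_wpM2l.
    by rewrite addr_ge0 ?sqr_ge0 // mulr_ge0 // mulr_ge0.
  by rewrite lef_pV2 ?posrE ?exprn_gt0 // expr2 ler_peMl // ltW.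
rewrite [in leRHS](_ : e = e / 2 + e / 2); last by rewrite -splitr.
apply: lerD; first exact: lerD.
apply: le_trans (lerD (lexx _) c2) _.
rewrite -mulrDl; apply: ler_wpM2r; first by rewrite invr_ge0 ltW.
by rewrite !addrA.
Qed.

End clt.

(** * Law of large numbers for the squared states *)

Section lln.

Let sum_powers n : \sum_(j < n) alpha ^+ (n - j) <= (1 - alpha)^-1.
Proof.
elim: n => [|n IH]; first by rewrite big_ord0 invr_ge0 ltW.
rewrite big_ord_recr /= subSnn expr1.
have -> : \sum_(j < n) alpha ^+ (n.+1 - j) = alpha * \sum_(j < n) alpha ^+ (n - j).
  rewrite mulr_sumr; apply: eq_bigr => j _.
  by rewrite subSn ?exprS // ltnW.
apply: (@le_trans _ _ (alpha * (1 - alpha)^-1 + alpha)).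
  by rewrite lerD2r ler_wpM2l // ltW.
rewrite [leRHS](_ : _ = alpha * (1 - alpha)^-1 + 1); last by field; rewrite gt_eqF.
by rewrite lerD2l ltW.
Qed.

(** By [K_ergodic] the covariance at times j <= n is at most a multiple of alpha^(n - j). Summing
    over j leaves a bound independent of n, so the variance of the sum grows at most linearly. *)
Lemma variance_bounded (g : nat -> R) M : (forall n, `|g n| <= M) ->
  exists G, forall n,
  itg P (fun w => (\sum_(j < n) (g (X j w) - \int[Q]_x g x)) ^+ 2) /\
  \int[P]_w (\sum_(j < n) (g (X j w) - \int[Q]_x g x)) ^+ 2 <= n%:R * G.
Proof.
move=> gM; set c := \int[Q]_x g x.
have M0 : 0 <= M by apply: le_trans (gM 0%N).
have cM : `|c| <= M.
  by rewrite -[leRHS](exp_cst Q); apply: exp_norm_le => //; [exact: Q_itg gM|exact: itg_cst].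
have hM x : `|g x - c| <= 2 * M.
  by rewrite (le_trans (ler_normB _ _)) // mulr_natl mulr2n lerD.
have [B1 hB1] := @a_bounded 1 isT.
pose cc := 2 * M * (2 * M * (B1 + m1)).
have B0 : 0 <= B1 + m1.
  by apply: addr_ge0; [exact: le_trans (a_ge0 1 0) (hB1 0%N)|apply: exp_ge0].
have cc0 : 0 <= cc by rewrite /cc; do 2 (apply: mulr_ge0; first exact: mulr_ge0).
have cov j n : (j <= n)%N ->
    \int[P]_w ((g (X j w) - c) * (g (X n w) - c)) <= cc * alpha ^+ (n - j).
  move=> jn; have al0 : 0 <= alpha ^+ (n - j) by rewrite exprn_ge0 // ltW.
  have hF (p : seq nat) : `|g (nth 0%N p j) - c| <= 2 * M by [].
  have := @markov_iter j (n - j) (fun p => g (nth 0%N p j) - c) (2 * M) g M hF gM.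
  rewrite subnKC // => e.
  have ij : itg P (fun w => g (X j w) - c) := X_itg j hM.
  have iK : itg P (fun w => (g (X j w) - c) * iter (n - j) K g (X j w)).
    apply: (X_itg j (f := fun x => (g x - c) * iter (n - j) K g x) (M := 2 * M * M)) => x.
    by rewrite /= normrM; apply: ler_pM => //; exact: iterK_bounded.
  have ign : itg P (fun w => (g (X j w) - c) * g (X n w)).
    have := path_itg n (f := fun p => (g (nth 0%N p j) - c) * g (nth 0%N p n)) (M := 2 * M * M).
    move=> /(_ _)/eq_integrable; apply => //.
      by move=> w _; rewrite !nth_path_of.
    by move=> p; rewrite normrM; apply: ler_pM.
  have -> : \int[P]_w ((g (X j w) - c) * (g (X n w) - c)) =
     \int[P]_w ((g (X j w) - c) * (iter (n - j) K g (X j w) - c)).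
    transitivity (\int[P]_w ((g (X j w) - c) * g (X n w)) - \int[P]_w (c * (g (X j w) - c))).
      rewrite -(expB ign (itgZ c ij)); apply: eq_Rintegral => w _; ring.
    have -> : \int[P]_w ((g (X j w) - c) * g (X n w)) =
       \int[P]_w ((g (X j w) - c) * iter (n - j) K g (X j w)).
      transitivity (\int[P]_w ((g (nth 0%N (path j w) j) - c) * g (X n w))).
        by apply: eq_Rintegral => w _; rewrite last_path_of.
      by rewrite e; apply: eq_Rintegral => w _; rewrite last_path_of.
    rewrite -(expB iK (itgZ c ij)); apply: eq_Rintegral => w _; ring.
  have iX := @X_i j 1 isT.
  apply: (@le_trans _ _ (\int[P]_w (2 * M * (alpha ^+ (n - j) * (2 * M)) *
     ((X j w)%:R ^+ 1 + m1)))).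
    apply: le_trans (ler_norm _) _; apply: exp_norm_le.
    - apply: (X_itg j (f := fun x => (g x - c) * (iter (n - j) K g x - c))
        (M := 2 * M * (2 * M))) => x.
      rewrite /= normrM; apply: ler_pM => //.
      rewrite (le_trans (ler_normB _ _)) // mulr_natl mulr2n lerD //.
      exact: iterK_bounded.
    - by apply: itgZ; apply: itgD => //; exact: itg_cst.
    - move=> w; rewrite normrM -mulrA; apply: ler_pM => //.
      exact: K_ergodic.
  rewrite (expZ _ (itgD iX (itg_cst _ _))) (expD iX (itg_cst _ _)) exp_cst.
  have -> : cc * alpha ^+ (n - j) = 2 * M * (alpha ^+ (n - j) * (2 * M)) * (B1 + m1).
    by rewrite /cc; ring.
  apply: ler_wpM2l; last by rewrite lerD2r; exact: hB1.
  by apply: mulr_ge0; [exact: mulr_ge0|apply: mulr_ge0 => //; exact: mulr_ge0].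
exists (2 * (cc / (1 - alpha)) + (2 * M) ^+ 2).
pose S n w := \sum_(j < n) (g (X j w) - c).
have Sb n w : `|S n w| <= n%:R * (2 * M).
  rewrite (le_trans (ler_norm_sum _ _ _)) //.
  apply: (@le_trans _ _ (\sum_(j < n) (2 * M))); first exact: ler_sum.
  by rewrite sumr_const card_ord -[leLHS]mulr_natl.
have Sm n k : (n <= k.+1)%N -> measurable_fun setT (S n).
  move=> nk; apply: eq_measurable_fun
    (pathM k (fun p => \sum_(j < n) (g (nth 0%N p j) - c))) => w _.
  apply: eq_bigr => j _; rewrite nth_path_of //.
  by rewrite -ltnS (leq_trans (ltn_ord j)).
have iS2 n : itg P (fun w => S n w ^+ 2).
  apply: (@itg_bounded _ _ _ _ _ ((n%:R * (2 * M)) ^+ 2)).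
    by apply: measurable_funX; exact: (Sm _ n).
  by move=> w; rewrite normrX lerXn2r ?nnegrE // mulr_ge0 // mulr_ge0.
elim=> [|n [_ IH]].
  split; first exact: (iS2 0%N).
  by under eq_Rintegral do rewrite big_ord0 expr0n; rewrite exp_cst mul0r.
split; first exact: (iS2 n.+1).
have ip j : (j < n.+1)%N -> itg P (fun w => (g (X j w) - c) * (g (X n w) - c)).
  move=> jn.
  have := path_itg n (f := fun p => (g (nth 0%N p j) - c) * (g (nth 0%N p n) - c)) (M := 2 * M * (2 * M)).
  move=> /(_ _)/eq_integrable; apply => //.
    by move=> w _; rewrite !nth_path_of.
  by move=> p; rewrite normrM; apply: ler_pM.
have iSn : itg P (fun w => \sum_(j < n) (g (X j w) - c) * (g (X n w) - c)).
  by apply: itg_sum => j _; apply: ip; rewrite ltnW // ltnS.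
have ih2 := ip n (ltnSn n).
have E w : (\sum_(j < n.+1) (g (X j w) - c)) ^+ 2 = S n w ^+ 2 +
   (2 * (\sum_(j < n) (g (X j w) - c) * (g (X n w) - c)) +
    (g (X n w) - c) * (g (X n w) - c)).
  by rewrite big_ord_recr /= -mulr_suml -/(S n w); ring.
under eq_Rintegral do rewrite E.
rewrite (expD (iS2 n) (itgD (itgZ _ iSn) ih2)) (expD (itgZ _ iSn) ih2) (expZ _ iSn).
rewrite -[n.+1%:R]natr1 [leRHS]mulrDl mul1r; apply: lerD; first exact: IH.
apply: lerD.
  rewrite ler_wpM2l // exp_sum; last by move=> j _; apply: ip; rewrite ltnW // ltnS.
  apply: (@le_trans _ _ (\sum_(j < n) cc * alpha ^+ (n - j))).
    by apply: ler_sum => j _; apply: cov; rewrite ltnW.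
  by rewrite -mulr_sumr ler_wpM2l // sum_powers.
rewrite -[leRHS](exp_cst P); apply: exp_le => //; first exact: itg_cst.
move=> w; apply: le_trans (ler_norm _) _; rewrite normrM expr2.
exact: ler_pM.
Qed.

(** The square is truncated at C to obtain a bounded function. The discarded part lives on {X > C},
    where X^2 <= X^3, and is small uniformly in time by uniform integrability. *)
Lemma lln_sq : \int[P]_w `|n%:R^-1 * \sum_(j < n) (X j w)%:R ^+ 2 - mm 2|
  @[n --> \oo] --> 0.
Proof.
apply: (@cvg_approx _ _ (fun=> 0)); first exact: cvg_cst.
move=> e e0; have e30 : 0 < e / 3 by rewrite divr_gt0.
have [C1 hC1] := X_uniformly_integrable e30.
have [C2 hC2] := @Q_tail 2 _ isT e30.
pose C := maxn C1 C2; pose g n : R := \1_[set v | v <= C]%N n * n%:R ^+ 2.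
have gM : forall n, `|g n| <= C%:R ^+ 2 := @trunc_bounded 2 C.
have [G hG] := variance_bounded gM; set c := \int[Q]_x g x in hG.
have ic := Q_itg gM; have i2Q := @Q_itgp 2 isT.
have cm : `|c - mm 2| <= e / 3.
  rewrite distrC ger0_norm; first exact: hC2 (leq_maxr _ _).
  rewrite subr_ge0; apply: exp_le => // n.
  by rewrite /g indicE ler_piMl ?exprn_ge0 //; case: (_ \in _); rewrite ?ler01.
have tail j : itg P (fun w => (X j w)%:R ^+ 2 - g (X j w)) /\
    \int[P]_w ((X j w)%:R ^+ 2 - g (X j w)) <= e / 3.
  have i1 : itg P (fun w => (X j w)%:R ^+ 2 - g (X j w)).
    by apply: itgB; [exact: X_i|exact: X_itg gM].
  split => //; apply: le_trans (hC1 C j (leq_maxl _ _)).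
  apply: exp_le => //.
    apply: (itg_le (XM j (fun n => \1_[set n | C < n]%N n * n%:R ^+ 3)) (X_itg3 j)) => w /=.
    rewrite ger0_norm; last by rewrite mulr_ge0 ?exprn_ge0 // indicE.
    by rewrite indicE ler_piMl ?exprn_ge0 //; case: (_ \in _); rewrite ?ler01.
  move=> w; rewrite /g !indicE; have [h|h] := leqP (X j w) C.
    by rewrite mem_set // mul1r subrr mulr_ge0 ?exprn_ge0.
  rewrite memNset ?mem_set //= ?mul1r ?mul0r ?subr0; last by apply/negP; rewrite -ltnNge.
  by rewrite -!natrX ler_nat; case: (X j w) h => // x _; exact: leq_pexp2l.
exists (G * (e / 6)^-1 / 1), 1%N => n n0; rewrite subr0.
have nR0 : 0 < n%:R :> R by rewrite ltr0n.
have ni0 : 0 <= n%:R^-1 :> R by rewrite invr_ge0 ltW.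
have [iS2 ES2] := hG n.
pose Y w := n%:R^-1 * \sum_(j < n) (g (X j w) - c).
have e60 : 0 < e / 6 by rewrite divr_gt0.
have it : itg P (fun w => \sum_(j < n) ((X j w)%:R ^+ 2 - g (X j w))).
  by apply: itg_sum => j _; exact: (tail j).1.
(* The centred truncated mean Y is controlled in L^1 by its second moment through |Y| <= z + Y^2/z
   with z = e/6. *)
pose rhs w := n%:R^-1 * \sum_(j < n) ((X j w)%:R ^+ 2 - g (X j w)) +
  ((e / 6 + (e / 6)^-1 * n%:R^-1 ^+ 2 * (\sum_(j < n) (g (X j w) - c)) ^+ 2) + e / 3).
have irhs : itg P rhs.
  by do ?[apply: itgD; try exact: itg_cst]; exact: itgZ.
have iX : itg P (fun w => n%:R^-1 * \sum_(j < n) (X j w)%:R ^+ 2 - mm 2).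
  apply: itgB; last exact: itg_cst.
  by apply: itgZ; apply: itg_sum => j _; exact: X_i.
have le w : `|n%:R^-1 * \sum_(j < n) (X j w)%:R ^+ 2 - mm 2| <= rhs w.
  have -> : n%:R^-1 * \sum_(j < n) (X j w)%:R ^+ 2 - mm 2 =
     n%:R^-1 * \sum_(j < n) ((X j w)%:R ^+ 2 - g (X j w)) + Y w + (c - mm 2).
    rewrite /Y !sumrB sumr_const card_ord -mulr_natl.
    by field; rewrite gt_eqF.
  rewrite /rhs -addrA; apply: le_trans (ler_normD _ _) _; apply: lerD.
    rewrite ger0_norm // mulr_ge0 // sumr_ge0 // => j _.
    by rewrite subr_ge0 /g indicE ler_piMl ?exprn_ge0 //; case: (_ \in _); rewrite ?ler01.
  apply: le_trans (ler_normD _ _) _; apply: lerD => //.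
  have YE : `|Y w| ^+ 2 = n%:R^-1 ^+ 2 * (\sum_(j < n) (g (X j w) - c)) ^+ 2.
    by rewrite real_normK ?num_real // /Y exprMn.
  rewrite -[X in _ + X]mulrA -YE.
  move: (`|Y w|) (normr_ge0 (Y w)) (e / 6) e60 => y y0 z z0.
  rewrite -(ler_pM2l z0) mulrDr mulrA mulfV ?gt_eqF // mul1r.
  by nra.
rewrite ger0_norm; last by apply: exp_ge0 => w.
apply: le_trans (exp_le (itg_norm iX) irhs le) _.
have iz := itgZ ((e / 6)^-1 * n%:R^-1 ^+ 2) iS2.
rewrite /rhs expD; [|exact: itgZ|by do ?[apply: itgD; try exact: itg_cst]].
rewrite (expD (itgD (itg_cst _ _) iz) (itg_cst _ _)) (expD (itg_cst _ _) iz) !exp_cst.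
rewrite (expZ _ it) (expZ _ iS2).
have b1 : n%:R^-1 * \int[P]_w \sum_(j < n) ((X j w)%:R ^+ 2 - g (X j w)) <= e / 3.
  rewrite exp_sum; last by move=> j _; exact: (tail j).1.
  have h : \sum_(j < n) \int[P]_w ((X j w)%:R ^+ 2 - g (X j w)) <= n%:R * (e / 3).
    apply: (@le_trans _ _ (\sum_(j < n) (e / 3))).
      by apply: ler_sum => j _; exact: (tail j).2.
    by rewrite sumr_const card_ord -[leLHS]mulr_natl.
  by rewrite mulrC ler_pdivrMr // mulrC.
have b2 : (e / 6)^-1 * n%:R^-1 ^+ 2 * (\int[P]_w (\sum_(j < n) (g (X j w) - c)) ^+ 2) <=
   G * (e / 6)^-1 / 1 / Num.sqrt n%:R.
  have ei0 : 0 <= (e / 6)^-1 by rewrite invr_ge0 ltW.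
  apply: (@le_trans _ _ ((e / 6)^-1 * n%:R^-1 ^+ 2 * (n%:R * G))).
    by apply: ler_wpM2l => //; rewrite mulr_ge0 // exprn_ge0.
  have G0 : 0 <= G.
    have := le_trans (exp_ge0 P (fun w => sqr_ge0 _)) ES2.
    by rewrite pmulr_rge0.
  have -> : (e / 6)^-1 * n%:R^-1 ^+ 2 * (n%:R * G) = G * (e / 6)^-1 / 1 * n%:R^-1.
    by field; rewrite !gt_eqF.
  apply: ler_wpM2l; first by rewrite divr1 mulr_ge0.
  have s0 : 0 < Num.sqrt (n%:R : R) by rewrite sqrtr_gt0.
  have s1 : 1 <= Num.sqrt (n%:R : R) by rewrite -[leLHS]sqrtr1 ler_wsqrtr // ler1n.
  by rewrite lef_pV2 ?posrE // -[leRHS]sqr_sqrtr ?ler0n // expr2 ler_peMl // ltW.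
move: b1 b2; lra.
Qed.

End lln.

End ergodic.

(** * Convergence of characteristic functions *)

Section tightness.
Context d (T : measurableType d) (R : realType) (P : probability T R).

Lemma measurable_norm_ge (f : T -> R) (c : R) : measurable_fun setT f ->
  measurable [set w | c <= `|f w|].
Proof.
move=> mf; rewrite (_ : [set w | _] =
    [set: T] `&` (fun w => `|f w|) @^-1` `[c, +oo[%classic).
  by apply: measurableT_comp.
by apply/seteqP; split => w; rewrite /= in_itv /= andbT; [split|case].
Qed.

Lemma rv_tight (f : T -> R) (e : R) : measurable_fun setT f -> 0 < e ->
  exists N : nat, forall n, (N <= n)%N -> fine (P [set w | n%:R <= `|f w|]) <= e.
Proof.
move=> mf e0.
have mA (n : nat) : measurable [set w | n%:R <= `|f w|] := measurable_norm_ge _ mf.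
have : \int[P]_w \1_[set w | n%:R <= `|f w|] w @[n --> \oo] --> \int[P]_w (0 : R).
  apply: (@exp_dominated _ _ _ _ _ _ (fun=> 1)).
  - by move=> n; exact: measurable_indicR.
  - exact: measurable_cst.
  - exact: itg_cst.
  - move=> w; apply: cvg_near_cst; exists (Num.truncn `|f w|).+1 => // n /= nN.
    rewrite indicE memNset //= => h.
    have := truncnS_gt `|f w|; rewrite ltNge => /negP; apply.
    by rewrite (le_trans _ h) // ler_nat.
  - by move=> n w; rewrite indicE; case: (_ \in _); rewrite ?normr1 ?normr0.
rewrite exp_cst => /cvgr0Pnorm_le/(_ _ e0)[N _ h]; exists N => n Nn.
by have := h n Nn; rewrite exp_indic //; exact: le_trans (ler_norm _).
Qed.

End tightness.

(** * Bernstein approximation and uniform continuity *)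

Section bernstein.
Context (R : realType).
Implicit Types (f g : nat -> R) (u : R).

(* The expectation of [f] under the binomial law of parameters [n] and [u]. *)
Fixpoint bern n f u : R :=
  if n is n'.+1 then u * bern n' (fun k => f k.+1) u + (1 - u) * bern n' f u
  else f 0%N.

Lemma bern_le n f g u : 0 <= u <= 1 -> (forall k, f k <= g k) ->
  bern n f u <= bern n g u.
Proof.
move=> /andP[u0 u1]; elim: n f g => [|n IH] f g fg //=.
by rewrite lerD // ler_wpM2l ?subr_ge0 // IH.
Qed.

Lemma bern_affine n f u (a b : R) :
  bern n (fun k => a + b * f k) u = a + b * bern n f u.
Proof.
elim: n f => [|n IH] f //=.
by have /= -> := IH (fun k => f k.+1); rewrite IH; ring.
Qed.

Lemma bern_cst n (c u : R) : bern n (fun=> c) u = c.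
Proof. by elim: n => [|n IH] //=; rewrite !IH; ring. Qed.

Lemma bern_norm n f u M : 0 <= u <= 1 -> (forall k, `|f k| <= M) ->
  `|bern n f u| <= M.
Proof.
move=> u01 fM; rewrite ler_norml; apply/andP; split.
  rewrite -[leLHS](bern_cst n _ u); apply: bern_le => // k.
  by have := fM k; rewrite ler_norml => /andP[].
rewrite -[leRHS](bern_cst n _ u); apply: bern_le => // k.
by have := fM k; rewrite ler_norml => /andP[].
Qed.

(** Squared bias plus variance. The centre [a] is left free because the induction shifts it by
    one. *)
Lemma bern_sqr n u (a : R) :
  bern n (fun k => (k%:R - a) ^+ 2) u = (n%:R * u - a) ^+ 2 + n%:R * u * (1 - u).
Proof.
elim: n a => [|n IH] a /=; first by rewrite !mul0r addr0.
have -> : (fun k => (k.+1%:R - a) ^+ 2) = (fun k => (k%:R - (a - 1)) ^+ 2 : R).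
  by apply/funext => k; rewrite -natr1; ring.
by rewrite !IH -natr1; ring.
Qed.

(** Uniform continuity at the points of a compact arc against all nearby points of the space: [y]
    need not lie on the curve. This is the situation of a random vector compared with its
    approximation on a line. *)
Lemma heine_along (V : normedModType R) (h : V -> R) (c : R -> V) (a b e : R) :
  continuous c -> (forall x, a <= x <= b -> {for c x, continuous h}) -> 0 < e ->
  exists2 r, 0 < r &
    forall x y, a <= x <= b -> `|c x - y| < r -> `|h (c x) - h y| < e.
Proof.
move=> cc ch e0.
have /compact_near_coveringP cpt := @segment_compact R a b.
have := @cpt R (0^'+) (fun r x => forall y, `|c x - y| < r -> `|h (c x) - h y| < e) _.
case.
  move=> x; rewrite /= in_itv /= => xab.
  have e20 : 0 < e / 2 by rewrite divr_gt0.
  have /cvgrPdist_lt/(_ _ e20)/nbhs_ballP[r /= r0 hr] := ch x xab.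
  have r20 : 0 < r / 2 by rewrite divr_gt0.
  have /cvgrPdist_lt/(_ _ r20) cx := cc x.
  exists ([set x' | `|c x - c x'| < r / 2], [set z | z < r / 2]) => /=.
    split; first exact: cx.
    by exists (r / 2) => // z /= + z0; rewrite sub0r normrN gtr0_norm.
  move=> [x' z] /= [xx' zr] y x'y.
  have h1 : `|h (c x) - h (c x')| < e / 2.
    apply: hr; rewrite -ball_normE /ball_ /= (lt_trans xx') //.
    by rewrite ltr_pdivrMr // ltr_pMr // ltr1n.
  have h2 : `|h (c x) - h y| < e / 2.
    apply: hr; rewrite -ball_normE /ball_ /= (le_lt_trans (ler_distD (c x') _ _)) //.
    by rewrite [ltRHS]splitr ltrD // (lt_trans x'y).
  rewrite (le_lt_trans (ler_distD (h (c x)) _ _)) // [ltRHS]splitr ltrD //.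
  by rewrite distrC.
move=> r /= r0 hr; exists (r / 2); first by rewrite divr_gt0.
move=> x y xab xy.
have : `|(0 : R) - r / 2| < r.
  by rewrite sub0r normrN gtr0_norm ?divr_gt0 // ltr_pdivrMr // ltr_pMr // ltr1n.
have r20 : 0 < r / 2 by rewrite divr_gt0.
by move=> /hr /(_ r20 x); apply; rewrite /= ?in_itv.
Qed.

Lemma heine (h : R -> R) (a b e : R) :
  (forall x, a <= x <= b -> {for x, continuous h}) -> 0 < e ->
  exists2 r, 0 < r & forall x y, a <= x <= b -> `|x - y| < r -> `|h x - h y| < e.
Proof. exact: (@heine_along R h id a b e (fun x => @cvg_id _ _)). Qed.

(** Where k/n is at least r away from u, the deviation 2 M is at most 2 M (k/n - u)^2/r^2, whose
    binomial mean is at most 2 M/(r^2 n). The degree is chosen to make this at most e/2. *)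
Lemma bern_approx (G : R -> R) M e : (forall u, `|G u| <= M) -> 0 < e ->
  (forall e', 0 < e' -> exists2 r, 0 < r & forall x y, `|x - y| < r -> `|G x - G y| < e') ->
  exists n, forall u, 0 <= u <= 1 ->
    `|bern n (fun k => G (k%:R / n%:R)) u - G u| <= e.
Proof.
move=> GM e0 uG.
have M0 : 0 <= M := le_trans (normr_ge0 _) (GM 0).
have e20 : 0 < e / 2 by rewrite divr_gt0.
have [r r0 hr] := uG _ e20.
pose L := 2 * M / r ^+ 2.
have L0 : 0 <= L by rewrite divr_ge0 ?exprn_ge0 ?mulr_ge0 // ltW.
pose n := (Num.truncn (L / (e / 2))).+1.
have nR0 : 0 < n%:R :> R by rewrite ltr0n.
exists n => u u01.
have key k : `|G (k%:R / n%:R) - G u| <= e / 2 + L / n%:R ^+ 2 * (k%:R - n%:R * u) ^+ 2.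
  have -> : L / n%:R ^+ 2 * (k%:R - n%:R * u) ^+ 2 = L * (k%:R / n%:R - u) ^+ 2.
    by field; rewrite gt_eqF.
  have [h|h] := ltP `|k%:R / n%:R - u| r.
    by rewrite (le_trans (ltW (hr _ _ h))) // lerDl mulr_ge0 // sqr_ge0.
  rewrite (le_trans (ler_normB _ _)) // -[leLHS]add0r lerD ?(ltW e20) //.
  apply: (@le_trans _ _ (2 * M)); first by rewrite [leRHS]mulr_natl [leRHS]mulr2n lerD.
  have -> : 2 * M = L * r ^+ 2 by rewrite /L divfK // gt_eqF // exprn_gt0.
  rewrite ler_wpM2l // -[leRHS]real_normK ?num_real //.
  by rewrite lerXn2r ?nnegrE // ltW.
have E : bern n (fun k => G (k%:R / n%:R)) u - G u =
   bern n (fun k => - G u + 1 * G (k%:R / n%:R)) u by rewrite bern_affine; ring.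
have b : bern n (fun k => e / 2 + L / n%:R ^+ 2 * (k%:R - n%:R * u) ^+ 2) u <= e.
  rewrite bern_affine bern_sqr subrr expr0n /= add0r [leRHS]splitr lerD2l.
  have u14 : u * (1 - u) <= 1 by case/andP: u01 => *; nra.
  apply: (@le_trans _ _ (L / n%:R)).
    have -> : L / n%:R ^+ 2 * (n%:R * u * (1 - u)) = L / n%:R * (u * (1 - u)).
      by field; rewrite gt_eqF.
    by rewrite ler_piMr // divr_ge0 // ltW.
  rewrite ler_pdivrMr // mulrC -ler_pdivrMr //.
  by apply: ltW; exact: truncnS_gt.
rewrite E ler_norml; apply/andP; split.
  have /(bern_le n u01) : forall k, (- (e / 2)) + (- (L / n%:R ^+ 2)) * (k%:R - n%:R * u) ^+ 2 <=
     - G u + 1 * G (k%:R / n%:R).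
    by move=> k; have := key k; rewrite ler_norml mul1r => /andP[+ _]; lra.
  by rewrite bern_affine; move: b; rewrite bern_affine; lra.
have /(bern_le n u01) h : forall k, - G u + 1 * G (k%:R / n%:R) <=
   e / 2 + L / n%:R ^+ 2 * (k%:R - n%:R * u) ^+ 2.
  by move=> k; have := key k; rewrite ler_norml mul1r => /andP[_]; lra.
exact: le_trans h b.
Qed.

End bernstein.

(** * Continuity theorem for real characteristic functions *)

Section continuity_theorem.
Context (R : realType).

(** The free phases make the class contain sines and constants, and make it stable under
    multiplication by a sine. *)
Inductive trig : (R -> R) -> Prop :=
| trig_cos (c t th : R) : trig (fun y => c * cos (t * y + th))
| trig_add f g : trig f -> trig g -> trig (fun y => f y + g y).

Lemma trig_scale (c : R) f : trig f -> trig (fun y => c * f y).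
Proof.
elim=> [c' t th|f1 g1 _ h1 _ h2].
  rewrite (_ : (fun _ => _) = fun y => (c * c') * cos (t * y + th)); first exact: trig_cos.
  by apply/funext => y; rewrite mulrA.
rewrite (_ : (fun _ => _) = fun y => c * f1 y + c * g1 y); first exact: trig_add.
by apply/funext => y; rewrite mulrDr.
Qed.

Lemma trig_cst (c : R) : trig (fun=> c).
Proof.
rewrite (_ : (fun _ => _) = fun y => c * cos (0 * y + 0)); first exact: trig_cos.
by apply/funext => y; rewrite mul0r addr0 cos0 mulr1.
Qed.

Lemma trig_mul_sin (t : R) f : trig f -> trig (fun y => sin (t * y) * f y).
Proof.
elim=> [c' t' th|f1 g1 _ h1 _ h2].
  rewrite (_ : (fun _ => _) = fun y =>
     (c' / 2) * cos ((t + t') * y + (th - pi / 2)) +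
     (c' / 2) * cos ((t' - t) * y + (th + pi / 2))).
    by apply: trig_add; exact: trig_cos.
  apply/funext => y; rewrite !addrA cosBpihalf cosDpihalf.
  have -> : (t + t') * y + th = t * y + (t' * y + th) by ring.
  have -> : (t' - t) * y + th = (t' * y + th) - t * y by ring.
  by rewrite sinD sinB; field.
rewrite (_ : (fun _ => _) = fun y => sin (t * y) * f1 y + sin (t * y) * g1 y).
  exact: trig_add.
by apply/funext => y; rewrite mulrDr.
Qed.

(** Each recursion step of [bern] multiplies by (1 + sin)/2 or (1 - sin)/2, which stays in the
    class. *)
Lemma trig_bern (t : R) n (f : nat -> R) :
  trig (fun y => bern n f ((1 + sin (t * y)) / 2)).
Proof.
elim: n f => [|n IH] f /=; first exact: trig_cst.
rewrite (_ : (fun _ => _) = fun y =>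
  (2^-1 * bern n (fun k => f k.+1) ((1 + sin (t * y)) / 2) +
    sin (t * y) * (2^-1 * bern n (fun k => f k.+1) ((1 + sin (t * y)) / 2))) +
  (2^-1 * bern n f ((1 + sin (t * y)) / 2) +
    sin (t * y) * (- 2^-1 * bern n f ((1 + sin (t * y)) / 2)))).
  by apply: trig_add; apply: trig_add; try apply: trig_mul_sin; exact: trig_scale.
by apply/funext => y; field.
Qed.

Lemma trig_bounded f : trig f -> exists M, forall y, `|f y| <= M.
Proof.
elim=> [c t th|f1 g1 _ [M1 h1] _ [M2 h2]].
  exists `|c| => y; rewrite normrM -[leRHS]mulr1 ler_wpM2l //; exact: cos_max.
by exists (M1 + M2) => y; rewrite (le_trans (ler_normD _ _)) // lerD.
Qed.

Lemma trig_measurable f : trig f -> measurable_fun setT f.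
Proof.
elim=> [c t th|f1 g1 _ h1 _ h2]; last exact: measurable_funD.
apply: measurable_funM => //; apply: (measurableT_comp (f := cos)).
  by apply: continuous_measurable_fun; exact: continuous_cos.
by apply: measurable_funD => //; exact: measurable_funM.
Qed.

Definition clip (c y : R) : R := Num.max (- c) (Num.min c y).

Lemma clip_bounds (c y : R) : 0 <= c -> - c <= clip c y <= c.
Proof.
by move=> c0; rewrite /clip le_max lexx /= ge_max ge_min lexx /= andbT; lra.
Qed.

Lemma clip_id (c y : R) : `|y| <= c -> clip c y = y.
Proof.
by rewrite ler_norml => /andP[h1 h2]; rewrite /clip min_r // max_r.
Qed.

Lemma clip_lip (c x y : R) : `|clip c x - clip c y| <= `|x - y|.
Proof.
rewrite /clip /Num.max /Num.min; do 4 ?case: ifPn; rewrite -?leNgt => *;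
  rewrite ler_norml; have := ler_norm (x - y); have := ler_norm (y - x);
  rewrite (distrC y); lra.
Qed.

(** Here cos z >= 1/2, so sin^2 z <= 3/4 < (7/8)^2. Staying away from 1 is what keeps [asin]
    continuous at the points used. *)
Lemma sin_small (z : R) : `|z| <= 1 -> `|sin z| <= 7 / 8.
Proof.
move=> z1; have h := cos_sub1_le z.
have z2 : z ^+ 2 <= 1.
  by rewrite -[leLHS]real_normK ?num_real // exprn_ile1.
have c2 : 1 / 2 <= cos z by move: h; rewrite ler_norml => /andP[h _]; lra.
have s2 : sin z ^+ 2 <= 3 / 4 by rewrite sin2cos2; nra.
rewrite -(@ler_pXn2r _ 2) ?nnegrE // ?divr_ge0 //.
by rewrite real_normK ?num_real //; lra.
Qed.

(** For |y| <= K one has y = K asin (sin (y/K)), so g is there a continuous function of sin (y/K),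
    extended by clipping. Its Bernstein polynomial, evaluated at (1 + sin (y/K))/2, is
    trigonometric, and being a mean of values of g it keeps the bound M on the whole line. *)
Lemma trig_approx (g : R -> R) M (K e : R) : continuous g ->
  (forall x, `|g x| <= M) -> 0 < K -> 0 < e ->
  exists2 p, trig p & (forall y, `|p y| <= M) /\ (forall y, `|y| <= K -> `|p y - g y| <= e).
Proof.
move=> cg gM K0 e0.
pose h v := g (K * asin v).
pose G u := h (clip (7 / 8) (2 * u - 1)).
have GM u : `|G u| <= M by exact: gM.
have uG e' : 0 < e' -> exists2 r, 0 < r & forall x y, `|x - y| < r -> `|G x - G y| < e'.
  move=> e'0; have [|r r0 hr] := @heine R h (- (7 / 8)) (7 / 8) e' _ e'0.
    move=> x /andP[x1 x2]; apply: (@continuous_comp _ _ _ (fun v => K * asin v) g).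
      apply: (@continuousM _ _ (cst K) asin); first exact: cst_continuous.
      by apply: continuous_asin; apply/andP; split; lra.
    exact: cg.
  exists (r / 2) => [|x y xy]; first by rewrite divr_gt0.
  apply: hr; first by apply: clip_bounds.
  apply: le_lt_trans (clip_lip _ _ _) _.
  have -> : 2 * x - 1 - (2 * y - 1) = 2 * (x - y) by ring.
  by rewrite normrM gtr0_norm // mulrC -ltr_pdivlMr.
have [n hn] := bern_approx GM e0 uG.
pose s y := (1 + sin (K^-1 * y)) / 2.
have s01 y : 0 <= s y <= 1.
  by rewrite /s; have := sin_geN1 (K^-1 * y); have := sin_le1 (K^-1 * y) => *; apply/andP; split; lra.
exists (fun y => bern n (fun k => G (k%:R / n%:R)) (s y)); first exact: trig_bern.
split=> [y|y yK]; first exact: bern_norm.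
have -> : g y = G (s y); last exact: hn.
have z1 : `|K^-1 * y| <= 1.
  by rewrite normrM normfV (gtr0_norm K0) mulrC ler_pdivrMr // mul1r.
rewrite /G /h.
have -> : 2 * s y - 1 = sin (K^-1 * y) by rewrite /s; field.
rewrite clip_id; last exact: sin_small.
rewrite sinK; first by rewrite mulrA mulfV ?mul1r // gt_eqF.
rewrite in_itv /=; move: z1; rewrite ler_norml => /andP[z1 z2].
by have := pihalf_ge1 R => p1; apply/andP; split; lra.
Qed.

Context d (T : measurableType d) (P : probability T R) (nu : probability R R).

(** On [-K, K] the function g is replaced by a trigonometric p, for which the convergence is
    assumed. Outside, tightness suffices, because |g - p| <= 2 M everywhere, whatever K is. *)
Lemma levy (H : nat -> T -> R) (rho : T -> R) (pB : R) (g : R -> R) (M : R) :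
  (forall n, measurable_fun setT (H n)) -> measurable_fun setT rho ->
  (forall w, `|rho w| <= 1) -> `|pB| <= 1 ->
  (forall t th, \int[P]_w (rho w * cos (t * H n w + th)) @[n --> \oo] -->
     pB * \int[nu]_x cos (t * x + th)) ->
  (forall e, 0 < e -> exists K N, forall n, (N <= n)%N ->
     fine (P [set w | K <= `|H n w|]) <= e) ->
  continuous g -> (forall x, `|g x| <= M) ->
  \int[P]_w (rho w * g (H n w)) @[n --> \oo] --> pB * \int[nu]_x g x.
Proof.
move=> mH mr r1 p1 hcos tight cg gM.
have mg : measurable_fun setT g by exact: continuous_measurable_fun.
have itgr (h : R -> R) B n : measurable_fun setT h -> (forall y, `|h y| <= B) ->
    itg P (fun w => rho w * h (H n w)).
  move=> mh hB; apply: (@itg_bounded _ _ _ _ _ B).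
    by apply: measurable_funM => //; exact: measurableT_comp.
  by move=> w; rewrite normrM -[leRHS]mul1r ler_pM.
have trigcvg p : trig p ->
    \int[P]_w (rho w * p (H n w)) @[n --> \oo] --> pB * \int[nu]_x p x.
  elim=> [c t th|f1 g1 t1 h1 t2 h2].
    have tc := trig_cos 1 t th.
    have mc : measurable_fun setT (fun y : R => cos (t * y + th)).
      by have := trig_measurable tc; apply: eq_measurable_fun => y _; rewrite mul1r.
    have cb (y : R) : `|cos (t * y + th)| <= 1 := cos_max _.
    have -> : pB * (\int[nu]_x (c * cos (t * x + th))) =
       c * (pB * \int[nu]_x (cos (t * x + th))).
      by rewrite expZ; [ring|exact: (itg_bounded _ mc cb)].
    have h : c * \int[P]_w (rho w * cos (t * H n w + th)) @[n --> \oo] -->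
        c * (pB * \int[nu]_x cos (t * x + th)) by apply: cvgMr; exact: hcos.
    apply: cvg_trans h; apply: near_eq_cvg; apply: nearW => n /=.
    rewrite -expZ; last exact: itgr mc cb.
    by apply: eq_Rintegral => w _; ring.
  have [B1 hB1] := trig_bounded t1; have [B2 hB2] := trig_bounded t2.
  have m1 := trig_measurable t1; have m2 := trig_measurable t2.
  rewrite expD; [|exact: (itg_bounded _ m1 hB1)|exact: (itg_bounded _ m2 hB2)].
  have h : \int[P]_w (rho w * f1 (H n w)) + \int[P]_w (rho w * g1 (H n w)) @[n --> \oo]
      --> pB * \int[nu]_x f1 x + pB * \int[nu]_x g1 x by apply: cvgD.
  rewrite mulrDr; apply: cvg_trans h; apply: near_eq_cvg; apply: nearW => n /=.
  rewrite -expD; [|exact: itgr m1 hB1|exact: itgr m2 hB2].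
  by apply: eq_Rintegral => w _; rewrite mulrDr.
have M0 : 0 <= M := le_trans (normr_ge0 _) (gM 0).
apply/cvgrPdist_le => e e0.
(* Two parts for replacing g by p under P, two for the same under nu, and one for the convergence of
   p. *)
pose e' := e / 5; have e'0 : 0 < e' by rewrite divr_gt0.
(* A tail mass that costs at most e' when the integrand is bounded by 2 M; the + 1 covers M = 0. *)
pose dl := e' / (2 * M + 1).
have dl0 : 0 < dl by rewrite divr_gt0 // ltr_wpDl // mulr_ge0.
have dlM : 2 * M * dl <= e'.
  rewrite /dl mulrCA ler_piMr ?(ltW e'0) // ler_pdivrMr ?mul1r; first lra.
  by rewrite ltr_wpDl // mulr_ge0.
have [K1 [N1 hN1]] := tight _ dl0.
have [N2 hN2] := @rv_tight _ _ R nu id dl (@measurable_id _ _ setT) dl0.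
pose K := Num.max 1 (Num.max K1 N2%:R).
have K0 : 0 < K by rewrite lt_max ltr01.
have [p tp [pM pg]] := trig_approx cg gM K0 e'0.
have mp := trig_measurable tp.
have dM y : `|g y - p y| <= 2 * M.
  by rewrite (le_trans (ler_normB _ _)) // mulr_natl mulr2n lerD.
have mgp : measurable_fun setT (fun y => g y - p y) by exact: measurable_funB.
have [N3 _ hN3] : \forall n \near \oo,
    `|pB * \int[nu]_x p x - \int[P]_w (rho w * p (H n w))| <= e'.
  by have /cvgrPdist_le/(_ _ e'0) := trigcvg p tp.
have sm d' (T' : measurableType d') (P' : probability T' R) (Y : T' -> R) (r : T' -> R) :
    measurable_fun setT Y -> measurable_fun setT r -> (forall w, `|r w| <= 1) ->
    fine (P' [set w | K <= `|Y w|]) <= dl ->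
    `|\int[P']_w (r w * (g (Y w) - p (Y w)))| <= 2 * e'.
  move=> mY mr' r1' hK.
  have mA := measurable_norm_ge K mY.
  have fM w : `|r w * (g (Y w) - p (Y w))| <= 2 * M.
    by rewrite normrM -[leRHS]mul1r ler_pM.
  have ir : itg P' (fun w => r w * (g (Y w) - p (Y w))).
    apply: (itg_bounded _ _ fM); apply: measurable_funM => //.
    exact: (measurableT_comp mgp mY).
  apply: le_trans (exp_norm ir) _.
  have fe w : ~ [set w | K <= `|Y w|] w -> `|r w * (g (Y w) - p (Y w))| <= e'.
    move=> /negP; rewrite -ltNge => h; rewrite normrM -[leRHS]mul1r ler_pM //.
    by rewrite distrC pg // ltW.
  apply: le_trans (exp_norm_split ir mA fM fe (ltW e'0)) _.
  have -> : 2 * e' = e' + e' by ring.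
  rewrite lerD2l; apply: le_trans dlM.
  by rewrite ler_wpM2l // mulr_ge0.
exists (maxn N1 N3) => // n /=; rewrite geq_max => /andP[n1 n3].
have s1 : `|\int[P]_w (rho w * (g (H n w) - p (H n w)))| <= 2 * e'.
  apply: sm => //; apply: le_trans (hN1 n n1); apply: prob_fine_le.
  - exact: measurable_norm_ge.
  - exact: measurable_norm_ge.
  - by move=> w /= h; rewrite (le_trans _ h) // /K !le_max lexx /= orbT.
have s2 : `|\int[nu]_x (1 * (g x - p x))| <= 2 * e'.
  apply: (sm _ _ nu id) => //; first by move=> w; rewrite normr1.
  apply: le_trans (hN2 N2 (leqnn _)); apply: prob_fine_le.
  - exact: measurable_norm_ge.
  - exact: measurable_norm_ge.
  - by move=> w /= h; rewrite (le_trans _ h) // /K !le_max lexx !orbT.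
have ig := itgr g M n mg gM; have ip := itgr p M n mp pM.
have ign := itg_bounded nu mg gM; have ipn := itg_bounded nu mp pM.
have E1 : \int[P]_w (rho w * (g (H n w) - p (H n w))) =
    \int[P]_w (rho w * g (H n w)) - \int[P]_w (rho w * p (H n w)).
  by rewrite -expB //; apply: eq_Rintegral => w _; rewrite mulrBr.
have E2 : \int[nu]_x (1 * (g x - p x)) = \int[nu]_x g x - \int[nu]_x p x.
  by rewrite -expB //; apply: eq_Rintegral => w _; rewrite mul1r.
rewrite E1 in s1; rewrite E2 in s2.
have := hN3 n n3; move: s1 s2.
set a := \int[P]_w (rho w * g (H n w)); set a' := \int[P]_w (rho w * p (H n w)).
set c := \int[nu]_x g x; set c' := \int[nu]_x p x => s1 s2 s3.
have -> : pB * c - a = pB * (c - c') + (pB * c' - a') + (a' - a) by ring.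
have s2' : `|pB * (c - c')| <= 2 * e'.
  by rewrite normrM -[leRHS]mul1r ler_pM.
apply: le_trans (ler_normD _ _) _; rewrite (distrC a').
apply: (le_trans (lerD (le_trans (ler_normD _ _) (lerD s2' s3)) s1)).
by rewrite /e'; lra.
Qed.

End continuity_theorem.

(** * Density and characteristic function of the normal law *)

Section normal_law.
Context (R : realType).
Notation mu := (@lebesgue_measure R).

Lemma integral_normal_prob (m s : R) (f : R -> \bar R) :
  (normal_prob m s).-integrable setT f ->
  (\int[normal_prob m s]_x f x = \int[mu]_x (f x * (normal_pdf m s x)%:E))%E.
Proof.
move=> fi; have mf := measurable_int _ fi.
rewrite -(Radon_Nikodym_change_of_variables (normal_prob_dominates m s)) //.
apply: ae_eq_integral => //.
- apply: emeasurable_funM => //; apply: (measurable_int mu).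
  apply: Radon_Nikodym_integrable; exact: normal_prob_dominates.
- apply: emeasurable_funM => //; apply/measurable_EFinP.
  exact: measurable_normal_pdf.
- apply: ae_eqe_mul2l => /=.
  rewrite Radon_NikodymE //=; first exact: normal_prob_dominates.
  move=> dom; case: cid => /= h [h1 h2 h3].
  apply: integral_ae_eq => //=.
  + by apply/measurable_EFinP; exact: measurable_normal_pdf.
  + by move=> E E01 mE; rewrite -h3.
Qed.

Context (s : R).
Hypothesis s0 : 0 < s.
Notation p := (normal_pdf 0 s).

Let sn0 : s != 0. Proof. by rewrite gt_eqF. Qed.

Lemma normal_pdf0E (x : R) : p x = normal_peak s * expR (- (2 * s ^+ 2)^-1 * x ^+ 2).
Proof.
rewrite normal_pdfE // /normal_fun subr0 mulNr mulNr; congr (_ * expR (- _)).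
by rewrite mulrC mulr_natl.
Qed.

Lemma is_derive_normal_pdf (x : R) : is_derive x 1 p (- (x / s ^+ 2) * p x).
Proof.
have -> : p = (fun y => normal_peak s * expR (- (2 * s ^+ 2)^-1 * y ^+ 2)).
  by apply/funext => y; rewrite normal_pdf0E.
have h1 : is_derive x 1 (fun y : R => - (2 * s ^+ 2)^-1 * y ^+ 2) (- (x / s ^+ 2)).
  apply: (@is_derive_eq _ _ _ (cst (- (2 * s ^+ 2)^-1) * (fun y : R => y ^+ 2))).
  rewrite /= scaler0 addr0 /GRing.scale /=; field.
  by rewrite sn0.
have h2 : is_derive x 1 (fun y : R => expR (- (2 * s ^+ 2)^-1 * y ^+ 2))
   (expR (- (2 * s ^+ 2)^-1 * x ^+ 2) * - (x / s ^+ 2)).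
  exact: is_derive1_comp.
have h3 : is_derive x 1 (cst (normal_peak s) *
     (fun y : R => expR (- (2 * s ^+ 2)^-1 * y ^+ 2)))
    (- (x / s ^+ 2) * (normal_peak s * expR (- (2 * s ^+ 2)^-1 * x ^+ 2))).
  apply: is_derive_eq.
  by rewrite /= scaler0 addr0 /GRing.scale /=; ring.
exact: h3.
Qed.

End normal_law.

Lemma is_derive_conv (R : realType) (f : R -> R) (x a b : R) :
  is_derive x 1 f a -> a = b -> is_derive x 1 f b.
Proof. by move=> h <-. Qed.

Section normal_characteristic_function.
Context (R : realType) (s : R).
Hypothesis s0 : 0 < s.
Notation mu := (@lebesgue_measure R).
Notation p := (normal_pdf 0 s).

Let sn0 : s != 0. Proof. by rewrite gt_eqF. Qed.

Let pM : measurable_fun setT (p : R -> R). Proof. exact: measurable_normal_pdf. Qed.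

Lemma integrable_bounded_pdf (f : R -> R) B : measurable_fun setT f ->
  (forall x, `|f x| <= B) -> mu.-integrable setT (EFin \o (fun x => f x * p x)).
Proof.
move=> mf fB.
apply: (le_integrable measurableT _ _ (integrableZl measurableT B (integrable_normal_pdf 0 s))).
  by apply/measurable_EFinP; exact: measurable_funM.
move=> x _ /=; rewrite lee_fin !normrM ler_wpM2r // (le_trans (fB x)) //.
exact: ler_norm.
Qed.

(** Half of the Gaussian exponent absorbs |x|: with z = x^2/(4 s^2), the product |x| exp (-z) is at
    most 1 + 4 s^2. The other half is proportional to a normal density of variance 2 s^2. *)
Lemma integrable_norm_pdf : mu.-integrable setT (EFin \o (fun x => `|x| * p x)).
Proof.
pose s' := s * Num.sqrt 2.
have s'0 : 0 < s' by rewrite mulr_gt0 // sqrtr_gt0.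
have s'2 : s' ^+ 2 = 2 * s ^+ 2 by rewrite exprMn sqr_sqrtr // mulrC.
pose C := normal_peak s * (1 + 4 * s ^+ 2) / normal_peak s'.
have pk : 0 < normal_peak s by exact: normal_peak_gt0.
have pk' : 0 < normal_peak s' by apply: normal_peak_gt0; rewrite gt_eqF.
apply: (le_integrable measurableT _ _ (integrableZl measurableT C (integrable_normal_pdf 0 s'))).
  by apply/measurable_EFinP; apply: measurable_funM => //; exact: measurableT_comp.
move=> x _ /=; rewrite lee_fin ger0_norm ?mulr_ge0 ?normal_pdf_ge0 //.
apply: le_trans (ler_norm _); rewrite normal_pdf0E // normal_pdf0E //.
pose z := x ^+ 2 / (4 * s ^+ 2).
have s20 : 0 < s ^+ 2 by rewrite exprn_gt0.
have z1 : - (2 * s' ^+ 2)^-1 * x ^+ 2 = - z.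
  by rewrite s'2 /z; field; rewrite sn0.
have z2 : - (2 * s ^+ 2)^-1 * x ^+ 2 = - z + - z.
  by rewrite /z; field; rewrite sn0.
rewrite z1 z2 expRD.
have -> : C * (normal_peak s' * expR (- z)) =
   normal_peak s * ((1 + 4 * s ^+ 2) * expR (- z)).
  by rewrite /C; field; rewrite gt_eqF.
have -> : `|x| * (normal_peak s * (expR (- z) * expR (- z))) =
  normal_peak s * (`|x| * expR (- z) * expR (- z)) by ring.
rewrite ler_pM2l // ler_pM2r ?expR_gt0 // expRN ler_pdivrMr ?expR_gt0 //.
have x1 : `|x| <= 1 + x ^+ 2.
  by rewrite -(real_normK (num_real x)); move: (`|x|) (normr_ge0 x) => y y0; nra.
apply: le_trans x1 _.
have zx : x ^+ 2 = 4 * s ^+ 2 * z by rewrite /z; field; rewrite sn0.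
have z0 : 0 <= z by rewrite divr_ge0 ?sqr_ge0 // mulr_ge0 // ltW.
have := expR_ge1Dx z; rewrite zx; move: (expR z) (s ^+ 2) s20 z0 => a b b0 c0 h.
by nra.
Qed.

(** The integrand is the derivative of sin (t x + th) p(x), which vanishes at both infinities. *)
Lemma normal_by_parts (t th : R) :
  \int[mu]_x (t * cos (t * x + th) * p x - sin (t * x + th) * (x / s ^+ 2) * p x) = 0.
Proof.
pose q x := sin (t * x + th) * p x.
pose q' x := t * cos (t * x + th) * p x - sin (t * x + th) * (x / s ^+ 2) * p x.
have Dl (x : R) : is_derive x 1 (fun y : R => t * y + th) t.
  apply: (@is_derive_eq _ _ _ (cst t * id + cst th)).
  by rewrite /= scaler0 !addr0 /GRing.scale /= mulr1.
have Dq (x : R) : is_derive x 1 q (q' x).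
  have hs : is_derive x 1 (fun y : R => sin (t * y + th)) (cos (t * x + th) * t).
    exact: is_derive1_comp.
  have hp := is_derive_normal_pdf s0 x.
  have : is_derive x 1 ((fun y : R => sin (t * y + th)) * p)
     (sin (t * x + th) *: (- (x / s ^+ 2) * p x) + p x *: (cos (t * x + th) * t)).
    exact: is_deriveM.
  by move=> /is_derive_conv; apply; rewrite /q' /GRing.scale /=; ring.
have cid' : continuous (fun y : R => t * y + th).
  by move=> x; apply/differentiable_continuous/derivable1_diffP; apply: (ex_derive (is_derive := Dl x)).
have cq' : continuous q'.
  have cp := @continuous_normal_pdf R 0 s sn0.
  have cs : continuous (fun y : R => sin (t * y + th)).
    by move=> x; apply: (continuous_comp (cid' x)); exact: continuous_sin.
  have cc : continuous (fun y : R => cos (t * y + th)).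
    by move=> x; apply: (continuous_comp (cid' x)); exact: continuous_cos.
  move=> x; apply: cvgB; apply: cvgM; try exact: cp.
    by apply: cvgM; [exact: cvg_cst|exact: cc].
  by apply: cvgM; [exact: cs|apply: cvgM; [exact: cvg_id|exact: cvg_cst]].
have mq' : measurable_fun setT q' by exact: continuous_measurable_fun.
have qle x : `|q' x| <= `|t| * p x + (s ^+ 2)^-1 * (`|x| * p x).
  have p0 := normal_pdf_ge0 0 s x.
  have sV : 0 <= (s ^+ 2)^-1 by rewrite invr_ge0 sqr_ge0.
  rewrite /q' (le_trans (ler_normB _ _)) // (normrM _ (p x)) (normrM _ (p x)).
  rewrite (ger0_norm p0); apply: lerD.
    by rewrite ler_wpM2r // normrM ler_piMr // cos_max.
  rewrite [leRHS]mulrA ler_wpM2r // (normrM (sin _)) (normrM x) (ger0_norm sV).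
  by rewrite [leRHS]mulrC ler_piMl ?mulr_ge0 // sin_max.
have idom : mu.-integrable setT (EFin \o (fun x => `|t| * p x + (s ^+ 2)^-1 * (`|x| * p x))).
  have i1 := integrableZl measurableT `|t| (integrable_normal_pdf 0 s).
  have i2 := integrableZl measurableT (s ^+ 2)^-1 integrable_norm_pdf.
  by apply: eq_integrable (integrableD measurableT i1 i2).
have iq' : mu.-integrable setT (EFin \o q').
  apply: le_integrable idom => //; first exact/measurable_EFinP.
  by move=> x _; rewrite /= lee_fin (le_trans (qle x)) // ler_norm.
pose f_ (n : nat) (x : R) := ((q' \_ `[- n%:R, n%:R]) x)%:E.
have [||||_ _ lim1] := @dominated_convergence _ _ _ mu setT measurableT f_
  (EFin \o q') (EFin \o (fun x => `|t| * p x + (s ^+ 2)^-1 * (`|x| * p x))) _ _ _ idom.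
- move=> n; apply/measurable_EFinP.
  by apply/(measurable_restrictT _ _).1 => //; exact: measurable_funTS.
- exact/measurable_EFinP.
- apply: aeW => x _; apply: cvg_near_cst; exists (Num.truncn `|x|).+1 => // n /= nN.
  rewrite /f_ patchE mem_set //= in_itv /= -ler_norml.
  by rewrite (le_trans (ltW (truncnS_gt _))) // ler_nat.
- apply: aeW => x n _; rewrite /f_ patchE; case: ifP => _.
    by rewrite /= lee_fin.
  rewrite /= normr0 lee_fin; apply: le_trans (qle x); exact: normr_ge0.
have E n : (0 < n)%N -> (\int[mu]_x f_ n x = (q n%:R - q (- n%:R))%:E)%E.
  move=> n0.
  have nn : - n%:R < n%:R :> R by rewrite (@lt_trans _ _ 0) ?oppr_lt0 ?ltr0n.
  rewrite EFinB -(@continuous_FTC2 R q' q _ _ nn).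
  - rewrite [RHS]integral_mkcond; apply: eq_integral => x _.
    by rewrite /f_ !patchE; case: ifP.
  - exact: continuous_subspaceT.
  - have cq : continuous q.
      by move=> x; apply/differentiable_continuous/derivable1_diffP; apply: (ex_derive (is_derive := Dq x)).
    split; [by move=> x _; apply: (ex_derive (is_derive := Dq x))| |].
      by apply: cvg_at_right_filter; exact: cq.
    by apply: cvg_at_left_filter; exact: cq.
  - by move=> x _; rewrite derive1E; apply: (derive_val (is_derive := Dq x)).
(* Only a decay of order 1/|x| is extracted from the exponential, through y <= exp y and |x| <=
   x^2. *)
have qn (x : R) : 1 <= `|x| -> `|q x| <= normal_peak s * (2 * s ^+ 2) * `|x|^-1.
  move=> x1; have x0 : 0 < `|x| := lt_le_trans ltr01 x1.
  have s20 : 0 < 2 * s ^+ 2 by rewrite mulr_gt0 // exprn_gt0.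
  have pk : 0 < normal_peak s by exact: normal_peak_gt0.
  rewrite /q normrM (ger0_norm (normal_pdf_ge0 _ _ _)).
  apply: (@le_trans _ _ (p x)); first by rewrite ler_piMl ?normal_pdf_ge0 // sin_max.
  rewrite normal_pdf0E // -mulrA ler_pM2l // mulNr expRN.
  rewrite -[leRHS]invrK lef_pV2 ?posrE ?expR_gt0 ?invr_gt0 ?mulr_gt0 ?invr_gt0 //.
  rewrite invfM invrK.
  apply: (@le_trans _ _ ((2 * s ^+ 2)^-1 * x ^+ 2)).
    rewrite ler_pM2l ?invr_gt0 // -[leRHS](real_normK (num_real x)).
    by rewrite expr2 ler_peMl // ltW.
  by have := expR_ge1Dx ((2 * s ^+ 2)^-1 * x ^+ 2); lra.
have lim2 : q n%:R - q (- n%:R) @[n --> \oo] --> (0 : R).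
  rewrite -(subr0 0).
  have bnd (x_ : nat -> R) : (forall n, `|x_ n| = n%:R) -> q (x_ n) @[n --> \oo] --> (0 : R).
    move=> xn; apply: (@cvg_approx _ _ (fun=> 0)); first exact: cvg_cst.
    move=> e e0; exists (normal_peak s * (2 * s ^+ 2)), 1%N => n n0.
    have nR0 : 0 < n%:R :> R by rewrite ltr0n.
    rewrite subr0 -[leLHS]add0r lerD ?(ltW e0) //.
    apply: le_trans (qn _ _) _; first by rewrite xn ler1n.
    rewrite xn; apply: ler_wpM2l.
      apply: mulr_ge0; first exact: normal_peak_ge0.
      by rewrite mulr_ge0 // sqr_ge0.
    have q0 : 0 < Num.sqrt (n%:R : R) by rewrite sqrtr_gt0.
    have q1 : 1 <= Num.sqrt (n%:R : R) by rewrite -[leLHS]sqrtr1 ler_wsqrtr // ler1n.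
    by rewrite lef_pV2 ?posrE // -[leRHS]sqr_sqrtr ?ler0n // expr2 ler_peMl // ltW.
  by apply: cvgB; apply: bnd => n; rewrite ?normrN normr_nat.
have lim3 : (\int[mu]_x f_ n x)%E @[n --> \oo] --> (0%:E : \bar R).
  have : (q n%:R - q (- n%:R))%:E @[n --> \oo] --> (0%:E : \bar R).
    by apply: cvg_EFin => //; exact: nearW.
  apply: cvg_trans; apply: near_eq_cvg; exists 1%N => // n /= n0.
  by rewrite E.
have e0 : (\int[mu]_x (EFin \o q') x = 0%:E)%E := cvg_unique _ lim1 lim3.
by rewrite /Rintegral; move: e0 => /= ->.
Qed.

Definition normal_cf (th t : R) := \int[mu]_x (cos (t * x + th) * p x).

(** Differentiation under the integral brings down -x sin (t x + th), and integration by parts turns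
    the factor x back into s^2 t times a cosine. The result is a linear differential equation. *)
Lemma is_derive_normal_cf (th t : R) :
  is_derive t 1 (normal_cf th) (- (s ^+ 2 * t) * normal_cf th t).
Proof.
pose f (u x : R) := cos (u * x + th) * p x.
have Df (u x : R) : is_derive u 1 (f ^~ x) (- (x * sin (u * x + th)) * p x).
  have Dl : is_derive u 1 (fun y : R => y * x + th) x.
    apply: (@is_derive_eq _ _ _ (id * cst x + cst th)).
    by rewrite /= scaler0 add0r addr0 /GRing.scale /= mulr1.
  have hc : is_derive u 1 (fun y : R => cos (y * x + th)) (- sin (u * x + th) * x).
    exact: is_derive1_comp.
  have : is_derive u 1 ((fun y : R => cos (y * x + th)) * cst (p x))
     (cos (u * x + th) *: 0 + p x *: (- sin (u * x + th) * x)).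
    exact: is_deriveM.
  by move=> /is_derive_conv; apply; rewrite scaler0 add0r /GRing.scale /=; ring.
have d1E (u x : R) : partial1of2 f u x = - (x * sin (u * x + th)) * p x.
  by rewrite partial1of2E; apply: (derive_val (is_derive := Df u x)).
have mc (u : R) : measurable_fun setT (fun x : R => cos (u * x + th)).
  have := trig_measurable (trig_cos 1 u th).
  by apply: eq_measurable_fun => y _; rewrite mul1r.
have ms (u : R) : measurable_fun setT (fun x : R => sin (u * x + th)).
  have := trig_measurable (trig_cos 1 u (th - pi / 2)).
  by apply: eq_measurable_fun => y _; rewrite mul1r addrA cosBpihalf.
have If u : mu.-integrable setT (EFin \o f u).
  by apply: (integrable_bounded_pdf (B := 1)) => // x; exact: cos_max.
have It : [set` `]t - 1, t + 1[] t by rewrite /= in_itv /=; apply/andP; split; lra.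
have G0 y : 0 <= `|y| * p y by rewrite mulr_ge0 ?normal_pdf_ge0.
have d1f (u y : R) : [set` `]t - 1, t + 1[] u -> [set: R] y -> derivable (f ^~ y) u 1.
  by move=> _ _; apply: (ex_derive (is_derive := Df u y)).
have Gu (u y : R) : [set` `]t - 1, t + 1[] u -> [set: R] y ->
    `|partial1of2 f u y| <= `|y| * p y.
  move=> _ _; rewrite d1E !normrM normrN normrM.
  rewrite (ger0_norm (normal_pdf_ge0 _ _ _)) ler_wpM2r ?normal_pdf_ge0 //.
  by rewrite ler_piMr // sin_max.
have dF := @derivable_under_integral R _ _ mu f setT measurableT t (t - 1) (t + 1)
   It (fun u _ => If u) d1f (fun y => `|y| * p y) G0 integrable_norm_pdf Gu.
have vF := @differentiation_under_integral R _ _ mu f setT measurableT t (t - 1) (t + 1)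
   It (fun u _ => If u) d1f (fun y => `|y| * p y) G0 integrable_norm_pdf Gu.
apply: DeriveDef; first exact: dF.
rewrite -derive1E; apply: etrans vF _.
have icos : mu.-integrable setT (EFin \o (fun x => t * cos (t * x + th) * p x)).
  have := integrableZl measurableT t (If t).
  by apply: eq_integrable => // x _; rewrite /= -EFinM mulrA.
have isin : mu.-integrable setT (EFin \o (fun x => x * sin (t * x + th) * p x)).
  apply: le_integrable integrable_norm_pdf => //.
    apply/measurable_EFinP; apply: measurable_funM; last exact: pM.
    by apply: measurable_funM; [exact: measurable_id|exact: ms].
  move=> x _; rewrite /= lee_fin [leRHS]ger0_norm // !normrM.
  rewrite (ger0_norm (normal_pdf_ge0 _ _ _)) ler_wpM2r ?normal_pdf_ge0 //.
  by rewrite ler_piMr // sin_max.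
have bp := normal_by_parts t th.
have E1 : \int[mu]_x (t * cos (t * x + th) * p x - sin (t * x + th) * (x / s ^+ 2) * p x) =
  t * normal_cf th t - (s ^+ 2)^-1 * \int[mu]_x (x * sin (t * x + th) * p x).
  have z1 : \int[mu]_x (t * (cos (t * x + th) * p x)) = t * normal_cf th t.
    by apply: RintegralZl => //; exact: (If t).
  have z2 : \int[mu]_x ((s ^+ 2)^-1 * (x * sin (t * x + th) * p x)) =
      (s ^+ 2)^-1 * \int[mu]_x (x * sin (t * x + th) * p x).
    by apply: RintegralZl.
  rewrite -z1 -z2 -RintegralB //.
  - by apply: eq_Rintegral => x _; ring.
  - by apply: eq_integrable icos => // x _; rewrite /= mulrA.
  - by apply: eq_integrable (integrableZl measurableT (s ^+ 2)^-1 isin) => // x _.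
rewrite E1 in bp.
have -> : \int[mu]_y partial1of2 f t y = - \int[mu]_x (x * sin (t * x + th) * p x).
  have z : \int[mu]_x (-1 * (x * sin (t * x + th) * p x)) =
      -1 * \int[mu]_x (x * sin (t * x + th) * p x) by apply: RintegralZl.
  rewrite -[RHS]mulN1r -z; apply: eq_Rintegral => x _.
  by rewrite d1E; ring.
have := sn0; move/eqP: bp; rewrite subr_eq0 => /eqP bp s1.
have -> : \int[mu]_x (x * sin (t * x + th) * p x) =
   s ^+ 2 * ((s ^+ 2)^-1 * \int[mu]_x (x * sin (t * x + th) * p x)).
  by rewrite mulrA mulfV ?mul1r // expf_neq0.
by rewrite -bp; ring.
Qed.

(** The product with exp (s^2 t^2/2) has zero derivative, and its value at 0 is cos th. *)
Lemma normal_cfE (th t : R) : normal_cf th t = expR (- (t ^+ 2 / 2 * s ^+ 2)) * cos th.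
Proof.
pose h (t : R) := normal_cf th t * expR (t ^+ 2 / 2 * s ^+ 2).
have Dh (u : R) : is_derive u 1 h 0.
  have D1 : is_derive u 1 (fun t : R => t ^+ 2 / 2 * s ^+ 2) (u * s ^+ 2).
    have : is_derive u 1 (cst (s ^+ 2 / 2) * (fun t : R => t ^+ 2)) (u * s ^+ 2).
      by apply: is_derive_eq; rewrite /= scaler0 addr0 /GRing.scale /=; field.
    move=> h1; refine (eq_ind _ (fun g => is_derive u 1 g (u * s ^+ 2)) h1 _ _).
    by apply/funext => y; rewrite !fctE; ring.
  have D2 : is_derive u 1 (fun t : R => expR (t ^+ 2 / 2 * s ^+ 2))
    (expR (u ^+ 2 / 2 * s ^+ 2) * (u * s ^+ 2)) by exact: is_derive1_comp.
  have D3 := is_derive_normal_cf th u.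
  have : is_derive u 1 (normal_cf th * (fun t : R => expR (t ^+ 2 / 2 * s ^+ 2)))
    (normal_cf th u *: (expR (u ^+ 2 / 2 * s ^+ 2) * (u * s ^+ 2)) +
     expR (u ^+ 2 / 2 * s ^+ 2) *: (- (s ^+ 2 * u) * normal_cf th u)).
    exact: is_deriveM.
  by move=> /is_derive_conv; apply; rewrite /GRing.scale /=; ring.
have e : h t = h 0 := is_derive_0_is_cst t 0 Dh.
have h0 : h 0 = cos th.
  rewrite /h expr0n /= !mul0r expR0 mulr1 /normal_cf.
  under eq_Rintegral do rewrite mul0r add0r.
  rewrite RintegralZl //; last exact: integrable_normal_pdf.
  by rewrite /Rintegral integral_normal_pdf mulr1.
rewrite h0 in e; rewrite -e /h expRN mulrCA mulVf ?mulr1 // gt_eqF //.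
exact: expR_gt0.
Qed.

Lemma normal_cos (th t : R) :
  \int[normal_prob 0 s]_x cos (t * x + th) = expR (- (t ^+ 2 / 2 * s ^+ 2)) * cos th.
Proof.
rewrite -normal_cfE /normal_cf /Rintegral; congr fine.
apply: integral_normal_prob.
have mc : measurable_fun setT (fun x : R => cos (t * x + th)).
  have := trig_measurable (trig_cos 1 t th).
  by apply: eq_measurable_fun => y _; rewrite mul1r.
by apply: (@itg_bounded _ _ R (normal_prob 0 s) _ 1 mc) => x; exact: cos_max.
Qed.

End normal_characteristic_function.

(** * Scaling of normal laws *)

Section normal_scaling.
Context (R : realType).
Notation mu := (@lebesgue_measure R).

Let scale_mfun (c : R) : measurable_fun setT (fun x : R => c * x).
Proof. exact: measurable_funM. Qed.

(** Lebesgue measure is determined by the lengths of intervals, and |c| times its image under x -> c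
    x assigns the same lengths. *)
Lemma ge0_integral_lebesgue_scale (c : R) (f : R -> \bar R) : c != 0 ->
  measurable_fun setT f -> (forall x, 0 <= f x)%E ->
  (\int[mu]_x f x = `|c|%:E * \int[mu]_x f (c * x)%R)%E.
Proof.
move=> c0 mf f0; have nc0 : 0 <= `|c| by [].
unshelve epose (m0 := (pushforward mu (fun x : R => c * x : measurableTypeR R) :
  {measure set (measurableTypeR R) -> \bar R})); first exact: scale_mfun.
pose m := mscale (NngNum nc0) m0.
have E A : measurable A -> mu A = m A.
  apply: lebesgue_measure_unique => _ [[a b]] _ <- /=.
  rewrite /m /m0 /mscale /pushforward /=. rewrite /pushforward.
  have [cp|cn] := ltP 0 c.
    rewrite (_ : _ @^-1` _ = `]a / c, b / c]%classic); last first.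
      by apply/seteqP; split => x; rewrite /= !in_itv /= ltr_pdivrMr // ler_pdivlMr // (mulrC x).
    rewrite !lebesgue_measure_itv /= !lte_fin ltr_pM2r ?invr_gt0 //.
    case: ifP => _; last by rewrite mule0.
    rewrite -!EFinB -EFinM gtr0_norm //; congr EFin; field.
    by rewrite gt_eqF.
  have {}cn : c < 0 by rewrite lt_neqAle c0.
  rewrite (_ : _ @^-1` _ = `[b / c, a / c[%classic); last first.
    apply/seteqP; split => x; rewrite /= !in_itv /= => /andP[h1 h2]; apply/andP; split.
    - by rewrite ler_ndivrMr // mulrC.
    - by rewrite ltr_ndivlMr // mulrC.
    - by move: h2; rewrite ltr_ndivlMr // mulrC.
    - by move: h1; rewrite ler_ndivrMr // mulrC.
  rewrite !lebesgue_measure_itv /= !lte_fin ltr_nM2r ?invr_lt0 //.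
  case: ifP => _; last by rewrite mule0.
  rewrite -!EFinB -EFinM ltr0_norm //; congr EFin; field.
  by rewrite lt_eqF.
transitivity (\int[m]_x f x)%E.
  by apply: eq_measure_integral => A mA _; exact: E.
transitivity (`|c|%:E * \int[m0]_x f x)%E.
  by apply: (@ge0_integral_mscale _ _ _ m0 setT measurableT (NngNum nc0) f mf) => x _.
congr (_ * _)%E.
by rewrite /m0 (@ge0_integral_pushforward _ _ (measurableTypeR R) (measurableTypeR R) R
  (fun x => c * x) (scale_mfun c) lebesgue_measure setT f measurableT mf) // => x _.
Qed.

Lemma normal_prob_scale (s c : R) (A : set R) : 0 < s -> c != 0 -> measurable A ->
  normal_prob 0 s ((fun x => c * x) @^-1` A) = normal_prob 0 (`|c| * s) A.
Proof.
move=> s0 c0 mA; have nc0 : 0 < `|c| by rewrite normr_gt0.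
have s'0 : 0 < `|c| * s by rewrite mulr_gt0.
rewrite /normal_prob [RHS]integral_mkcond [LHS]integral_mkcond.
rewrite [RHS](ge0_integral_lebesgue_scale c0); last 2 first.
- apply/(measurable_restrictT _ _).1 => //; apply: measurable_funTS.
  by apply/measurable_EFinP; exact: measurable_normal_pdf.
- by move=> x; apply: erestrict_ge0 => y _; rewrite lee_fin normal_pdf_ge0.
rewrite -ge0_integralZl_EFin //.
- apply: eq_integral => x _; rewrite !patchE.
  have -> : (c * x \in A) = (x \in (fun x => c * x) @^-1` A).
    by apply/idP/idP => /set_mem h; exact/mem_set.
  case: ifP => _; last by rewrite mule0.
  rewrite -EFinM; congr EFin; rewrite !normal_pdf0E //.
  have n2 : (`|c| * s) ^+ 2 = c ^+ 2 * s ^+ 2 by rewrite exprMn real_normK ?num_real.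
  have -> : - (2 * (`|c| * s) ^+ 2)^-1 * (c * x) ^+ 2 = - (2 * s ^+ 2)^-1 * x ^+ 2.
    by rewrite n2; field; rewrite c0 gt_eqF.
  have -> : normal_peak s = `|c| * normal_peak (`|c| * s).
    rewrite /normal_peak.
    have -> : (`|c| * s) ^+ 2 * pi *+ 2 = c ^+ 2 * (s ^+ 2 * pi *+ 2).
      by rewrite n2 -mulrA mulrnAr.
    by rewrite [in RHS]sqrtrM ?sqr_ge0 // sqrtr_sqr invfM mulrA mulfV ?mul1r // gt_eqF.
  by rewrite -mulrA.
- by move=> x _; apply: erestrict_ge0 => y _; rewrite lee_fin normal_pdf_ge0.
have h : measurable_fun setT (fun x : R => ((fun y : R => (normal_pdf 0 (`|c| * s) y)%:E) \_ A) x).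
  apply/(measurable_restrictT _ _).1 => //; apply: measurable_funTS.
  by apply/measurable_EFinP; exact: measurable_normal_pdf.
exact: (measurableT_comp h (scale_mfun c)).
Qed.

(** The value c = 0 is included because some linear combinations of the two coordinates of the limit
    are degenerate; they give the unit mass at 0. *)
Lemma is_normal0_scale (s c : R) : 0 < s ->
  is_normal0 (pushforward (normal_prob 0 s) (fun x => c * x)) (c ^+ 2 * s ^+ 2).
Proof.
move=> s0 A mA; have [->|c0] := eqVneq c 0.
  rewrite expr0n /= mul0r ltxx /pushforward.
  have [A0|A0] := pselect (A 0).
    have -> : (fun x : R => 0 * x) @^-1` A = setT.
      by apply/seteqP; split => x //= _; rewrite mul0r.
    by rewrite indicE mem_set // probability_setT.
  have -> : (fun x : R => 0 * x) @^-1` A = set0.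
    by apply/seteqP; split => x //=; rewrite mul0r.
  by rewrite indicE memNset // measure0.
have c2s2 : 0 < c ^+ 2 * s ^+ 2.
  by rewrite mulr_gt0 ?(exprn_gt0 2 s0) // lt_neqAle sqr_ge0 eq_sym sqrf_eq0 c0.
have q : Num.sqrt (c ^+ 2 * s ^+ 2) = `|c| * s.
  by rewrite sqrtrM ?sqr_ge0 // !sqrtr_sqr (gtr0_norm s0).
by rewrite c2s2 q; exact: normal_prob_scale.
Qed.

End normal_scaling.

(** * The INAR(1) chain *)

Section inar_chain.
Context d (T : measurableType d) (R : realType) (P : probability T R).
Context (alpha : R) (X0 : T -> nat) (eps : nat -> T -> nat).
Context (xi : nat -> nat -> T -> nat).
Notation Z := (inar_family X0 eps xi).
Notation X := (inar_X X0 eps xi).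
Hypothesis mZ : forall i, nat_rv (Z i).
Hypothesis iZ : mutually_independent P Z.
Hypothesis eps_id :
  forall k m, P (eps k @^-1` [set m]) = P (eps 0%N @^-1` [set m]).
Hypothesis xi_le1 : forall k j w, (xi k j w <= 1)%N.
Hypothesis xi_P : forall k j, P (xi k j @^-1` [set 1%N]) = alpha%:E.

(** One transition from a deterministic state [x]. The instance k = 0 plays the role of [W] in the
    abstract ergodic theory. *)
Definition step (k x : nat) (w : T) : nat := (\sum_(j < x) xi k j w + eps k w)%N.

Definition step_indices (k x : nat) : seq inar_index :=
  IE k :: [seq IXi k j | j <- iota 0 x].

(** The number of survival variables used by the chain is random. On the event that the path equals
    [p] it is dictated by [p], so that event is determined by a fixed finite list of variables. *)
Definition path_indices (k : nat) (p : seq nat) : seq inar_index :=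
  I0 :: [seq IE i | i <- iota 0 k] ++
  [seq IXi i j | i <- iota 0 k, j <- iota 0 (nth 0%N p i)].

Lemma vals_mem l w w' i : vals Z l w = vals Z l w' -> i \in l -> Z i w = Z i w'.
Proof.
by elim: l => [|a l IH] //= [ea el]; rewrite in_cons => /predU1P[->|/(IH el)].
Qed.

Lemma step_eq_on k x w w' : vals Z (step_indices k x) w = vals Z (step_indices k x) w' ->
  step k x w = step k x w'.
Proof.
move=> e; have h := vals_mem e; rewrite /step.
congr (_ + _)%N; last by apply: (h (IE k)); rewrite mem_head.
apply: eq_bigr => j _; apply: (h (IXi k j)).
by rewrite in_cons; apply/orP; right; apply: map_f; rewrite mem_iota /= add0n.
Qed.

Lemma step_determined k x A : determined Z (step_indices k x) (step k x @^-1` A).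
Proof. by move=> w w' /step_eq_on /=; rewrite /preimage /= => ->. Qed.

Lemma path_determined k p :
  determined Z (path_indices k p) (path_of X k @^-1` [set p]).
Proof.
move=> w w' e /= pw; have h := vals_mem e.
have Xp i : (i <= k)%N -> X i w = nth 0%N p i.
  by move=> ik; rewrite -pw /path_of (nth_map 0%N) ?size_iota // nth_iota.
have XX i : (i <= k)%N -> X i w' = X i w.
  elim: i => [_|i IH ik]; first by apply/esym/(h I0); rewrite mem_head.
  rewrite /= IH ?(ltnW ik) //; congr (_ + _)%N; last first.
    by apply/esym/(h (IE i)); rewrite in_cons mem_cat (map_f IE) ?orbT // mem_iota.
  apply: eq_bigr => j _; apply/esym/(h (IXi i j)).
  rewrite in_cons mem_cat; apply/orP; right; apply/orP; right.
  apply/allpairsPdep; exists i, (j : nat); rewrite !mem_iota /=; split => //.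
  by rewrite add0n -Xp // ltnW.
rewrite -pw /path_of; apply/eq_in_map => i; rewrite mem_iota => /andP[_ ik].
exact: XX.
Qed.

(** The path uses innovation and survival variables with first index below k, the next transition
    those with index k, so the lists are disjoint. *)
Lemma path_step_indices_uniq k p x :
  uniq (path_indices k p ++ step_indices k x).
Proof.
have uE : uniq [seq IE i | i <- iota 0 k].
  by rewrite map_inj_uniq ?iota_uniq // => i j [].
have uX : uniq [seq IXi i j | i <- iota 0 k, j <- iota 0 (nth 0%N p i)].
  apply: allpairs_uniq_dep; rewrite ?iota_uniq //.
    by move=> i _; exact: iota_uniq.
  by move=> [i j] [i' j'] _ _ /= [-> ->].
have uS : uniq [seq IXi k j | j <- iota 0 x].
  by rewrite map_inj_uniq ?iota_uniq // => i j [].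
rewrite cat_uniq; apply/and3P; split.
- rewrite /path_indices cons_uniq mem_cat cat_uniq uE uX /= andbT.
  apply/andP; split.
    apply/norP; split; apply/negP; first by case/mapP.
    by case/allpairsPdep => ? [? []].
  by apply/hasPn => z /allpairsPdep[i [j [_ _ ->]]]; apply/negP => /mapP[].
- apply/hasPn => z; rewrite /step_indices /path_indices !in_cons mem_cat.
  move=> /predU1P[->|/mapP[j _ ->]]; apply/norP; split;
    (try by apply/eqP); rewrite /=; apply/norP; split; apply/negP.
  + by case/mapP => i; rewrite mem_iota add0n => /andP[_ ik] [ki]; move: ik; rewrite ki ltnn.
  + by case/allpairsPdep => ? [? []].
  + by case/mapP.
  + case/allpairsPdep => i [j' []]; rewrite !mem_iota add0n => /andP[_ ik] _ [ki _].
    by move: ik; rewrite ki ltnn.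
- rewrite /step_indices cons_uniq uS andbT; by apply/negP => /mapP[].
Qed.

Lemma nat_rv_step k x : nat_rv (step k x).
Proof. by move=> m; apply: (determined_measurable mZ); exact: step_determined. Qed.

Lemma nat_rv_path k : nat_rv (fun w => pickle (path_of X k w)).
Proof.
move=> m; case E : (@pickle_inv (seq nat) m) => [p|].
  rewrite (_ : _ @^-1` _ = path_of X k @^-1` [set p]).
    apply: (determined_measurable mZ); exact: path_determined.
  apply/seteqP; split => w /=.
    by move=> h; move: E; rewrite -h pickleK_inv => -[].
  by move=> ->; have := @pickle_invK (seq nat) m; rewrite E.
rewrite (_ : _ @^-1` _ = set0) //; apply/seteqP; split => w //= h.
by move: E; rewrite -h pickleK_inv.
Qed.

Lemma prob_xi k j m : P (xi k j @^-1` [set m]) = P (xi 0%N 0%N @^-1` [set m]).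
Proof.
case: m => [|[|m]]; last 1 first.
- have z k' j' : xi k' j' @^-1` [set m.+2] = set0.
    by apply/seteqP; split => // w /= h; have := xi_le1 k' j' w; rewrite h.
  by rewrite !z.
- have z k' j' : xi k' j' @^-1` [set 0%N] = ~` (xi k' j' @^-1` [set 1%N]).
    apply/seteqP; split => w /=; first by move=> ->.
    by have := xi_le1 k' j' w; case: (xi k' j' w) => [|[|?]].
  have m1 k' j' : measurable (xi k' j' @^-1` [set 1%N]) := mZ (IXi k' j') 1%N.
  by rewrite !z !probability_setC // !xi_P.
- by rewrite !xi_P.
Qed.

(** Both sides are the same function of a list of independent variables, and by [prob_vals] the two
    lists have the same law. *)
Lemma integral_step k x (g : nat -> \bar R) : (forall v, 0 <= g v)%E ->
  (\int[P]_w g (step k x w) = \int[P]_w g (step 0 x w))%E.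
Proof.
move=> g0; pose h (u : nat) := g (sumn (odflt [::] (@pickle_inv (seq nat) u))).
have E k' w : g (step k' x w) = h (pickle (vals Z (step_indices k' x) w)).
  rewrite /h pickleK_inv /= /step addnC; congr (g (_ + _)%N).
  rewrite sumnE !big_map /=.
  by rewrite -(big_mkord xpredT (fun j => xi k' j w)) /index_iota subn0.
under eq_integral do rewrite E.
under [RHS]eq_integral do rewrite E.
apply: integral_eq_law; [exact: nat_rv_vals|exact: nat_rv_vals| |by move=> v; exact: g0].
move=> u; case Eu : (@pickle_inv (seq nat) u) => [v|]; last first.
  have z l : (fun w => pickle (vals Z l w)) @^-1` [set u] = set0.
    by apply/seteqP; split => // w /= e; move: Eu; rewrite -e pickleK_inv.
  by rewrite !z.
have z l : (fun w => pickle (vals Z l w)) @^-1` [set u] = vals Z l @^-1` [set v].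
  apply/seteqP; split => w /=.
    by move=> e; move: Eu; rewrite -e pickleK_inv => -[].
  by move=> ->; have := @pickle_invK (seq nat) u; rewrite Eu.
rewrite !z.
have [s|s] := eqVneq (size v) x.+1; last first.
  have z' k' : vals Z (step_indices k' x) @^-1` [set v] = set0.
    apply/seteqP; split => // w /= e; move: s; rewrite -e.
    by rewrite /= !size_map size_iota eqxx.
  by rewrite !z'.
have uS k' : uniq (step_indices k' x).
  by have := path_step_indices_uniq k' [::] x; rewrite cat_uniq => /and3P[].
rewrite -[LHS]fineK ?fin_num_measure //; last exact: measurable_vals.
rewrite -[RHS]fineK ?fin_num_measure //; last exact: measurable_vals.
congr EFin; rewrite !(prob_vals iZ) //; try by rewrite s /= size_map size_iota.
case: v s {Eu z} => // a v [sv]; rewrite !big_cons /=.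
congr (fine _ * _); first exact: eps_id.
elim: (iota 0 x) v {sv} => [|j l IH] [|b v]; rewrite ?big_nil //=.
by rewrite !big_cons /= IH; congr (fine _ * _); rewrite prob_xi [RHS]prob_xi.
Qed.

Lemma last_path k w : last 0%N (path_of X k w) = X k w.
Proof. by rewrite /path_of -[k.+1]addn1 iotaD map_cat last_cat /= add0n. Qed.

(** The next state is a variable selected by the past, namely the transition from the last state.
    For each fixed past this transition is independent of the event that the past occurs, as
    [integral_indep_selected] requires; [integral_step] then moves it to time 0. *)
Lemma markov_property k (G : seq nat -> nat -> \bar R) :
  (forall p v, 0 <= G p v)%E ->
  (\int[P]_w G (path_of X k w) (X k.+1 w) =
   \int[P]_w \int[P]_w' G (path_of X k w) (step 0 (X k w) w'))%E.
Proof.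
move=> G0; pose dec u := odflt [::] (@pickle_inv (seq nat) u).
have decK w : dec (pickle (path_of X k w)) = path_of X k w.
  by rewrite /dec pickleK_inv.
have lastX w := last_path k w.
transitivity (\int[P]_w (\int[P]_w' G (path_of X k w) (step k (X k w) w'))%E)%E.
  pose V u := step k (last 0%N (dec u)).
  transitivity (\int[P]_w G (dec (pickle (path_of X k w)))
      (V (pickle (path_of X k w)) w))%E.
    by apply: eq_integral => w _; rewrite /V decK lastX.
  rewrite (@integral_indep_selected _ T R P (fun w => pickle (path_of X k w))
    V (fun u v => G (dec u) v)).
  - apply: eq_integral => w _; apply: eq_integral => w' _.
    by rewrite /V decK lastX.
  - exact: nat_rv_path.
  - by move=> u; exact: nat_rv_step.
  move=> u v; case Eu : (@pickle_inv (seq nat) u) => [p|]; last first.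
    rewrite (_ : _ @^-1` [set u] = set0) ?set0I ?measure0 ?mul0e //.
    by apply/seteqP; split => // w /= e; move: Eu; rewrite -e pickleK_inv.
  rewrite (_ : _ @^-1` [set u] = path_of X k @^-1` [set p]); last first.
    apply/seteqP; split => w /=.
      by move=> e; move: Eu; rewrite -e pickleK_inv => -[].
    by move=> ->; have := @pickle_invK (seq nat) u; rewrite Eu.
  apply: (determined_indep mZ iZ (path_step_indices_uniq k p (last 0%N (dec u)))).
      exact: path_determined.
    exact: step_determined.
  by move=> u v; exact: G0.
by apply: eq_integral => w _; exact: integral_step.
Qed.

Lemma path_measurable k d' (T' : measurableType d') (f : seq nat -> T') :
  measurable_fun setT (fun w => f (path_of X k w)).
Proof.
have := nat_rv_measurable (fun u => f (odflt [::] (@pickle_inv (seq nat) u)))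
  (@nat_rv_path k).
by apply: eq_measurable_fun => w _ /=; rewrite pickleK_inv.
Qed.

(** Starting from x + 1 adds the single variable [xi 0 x], independent of the transition from x. *)
Lemma integral_stepS x (g : nat -> \bar R) : (forall v, 0 <= g v)%E ->
  (\int[P]_w g (step 0 x.+1 w) =
   \int[P]_w (alpha%:E * g (step 0 x w).+1 + (1 - alpha)%:E * g (step 0 x w)))%E.
Proof.
move=> g0.
have E w : step 0 x.+1 w = (step 0 x w + xi 0%N x w)%N.
  by rewrite /step big_ord_recr /= addnAC.
under eq_integral do rewrite E.
rewrite (@integral_indep_selected _ T R P (step 0 x) (fun=> xi 0%N x)
  (fun u v => g (u + v)%N)); last 4 first.
- exact: nat_rv_step.
- by move=> _; exact: (mZ (IXi 0 x)).
- move=> u v; apply: (determined_indep mZ iZ (l1 := step_indices 0 x) (l2 := [:: IXi 0 x])).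
  + have uS : uniq (step_indices 0 x.+1).
      by have := path_step_indices_uniq 0 [::] x.+1; rewrite cat_uniq => /and3P[].
    by move: uS; rewrite /step_indices -addn1 iotaD map_cat.
  + exact: step_determined.
  + by move=> w w' [e] /= ; rewrite /preimage /= e.
- by move=> u v; exact: g0.
apply: eq_integral => w _.
have x0 w' : ~ (xi 0%N x @^-1` [set 1%N]) w' -> xi 0%N x w' = 0%N.
  by move=> /=; have := xi_le1 0 x w'; case: (xi 0%N x w') => [|[|?]].
have m1 : measurable (xi 0%N x @^-1` [set 1%N]) := mZ (IXi 0 x) 1%N.
transitivity (\int[P]_w' ((\1_(xi 0%N x @^-1` [set 1%N]) w')%:E * g (step 0 x w).+1
   + (\1_(~` (xi 0%N x @^-1` [set 1%N])) w')%:E * g (step 0 x w)))%E.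
  apply: eq_integral => w' _; rewrite !indicE in_setC.
  have [/set_mem /= ->|/negP h] := boolP (w' \in _).
    by rewrite /= mul1e mul0e adde0 addn1.
  by rewrite x0 /= ?mul1e ?mul0e ?add0e ?addn0 // => /mem_set.
have mi A : measurable A -> measurable_fun [set: T] (fun w' => (\1_A w' : R)%:E).
  by move=> mA; apply/measurable_EFinP.
have i0 A w' : (0 <= (\1_A w' : R)%:E)%E by rewrite lee_fin indicE.
rewrite ge0_integralD //.
- rewrite !ge0_integralZr //; try exact: mi.
  + rewrite !integral_indic ?setIT //; try exact: measurableC.
    congr (_ * _ + _ * _)%E; first exact: xi_P.
    transitivity (P (~` (xi 0%N x @^-1` [set 1%N]))) => //.
    by rewrite probability_setC // xi_P.
  + by apply: mi; exact: measurableC.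
- by move=> w' _; rewrite mule_ge0.
- by apply: emeasurable_funM => //; exact: mi.
- by move=> w' _; rewrite mule_ge0.
- by apply: emeasurable_funM => //; apply: mi; exact: measurableC.
Qed.

End inar_chain.

(** * Conditional least squares *)

Section taylor2.
Context (R : realType).
Implicit Types (f g df dg : R -> R) (a b : R).

(* The radius 3 is chosen to contain the minimizers, which will be within
   distance 1 of a point of [-2, 2]. *)
Definition taylor2 f df : Prop := exists M : R, forall a b,
  `|a| <= 3 -> `|b| <= 3 ->
  [/\ `|f a| <= M, `|df a| <= M & `|f a - f b - df b * (a - b)| <= M * (a - b) ^+ 2].

Let norm0_le3 : `|0 : R| <= 3. Proof. by rewrite normr0. Qed.

Lemma taylor2_cst (c : R) : taylor2 (fun=> c) (fun=> 0).
Proof.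
exists `|c| => a b _ _; split => //; first by rewrite normr0.
by rewrite subrr mul0r subr0 normr0 mulr_ge0 ?sqr_ge0.
Qed.

Lemma taylor2_id : taylor2 (fun a => a) (fun=> 1).
Proof.
exists 3 => a b a3 b3; split => //; first by rewrite normr1 ler1n.
by rewrite mul1r subrr normr0 mulr_ge0 ?sqr_ge0.
Qed.

Lemma taylor2D f df g dg : taylor2 f df -> taylor2 g dg ->
  taylor2 (fun a => f a + g a) (fun a => df a + dg a).
Proof.
move=> [M hM] [N hN]; exists (M + N) => a b a3 b3.
have [f1 f2 f3] := hM _ _ a3 b3; have [g1 g2 g3] := hN _ _ a3 b3; split.
- by rewrite (le_trans (ler_normD _ _)) // lerD.
- by rewrite (le_trans (ler_normD _ _)) // lerD.
- have -> : f a + g a - (f b + g b) - (df b + dg b) * (a - b) =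
    (f a - f b - df b * (a - b)) + (g a - g b - dg b * (a - b)) by ring.
  by rewrite (le_trans (ler_normD _ _)) // mulrDl lerD.
Qed.

Lemma norm_dist_le6 a b : `|a| <= 3 -> `|b| <= 3 -> `|a - b| <= 6.
Proof.
move=> a3 b3; rewrite (le_trans (ler_normB _ _)) // (le_trans (lerD a3 b3)) //.
by rewrite -natrD.
Qed.

(** 7 = 6 + 1: since |a - b| <= 6 the quadratic remainder is at most 6 M |a - b|, and the linear
    term adds M |a - b|. *)
Lemma taylor2_lip f df M a b : 0 <= M -> `|a| <= 3 -> `|b| <= 3 ->
  `|df b| <= M -> `|f a - f b - df b * (a - b)| <= M * (a - b) ^+ 2 ->
  `|f a - f b| <= 7 * M * `|a - b|.
Proof.
move=> M0 a3 b3 h1 h2.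
have -> : f a - f b = (f a - f b - df b * (a - b)) + df b * (a - b) by ring.
rewrite (le_trans (ler_normD _ _)) // normrM.
have -> : 7 * M * `|a - b| = M * (6 * `|a - b|) + M * `|a - b| by ring.
apply: lerD; last by rewrite ler_wpM2r.
rewrite (le_trans h2) // ler_wpM2l // -real_normK ?num_real // expr2 ler_wpM2r //.
exact: norm_dist_le6.
Qed.

Lemma taylor2M f df g dg : taylor2 f df -> taylor2 g dg ->
  taylor2 (fun a => f a * g a) (fun a => df a * g a + f a * dg a).
Proof.
move=> [M hM] [N hN].
have M0 : 0 <= M.
  by have [h _ _] := hM 0 0 norm0_le3 norm0_le3; exact: le_trans h.
have N0 : 0 <= N.
  by have [h _ _] := hN 0 0 norm0_le3 norm0_le3; exact: le_trans h.
have MN0 : 0 <= M * N by exact: mulr_ge0.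
(* 51 = 7 * 7 + 1 + 1: the product of the two increments, and one Taylor remainder for each
   factor. *)
exists (51 * (M * N)) => a b a3 b3.
have [f1 f2 f3] := hM _ _ a3 b3; have [g1 g2 g3] := hN _ _ a3 b3.
have [f1b f2b _] := hM _ _ b3 a3; have [g1b g2b _] := hN _ _ b3 a3.
split.
- rewrite normrM (le_trans (ler_pM _ _ f1 g1)) //; lra.
- rewrite (le_trans (ler_normD _ _)) // !normrM.
  have := ler_pM (normr_ge0 _) (normr_ge0 _) f1 g2.
  have := ler_pM (normr_ge0 _) (normr_ge0 _) f2 g1.
  lra.
- have -> : f a * g a - f b * g b - (df b * g b + f b * dg b) * (a - b) =
    (f a - f b) * (g a - g b) + (f a - f b - df b * (a - b)) * g b
    + f b * (g a - g b - dg b * (a - b)) by ring.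
  have lf := taylor2_lip M0 a3 b3 f2b f3; have lg := taylor2_lip N0 a3 b3 g2b g3.
  rewrite (le_trans (ler_normD _ _)) //.
  have E : 51 * (M * N) * (a - b) ^+ 2 = (7 * M * `|a - b|) * (7 * N * `|a - b|)
      + (M * (a - b) ^+ 2) * N + M * (N * (a - b) ^+ 2).
    rewrite -(real_normK (num_real (a - b))); ring.
  rewrite E; apply: lerD; last by rewrite normrM ler_pM.
  rewrite (le_trans (ler_normD _ _)) //; apply: lerD; first by rewrite normrM ler_pM.
  by rewrite normrM ler_pM.
Qed.

Lemma taylor2V f df : taylor2 f df -> (forall a, 1 <= f a) ->
  taylor2 (fun a => (f a)^-1) (fun a => - df a / f a ^+ 2).
Proof.
move=> [M hM] f_ge1.
have f0 a : 0 < f a by apply: lt_le_trans (f_ge1 a).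
have fV a : `|(f a)^-1| <= 1 by rewrite gtr0_norm ?invr_gt0 // invf_le1.
have M1 : 1 <= M.
  have [h _ _] := hM 0 0 norm0_le3 norm0_le3.
  by apply: le_trans h; rewrite (le_trans (f_ge1 0)) // ler_norm.
have M0 : 0 <= M by apply: le_trans M1.
(* 7 M^2 comes from the Lipschitz increment of f, and the Taylor remainder of f adds M <= M^2; f >=
   1 ensures M >= 1. *)
exists (8 * M ^+ 2) => a b a3 b3.
have [f1 f2 f3] := hM _ _ a3 b3; have [f1b f2b _] := hM _ _ b3 a3.
have lf := taylor2_lip M0 a3 b3 f2b f3.
have M2 : M <= M ^+ 2 by rewrite expr2 ler_peMl.
split.
- by rewrite (le_trans (fV a)) //; lra.
- rewrite mulNr normrN normrM -exprVn normrX.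
  have : `|df a| * `|(f a)^-1| ^+ 2 <= M * 1.
    by apply: ler_pM => //; rewrite ?exprn_ge0 // exprn_ile1.
  lra.
- have -> : (f a)^-1 - (f b)^-1 - - df b / f b ^+ 2 * (a - b) =
    (f a)^-1 * (f b)^-1 * (df b * (a - b) * (f a - f b) * (f b)^-1
      - (f a - f b - df b * (a - b))).
    by field; rewrite !gt_eqF.
  have h1 : `|df b * (a - b) * (f a - f b) * (f b)^-1| <= M * `|a - b| * (7 * M * `|a - b|) * 1.
    have h0 : `|df b * (a - b)| <= M * `|a - b| by rewrite normrM ler_wpM2r.
    rewrite normrM (ler_pM _ _ _ (fV b)) // normrM.
    by rewrite (ler_pM _ _ h0 lf).
  have h2 : `|df b * (a - b) * (f a - f b) * (f b)^-1 - (f a - f b - df b * (a - b))|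
      <= 8 * M ^+ 2 * (a - b) ^+ 2.
    rewrite (le_trans (ler_normB _ _)) // (le_trans (lerD h1 f3)) //.
    have -> : M * `|a - b| * (7 * M * `|a - b|) * 1 = 7 * M ^+ 2 * (a - b) ^+ 2.
      rewrite -(real_normK (num_real (a - b))); ring.
    rewrite -mulrDl ler_wpM2r ?sqr_ge0 //; lra.
  rewrite normrM -[leRHS]mul1r; apply: ler_pM => //.
  by rewrite normrM -[leRHS]mul1r; apply: ler_pM.
Qed.

Lemma taylor2_eq f df g dg : taylor2 f df -> f =1 g -> df =1 dg -> taylor2 g dg.
Proof. by move=> h /funext <- /funext <-. Qed.

End taylor2.

Section least_squares.
Context (R : realType) (mu : R).
Implicit Types x z a : R.

(* With [x = y_(s-1)] and [z = y_(s+2)], the three residuals at [s], [s+1], [s+2]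
   satisfy [a^2 e_s + a e_(s+1) + e_(s+2) = cres x z a] whatever the outlier sizes;
   by Cauchy-Schwarz their sum of squares is at least [prof x z a], with equality
   only for the outlier sizes [y_s + opt1 x z a] and [y_(s+1) + opt2 x z a]. *)
Definition cres x z a := z - a ^+ 3 * x - (1 + a + a ^+ 2) * mu.
Definition wsum a := 1 + a ^+ 2 + a ^+ 4.
Definition prof x z a := cres x z a ^+ 2 / wsum a.
Definition opt1 x z a := - (a * x + mu + a ^+ 2 * (cres x z a / wsum a)).
Definition opt2 x z a :=
  - (a ^+ 2 * x + (1 + a) * mu + (a + a ^+ 3) * (cres x z a / wsum a)).

Definition dcres x a := - (3 * a ^+ 2 * x) - (1 + 2 * a) * mu.
Definition dquot x z a :=
  dcres x a / wsum a - cres x z a * (2 * a + 4 * a ^+ 3) / wsum a ^+ 2.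
Definition dopt1 x z a :=
  - (x + 2 * a * (cres x z a / wsum a) + a ^+ 2 * dquot x z a).
Definition dopt2 x z a :=
  - (2 * a * x + mu + (1 + 3 * a ^+ 2) * (cres x z a / wsum a)
     + (a + a ^+ 3) * dquot x z a).

Lemma wsum_ge1 a : 1 <= wsum a.
Proof. by rewrite /wsum -addrA lerDl addr_ge0 ?exprn_even_ge0. Qed.

Lemma wsum_neq0 a : wsum a != 0.
Proof. by rewrite gt_eqF // (lt_le_trans _ (wsum_ge1 a)). Qed.

Lemma taylor2_exp n : taylor2 (fun a => a ^+ n.+1) (fun a => n.+1%:R * a ^+ n).
Proof.
elim: n => [|n IH].
  by apply: taylor2_eq (taylor2_id R) _ _ => a; rewrite ?expr1 // expr0 mulr1.
apply: taylor2_eq (taylor2M (taylor2_id R) IH) _ _ => a; first by rewrite -exprS.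
by rewrite mul1r mulrCA -exprS -[in RHS]natr1 mulrDl mul1r addrC.
Qed.

Lemma taylor2_wsum : taylor2 wsum (fun a => 2 * a + 4 * a ^+ 3).
Proof.
apply: taylor2_eq (taylor2D (taylor2D (taylor2_cst 1) (taylor2_exp 1)) (taylor2_exp 3)) _ _ => a //=.
by rewrite add0r expr1.
Qed.

Lemma taylor2_cres x z : taylor2 (cres x z) (dcres x).
Proof.
apply: taylor2_eq (taylor2D (taylor2D (taylor2_cst z)
  (taylor2M (taylor2_cst (- x)) (taylor2_exp 2)))
  (taylor2M (taylor2_cst (- mu)) (taylor2D (taylor2D (taylor2_cst 1) (taylor2_id R))
    (taylor2_exp 1)))) _ _ => a /=; rewrite /cres /dcres; ring.
Qed.

Lemma taylor2_quot x z : taylor2 (fun a => cres x z a / wsum a) (dquot x z).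
Proof.
apply: taylor2_eq (taylor2M (taylor2_cres x z) (taylor2V taylor2_wsum wsum_ge1)) _ _ => a //=.
by rewrite /dquot mulNr mulrN mulrA.
Qed.

Lemma taylor2_opt1 x z : taylor2 (opt1 x z) (dopt1 x z).
Proof.
apply: taylor2_eq (taylor2M (taylor2_cst (-1)) (taylor2D (taylor2D
  (taylor2M (taylor2_id R) (taylor2_cst x)) (taylor2_cst mu))
  (taylor2M (taylor2_exp 1) (taylor2_quot x z)))) _ _ => a /=;
  rewrite /opt1 /dopt1; ring.
Qed.

Lemma taylor2_opt2 x z : taylor2 (opt2 x z) (dopt2 x z).
Proof.
apply: taylor2_eq (taylor2M (taylor2_cst (-1)) (taylor2D (taylor2D
  (taylor2M (taylor2_exp 1) (taylor2_cst x))
  (taylor2M (taylor2D (taylor2_cst 1) (taylor2_id R)) (taylor2_cst mu)))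
  (taylor2M (taylor2D (taylor2_id R) (taylor2_exp 2)) (taylor2_quot x z)))) _ _ => a /=;
  rewrite /opt2 /dopt2; ring.
Qed.

Lemma taylor2_prof x z : exists dprof, taylor2 (prof x z) dprof.
Proof.
eexists; apply: taylor2_eq (taylor2M (taylor2_cres x z) (taylor2_quot x z)) _ (fun=> erefl) => a /=.
by rewrite /prof expr2 mulrA.
Qed.

(** The properties needed of the perturbation [prof]: the Lipschitz bound locates the minimizer, and
    midpoint convexity up to M (a - b)^2 yields its uniqueness once the quadratic term is large. The
    Taylor bounds transfer the expansion to the outlier sizes. *)
Definition ls_bound x z M := 0 <= M /\ (forall a b : R, `|a| <= 3 -> `|b| <= 3 ->
  [/\ prof x z a <= M, `|prof x z a - prof x z b| <= M * `|a - b|,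
      2 * prof x z ((a + b) / 2) <= prof x z a + prof x z b + M * (a - b) ^+ 2,
      `|opt1 x z a - opt1 x z b - dopt1 x z b * (a - b)| <= M * (a - b) ^+ 2 &
      `|opt2 x z a - opt2 x z b - dopt2 x z b * (a - b)| <= M * (a - b) ^+ 2]).

Lemma ls_bound_ex x z : exists M, ls_bound x z M.
Proof.
have [dp [M1 h1]] := taylor2_prof x z.
have [M2 h2] := taylor2_opt1 x z; have [M3 h3] := taylor2_opt2 x z.
have z3 : `|0 : R| <= 3 by rewrite normr0.
have M10 : 0 <= M1 by have [h _ _] := h1 _ _ z3 z3; exact: le_trans h.
have M20 : 0 <= M2 by have [h _ _] := h2 _ _ z3 z3; exact: le_trans h.
have M30 : 0 <= M3 by have [h _ _] := h3 _ _ z3 z3; exact: le_trans h.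
exists (7 * M1 + M2 + M3); split; first by lra.
move=> a b a3 b3; have [u1 u2 u3] := h1 _ _ a3 b3; have [u1b u2b u3b] := h1 _ _ b3 a3.
have [_ _ v3] := h2 _ _ a3 b3; have [_ _ w3] := h3 _ _ a3 b3.
have q0 := sqr_ge0 (a - b); have n0 := normr_ge0 (a - b).
have mid3 : `|(a + b) / 2| <= 3.
  move: a3 b3; rewrite !ler_norml => /andP[? ?] /andP[? ?]; apply/andP; lra.
have [_ _ ma] := h1 _ _ a3 mid3; have [_ _ mb] := h1 _ _ b3 mid3.
split.
- by rewrite (le_trans (ler_norm _)) // (le_trans u1) //; lra.
- rewrite (le_trans (taylor2_lip M10 a3 b3 u2b u3)) // ler_wpM2r //; lra.
- have ea : a - (a + b) / 2 = (a - b) / 2 by field.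
  have eb : b - (a + b) / 2 = - ((a - b) / 2) by field.
  move: ma mb; rewrite ea eb sqrrN exprMn => ma mb.
  have := ler_norm (- (prof x z a - prof x z ((a + b) / 2) - dp ((a + b) / 2) * ((a - b) / 2))).
  have := ler_norm (- (prof x z b - prof x z ((a + b) / 2) - dp ((a + b) / 2) * - ((a - b) / 2))).
  rewrite !normrN; move: ma mb.
  move: (prof _ _ _) (prof _ _ _) (prof _ _ _) (dp _) (a - b) q0 => pm pa pb q e q0.
  have : 0 <= M1 * e ^+ 2 by rewrite mulr_ge0.
  have : 0 <= M2 * e ^+ 2 by rewrite mulr_ge0.
  have : 0 <= M3 * e ^+ 2 by rewrite mulr_ge0.
  have -> : (7 * M1 + M2 + M3) * e ^+ 2 = 7 * (M1 * e ^+ 2) + M2 * e ^+ 2 + M3 * e ^+ 2 by ring.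
  have -> : M1 * (e ^+ 2 * 2^-1 ^+ 2) = M1 * e ^+ 2 / 4 by field.
  lra.
- rewrite (le_trans v3) // ler_wpM2r //; lra.
- rewrite (le_trans w3) // ler_wpM2r //; lra.
Qed.

Section argmin.
Variables (s n : nat) (y : nat -> R) (alpha : R).
Hypothesis (alpha01 : 0 < alpha < 1).

Definition regular k := (k != s) && (k != s.+1) && (k != s.+2).
Definition reg_S := \sum_(1 <= k < n.+1 | regular k) y k.-1 ^+ 2.
Definition reg_N :=
  \sum_(1 <= k < n.+1 | regular k) (y k - alpha * y k.-1 - mu) * y k.-1.

Let x := y s.-1.
Let z := y s.+2.
Let beta := alpha + reg_N / reg_S.
Let cst0 := \sum_(1 <= k < n.+1 | regular k) (y k - alpha * y k.-1 - mu) ^+ 2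
  - reg_N ^+ 2 / reg_S.
Let F a := cst0 + reg_S * (a - beta) ^+ 2 + prof x z a.

(** The regular part is a completed square. The three special residuals are split along the vector
    (a^2, a, 1): their component in this direction has squared length [prof], and the squares that
    remain are those of the orthogonal component. *)
Lemma Qn_profile a t1 t2 : reg_S != 0 ->
  Qn mu s n y (a, t1, t2) = F a
   + (y s - a * x - mu - t1 - a ^+ 2 * (cres x z a / wsum a)) ^+ 2
   + (y s.+1 - a * y s - mu + a * t1 - t2 - a * (cres x z a / wsum a)) ^+ 2
   + (z - a * y s.+1 - mu + a * t2 - cres x z a / wsum a) ^+ 2.
Proof.
move=> S0; rewrite /Qn.
have -> : \sum_(1 <= k < n.+1 | (k != s) && (k != s.+1) && (k != s.+2))
      (y k - a * y k.-1 - mu) ^+ 2 = cst0 + reg_S * (a - beta) ^+ 2.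
  under eq_bigr => k _ do have -> : (y k - a * y k.-1 - mu) ^+ 2 =
    (y k - alpha * y k.-1 - mu) ^+ 2 + (- 2 * (a - alpha)) *
     ((y k - alpha * y k.-1 - mu) * y k.-1) + (a - alpha) ^+ 2 * y k.-1 ^+ 2 by ring.
  rewrite !big_split /= -!mulr_sumr -/reg_S -/reg_N /cst0 /beta.
  by field.
rewrite /F -!addrA; congr (_ + (_ + _)).
rewrite /prof /x /z.
have := wsum_neq0 a; rewrite /cres /wsum => h.
by field.
Qed.

(** Once the outlier sizes are eliminated, F a = constant + S (a - beta)^2 + [prof] remains, with S
    large against the constants of [prof]. A minimizer over [-3, 3] exists by compactness, and the
    quadratic term makes it global and unique. *)
Lemma argmin_Qn M : ls_bound x z M -> 2 * M < reg_S -> `|reg_N| <= reg_S ->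
  exists2 a, `|a - beta| <= M / reg_S /\ `|a| <= 3 &
    unique_argmin (Qn mu s n y) = (a, y s + opt1 x z a, y s.+1 + opt2 x z a).
Proof.
move=> [M0 hM] MS NS; have S0 : 0 < reg_S by lra.
have Sn0 : reg_S != 0 by rewrite gt_eqF.
(* alpha contributes at most 1, and so does the correction, since |reg_N| <= reg_S. *)
have b2 : `|beta| <= 2.
  have : `|reg_N / reg_S| <= 1 by rewrite normrM normfV (gtr0_norm S0) ler_pdivrMr // mul1r.
  move: alpha01 => /andP[? ?]; rewrite /beta !ler_norml => /andP[? ?]; lra.
have b3 : `|beta| <= 3 by lra.
have prof0 a : 0 <= prof x z a.
  by rewrite /prof divr_ge0 ?sqr_ge0 // (le_trans _ (wsum_ge1 a)).
have [pb _ _ _ _] := hM _ _ b3 b3.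
have Fbeta : F beta = cst0 + prof x z beta by rewrite /F subrr expr0n /= mulr0 addr0.
have cF : {within `[-3, 3], continuous F}.
  apply: continuous_subspaceT => a.
  have cid : {for a, continuous (fun b : R => b)} by exact: cvg_id.
  have cc (c : R) : {for a, continuous (fun _ : R => c)} by exact: cvg_cst.
  have cx k : {for a, continuous (fun b : R => b ^+ k)} by exact: exprn_continuous.
  apply: cvgD; first apply: cvgD; first exact: cvg_cst.
    apply: cvgM; first exact: cvg_cst.
    under eq_fun do rewrite expr2.
    by apply: cvgM; apply: cvgB; (exact: cvg_id || exact: cvg_cst).
  have cres_cvg : {for a, continuous (cres x z)}.
    apply: cvgB; first apply: cvgB; first exact: cvg_cst.
      by apply: cvgM; [exact: cx|exact: cvg_cst].
    apply: cvgM; last exact: cvg_cst.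
    by apply: cvgD; [apply: cvgD; [exact: cvg_cst|exact: cvg_id]|exact: cx].
  apply: cvgM.
    by under eq_fun do rewrite expr2; apply: cvgM.
  apply: cvgV; first exact: wsum_neq0.
  by apply: cvgD; [apply: cvgD; [exact: cvg_cst|exact: cx]|exact: cx].
have [a am aP] : exists2 a, a \in `[-3, 3] & forall t, t \in `[-3, 3] -> F a <= F t.
  by apply: EVT_min cF; lra.
have inI (t : R) : (t \in `[-3, 3]) = (`|t| <= 3) by rewrite ler_norml in_itv.
have far t : F t <= F beta -> reg_S * (t - beta) ^+ 2 <= prof x z beta - prof x z t.
  rewrite Fbeta /F; lra.
(* Such a t satisfies S (t - beta)^2 <= M <= S, hence is within 1 of beta. *)
have near t : F t <= F beta -> `|t| <= 3.
  move=> /far ft; have : (t - beta) ^+ 2 <= 1.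
    rewrite -(ler_pM2l S0); have := prof0 t; lra.
  rewrite -real_normK ?num_real // expr_le1 // => tb.
  by move: tb b2; rewrite !ler_norml => /andP[? ?] /andP[? ?]; lra.
have amin t : F a <= F t.
  have [t3|t3] := leP `|t| 3; first by rewrite aP // inI.
  have [|] := leP (F t) (F beta); first by move/near; rewrite leNgt t3.
  by move=> /ltW; apply: le_trans; rewrite aP // inI.
(* Compare t and a with their midpoint: the quadratic part gains S (t - a)^2/2, the profile loses at
   most M (t - a)^2, and S > 2 M. *)
have auniq t : F t <= F a -> t = a.
  move=> ta; have t3 : `|t| <= 3 by apply: near; exact: le_trans (amin _).
  have a3 : `|a| <= 3 by rewrite -inI.
  have [_ _ + _ _] := hM _ _ t3 a3.
  have := amin ((t + a) / 2); have := ta.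
  rewrite /F => h1 h2 h3.
  have e : reg_S * (t - beta) ^+ 2 + reg_S * (a - beta) ^+ 2 =
    2 * (reg_S * ((t + a) / 2 - beta) ^+ 2) + reg_S / 2 * (t - a) ^+ 2 by field.
  have : (reg_S / 2 - M) * (t - a) ^+ 2 <= 0.
    rewrite mulrBl; lra.
  rewrite pmulr_rle0; last by lra.
  by move=> h; apply/eqP; rewrite -subr_eq0 -sqrf_eq0 eq_le h sqr_ge0.
have a3 : `|a| <= 3 by rewrite -inI.
(* F a <= F beta gives S (a - beta)^2 <= M |a - beta|, and one factor cancels. *)
exists a; first split => //.
  have [_ lip _ _ _] := hM _ _ b3 a3.
  have := far _ (amin beta); have := le_trans (ler_norm _) lip.
  rewrite distrC -(real_normK (num_real (a - beta))) => h1 h2.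
  have [->|d0] := eqVneq (a - beta) 0; first by rewrite normr0 divr_ge0 // ltW.
  have dp : 0 < `|a - beta| by rewrite normr_gt0.
  rewrite ler_pdivlMr // -(ler_pM2r dp); apply: le_trans (le_trans h2 h1).
  by rewrite expr2; nra.
have Qge b t1 t2 : F b <= Qn mu s n y (b, t1, t2).
  by rewrite Qn_profile // -2!addrA lerDl !addr_ge0 ?sqr_ge0.
have Qopt : Qn mu s n y (a, y s + opt1 x z a, y s.+1 + opt2 x z a) = F a.
  rewrite Qn_profile // /opt1 /opt2 /prof.
  have := wsum_neq0 a; rewrite /cres /wsum => h.
  have -> : F a = F a + 0 + 0 + 0 by rewrite !addr0.
  congr (_ + _ + _ + _); rewrite ?addr0 //; rewrite -?[RHS](expr0n _ 2); congr (_ ^+ 2); by field.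
have optmin q : Qn mu s n y (a, y s + opt1 x z a, y s.+1 + opt2 x z a) <= Qn mu s n y q.
  by case: q => -[b t1] t2; rewrite Qopt (le_trans (amin b)).
rewrite /unique_argmin; apply: xget_unique; last first.
  by move=> p [_ p2]; apply/esym/p2.
split=> [//|[[b t1] t2] hp].
  have := hp (a, y s + opt1 x z a, y s.+1 + opt2 x z a); rewrite Qopt => hle.
  have bE : b = a by apply: auniq; exact: le_trans (Qge b t1 t2) hle.
  subst b; move: hle; rewrite Qn_profile // -2!addrA gerDl.
  set e1 := (_ - _ - mu - t1 - _); set e2 := (_ - _ + a * t1 - _ - _).
  set e3 := (X in _ + (_ + X ^+ 2) <= _) => hle.
  have q1 := sqr_ge0 e1; have q2 := sqr_ge0 e2; have q3 := sqr_ge0 e3.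
  have /eqP : e1 ^+ 2 = 0 by lra.
  have /eqP : e2 ^+ 2 = 0 by lra.
  rewrite !sqrf_eq0 => /eqP e20 /eqP e10.
  have t1E : t1 = y s + opt1 x z a.
    move: e10; rewrite /e1 /opt1; lra.
  congr (_, _, _) => //.
  move: e20; rewrite /e2 t1E /opt1 /opt2; set q := _ / _ => h; nra.
Qed.

End argmin.
(** A deterministic statement: probability will only have to supply data for which the smallness
    conditions in [del] hold. [V] is the normalized martingale, [r] the contribution of finitely
    many early terms, and V/m2 the leading term of the error of the estimator of alpha. *)
Lemma argmin_expansion (alpha m2 K e : R) : 0 < alpha < 1 -> 0 < m2 -> 0 <= K -> 0 < e ->
  exists2 del, 0 < del & exists c : R, forall n s (y : nat -> R) M V r,
  let x := y s.-1 in let z := y s.+2 in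
  let est := unique_argmin (Qn mu s n y) in
  c < Num.sqrt n%:R -> ls_bound x z M ->
  `|reg_S s n y / n%:R - m2| <= del -> reg_N s n y alpha = Num.sqrt n%:R * (V + r) ->
  `|V| <= K -> `|r| <= del -> M <= del * Num.sqrt n%:R ->
  `|dopt1 x z alpha| <= K -> `|dopt2 x z alpha| <= K ->
  [/\ `|Num.sqrt n%:R * (est.1.1 - alpha) - V / m2| <= e,
      `|Num.sqrt n%:R * (est.1.2 - (y s + opt1 x z alpha)) - dopt1 x z alpha * (V / m2)| <= e &
      `|Num.sqrt n%:R * (est.2 - (y s.+1 + opt2 x z alpha)) - dopt2 x z alpha * (V / m2)| <= e].
Proof.
move=> a01 m20 K0 e0.
(* del C1 bounds the error for alpha: 2/m2 for the distance of the minimizer to beta, 2/m2 for [r],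
   and 2 K/m2^2 for replacing S/n by m2. [C2] adds the quadratic Taylor remainder and the
   derivative, at most K, times that error. *)
pose C1 := 2 * K / m2 ^+ 2 + 4 / m2.
pose C2 := C1 + (K / m2 + C1) ^+ 2 + K * C1 + 1.
have C10 : 0 <= C1 by rewrite addr_ge0 // divr_ge0 ?mulr_ge0 ?sqr_ge0 // ltW.
have Km0 : 0 <= K / m2 by rewrite divr_ge0 // ltW.
have KC0 : 0 <= K * C1 by rewrite mulr_ge0.
have sq0 := sqr_ge0 (K / m2 + C1).
have C20 : 0 < C2 by rewrite /C2; lra.
pose del := Num.min 1 (Num.min (m2 / 2) (e / C2)).
have del0 : 0 < del by rewrite !lt_min ltr01 !divr_gt0.
have del1 : del <= 1 by rewrite ge_min lexx.
have delm : del <= m2 / 2 by rewrite !ge_min lexx !orbT.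
have dele : del * C2 <= e by rewrite -ler_pdivlMr // !ge_min lexx !orbT.
(* Beyond this threshold for sqrt n, S exceeds both 2 M and |reg_N|, as [argmin_Qn] requires. *)
exists del => //; exists ((4 + 2 * (K + 1)) / m2) => n s y M V r x z est.
set q := Num.sqrt _ => cq bM Sm NE VK rd Md f1K f2K.
have q0 : 0 < q.
  by apply: le_lt_trans cq; rewrite divr_ge0 ?(ltW m20) // addr_ge0 // mulr_ge0 // addr_ge0.
have nE : n%:R = q ^+ 2 by rewrite /q sqr_sqrtr.
have cq' : 4 + 2 * (K + 1) < q * m2 by rewrite -ltr_pdivrMr.
set sb := reg_S s n y / n%:R in Sm.
have SE : reg_S s n y = q ^+ 2 * sb by rewrite /sb -nE; field; rewrite nE sqrf_eq0 gt_eqF.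
have sbm : m2 / 2 <= sb by move: Sm; rewrite ler_norml => /andP[]; lra.
have sb0 : 0 < sb by apply: lt_le_trans sbm; rewrite divr_gt0.
have M0 : 0 <= M by case: bM.
have Mq : M <= q by rewrite (le_trans Md) // ler_piMl // ltW.
have qsb : q * (q * m2) <= 2 * (q ^+ 2 * sb).
  rewrite expr2; have := ler_wpM2l (sqr_ge0 q) sbm; rewrite expr2; lra.
have qq : q * (4 + 2 * (K + 1)) < q * (q * m2) by rewrite ltr_pM2l.
have qK : 0 <= q * K by rewrite mulr_ge0 // ltW.
have MS : 2 * M < reg_S s n y by rewrite SE; lra.
have NS : `|reg_N s n y alpha| <= reg_S s n y.
  rewrite NE SE normrM (gtr0_norm q0).
  have : q * `|V + r| <= q * (K + 1).
    rewrite ler_pM2l // (le_trans (ler_normD _ _)) // lerD // (le_trans rd) //.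
  lra.
have [a [ab a3] estE] := argmin_Qn a01 bM MS NS.
rewrite /est estE /= -/x -/z.
have h0 : `|q * (a - alpha) - V / m2| <= del * C1.
  have -> : q * (a - alpha) - V / m2 =
      q * (a - (alpha + reg_N s n y alpha / reg_S s n y))
      + (V * (m2 - sb) / (sb * m2) + r / sb).
    by rewrite NE SE; field; rewrite !gt_eqF.
  have h1 : `|q * (a - (alpha + reg_N s n y alpha / reg_S s n y))| <= del * (2 / m2).
    rewrite normrM (gtr0_norm q0).
    have : q * `|a - (alpha + reg_N s n y alpha / reg_S s n y)| <= q * (M / reg_S s n y).
      by rewrite ler_pM2l.
    move/le_trans; apply; rewrite SE.
    have -> : q * (M / (q ^+ 2 * sb)) = M / (q * sb) by field; rewrite !gt_eqF.
    rewrite ler_pdivrMr ?(mulr_gt0 q0 sb0) //; apply: (le_trans Md).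
    have -> : del * (2 / m2) * (q * sb) = del * q * (2 / m2 * sb) by ring.
    rewrite ler_peMr //; first by rewrite mulr_ge0 // ltW.
    by rewrite mulrAC ler_pdivlMr // mul1r; lra.
  have sV : sb^-1 <= 2 / m2.
    by rewrite -[leLHS]mul1r ler_pdivrMr // mulrAC ler_pdivlMr // mul1r; lra.
  have sV0 : 0 < sb^-1 by rewrite invr_gt0.
  have h2 : `|r / sb| <= del * (2 / m2).
    by rewrite normrM (gtr0_norm sV0) ler_pM // ltW.
  have h3 : `|V * (m2 - sb) / (sb * m2)| <= del * (2 * K / m2 ^+ 2).
    have -> : V * (m2 - sb) / (sb * m2) = V * (m2 - sb) * (sb^-1 * m2^-1).
      by field; rewrite !gt_eqF.
    have -> : del * (2 * K / m2 ^+ 2) = K * del * (2 / m2 * m2^-1).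
      by field; rewrite gt_eqF.
    rewrite normrM [`|_ * m2^-1|]gtr0_norm ?mulr_gt0 ?invr_gt0 //.
    apply: ler_pM => //; first by rewrite mulr_ge0 // ltW ?invr_gt0.
      by rewrite normrM distrC ler_pM.
    by rewrite ler_pM2r // invr_gt0.
  rewrite (le_trans (ler_normD _ _)) // (le_trans (lerD h1 (le_trans (ler_normD _ _) (lerD h3 h2)))) //.
  by rewrite /C1 -!mulrDr ler_pM2l //; lra.
have hK : `|q * (a - alpha)| <= K / m2 + C1.
  have := ler_normD (q * (a - alpha) - V / m2) (V / m2); rewrite subrK => /le_trans; apply.
  rewrite addrC lerD //.
    by rewrite normrM [`|m2^-1|]gtr0_norm ?invr_gt0 // ler_pM2r ?invr_gt0.
  by rewrite (le_trans h0) // ler_piMl.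
have al3 : `|alpha| <= 3 by move: a01 => /andP[? ?]; rewrite ler_norml; lra.
have [_ /(_ _ _ a3 al3)[_ _ _ t1 t2]] := bM.
have rem u v (fd : R) : `|fd| <= K -> `|u - v - fd * (a - alpha)| <= M * (a - alpha) ^+ 2 ->
    `|q * (u - v) - fd * (V / m2)| <= e.
  move=> fdK h.
  have -> : q * (u - v) - fd * (V / m2) =
    q * (u - v - fd * (a - alpha)) + fd * (q * (a - alpha) - V / m2) by ring.
  apply: le_trans dele; rewrite (le_trans (ler_normD _ _)) // !normrM (gtr0_norm q0).
  have k1 : q * `|u - v - fd * (a - alpha)| <= del * (K / m2 + C1) ^+ 2.
    have : q * `|u - v - fd * (a - alpha)| <= q * (M * (a - alpha) ^+ 2) by rewrite ler_pM2l.
    move/le_trans; apply.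
    have : q * (M * (a - alpha) ^+ 2) <= q * (del * q * (a - alpha) ^+ 2).
      by rewrite ler_pM2l // ler_wpM2r ?sqr_ge0.
    move/le_trans; apply.
    have -> : q * (del * q * (a - alpha) ^+ 2) = del * `|q * (a - alpha)| ^+ 2.
      by rewrite real_normK ?num_real //; ring.
    by rewrite ler_pM2l // lerXn2r // nnegrE addr_ge0.
  have k2 : `|fd| * `|q * (a - alpha) - V / m2| <= K * (del * C1) by rewrite ler_pM.
  have -> : del * C2 = del * (K / m2 + C1) ^+ 2 + K * (del * C1) + del * (C1 + 1).
    by rewrite /C2; ring.
  have k3 : 0 <= del * (C1 + 1) by apply: mulr_ge0; [exact: ltW|exact: addr_ge0].
  lra.
split.
- apply: le_trans h0 (le_trans _ dele); rewrite ler_pM2l // /C2; lra.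
- apply: rem => //; move: t1; rewrite [X in `|X| <= _ -> _](_ : _ =
    y s + opt1 x z a - (y s + opt1 x z alpha) - dopt1 x z alpha * (a - alpha)) //; ring.
- apply: rem => //; move: t2; rewrite [X in `|X| <= _ -> _](_ : _ =
    y s.+1 + opt2 x z a - (y s.+1 + opt2 x z alpha) - dopt2 x z alpha * (a - alpha)) //; ring.
Qed.

End least_squares.

(** * The stationary law *)

Section discrete_law.
Context (R : realType) (pi : nat -> R).
Hypothesis pi_ge0 : forall n, 0 <= pi n.
Hypothesis pi_sum : (\sum_(0 <= n <oo) (pi n)%:E = 1)%E.

Definition discrete_measure : set nat -> \bar R :=
  mseries (fun n => mscale (NngNum (pi_ge0 n)) (\d_n)) 0.

HB.instance Definition _ := Measure.on discrete_measure.

Lemma integral_discrete (g : nat -> \bar R) : (forall n, 0 <= g n)%E ->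
  (\int[discrete_measure]_n g n = \sum_(0 <= n <oo) (pi n)%:E * g n)%E.
Proof.
move=> g0; rewrite ge0_integral_measure_series //.
apply: eq_eseriesr => n _; rewrite ge0_integral_mscale // integral_dirac //.
by rewrite diracT mul1e.
Qed.

Let discrete_setT : discrete_measure setT = 1%E.
Proof.
rewrite -[LHS]mul1e -integral_cst // integral_discrete //.
by under eq_eseriesr do rewrite mule1.
Qed.

HB.instance Definition _ :=
  @Measure_isProbability.Build _ _ R discrete_measure discrete_setT.

Lemma discrete_law_ex : exists Q : probability nat R,
  forall g : nat -> \bar R, (forall n, 0 <= g n)%E ->
  (\int[Q]_n g n = \sum_(0 <= n <oo) (pi n)%:E * g n)%E.
Proof. by exists discrete_measure; exact: integral_discrete. Qed.

End discrete_law.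

Section kernel.
Context d (T : measurableType d) (R : realType) (P : probability T R).
Context (alpha : R) (X0 : T -> nat) (eps : nat -> T -> nat).
Context (xi : nat -> nat -> T -> nat).
Notation Z := (inar_family X0 eps xi).
Hypothesis mZ : forall i, nat_rv (Z i).
Hypothesis iZ : mutually_independent P Z.
Hypothesis eps_id :
  forall k m, P (eps k @^-1` [set m]) = P (eps 0%N @^-1` [set m]).
Hypothesis xi_le1 : forall k j w, (xi k j w <= 1)%N.
Hypothesis xi_P : forall k j, P (xi k j @^-1` [set 1%N]) = alpha%:E.
Hypothesis a01 : 0 < alpha < 1.
Notation W := (step eps xi 0).
Notation p := (eps_pmf P eps).

Let pW (x m : nat) : R := fine (P (W x @^-1` [set m])).

Let mW x : nat_rv (W x). Proof. exact: (nat_rv_step mZ). Qed.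

Lemma integral_law (N : T -> nat) (g : nat -> \bar R) : nat_rv N ->
  (forall v, 0 <= g v)%E ->
  (\int[P]_w g (N w) = \sum_(0 <= m <oo) (fine (P (N @^-1` [set m])))%:E * g m)%E.
Proof.
move=> mN g0; rewrite (integral_nat_rv P mN) //; last exact: (nat_rv_measurable g mN).
apply: eq_eseriesr => m _.
rewrite (eq_integral (cst (g m))); last by move=> w /set_mem /= <-.
by rewrite integral_cst ?fineK ?fin_num_measure // muleC.
Qed.

Lemma law_indic (N : T -> nat) m : nat_rv N ->
  (\int[P]_w ((\1_[set m] (N w) : R)%:E) = P (N @^-1` [set m]))%E.
Proof.
by move=> mN; rewrite -[in RHS](setIT (N @^-1` _)) -integral_indic.
Qed.

Let pWS x m : pW x.+1 m =
  alpha * (if m is m'.+1 then pW x m' else 0) + (1 - alpha) * pW x m.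
Proof.
have [a0 a1] := andP a01.
have mI (N : T -> nat) (f : nat -> \bar R) : nat_rv N -> measurable_fun setT (fun w => f (N w)).
  by move=> mN; exact: (nat_rv_measurable f mN).
have h : (P (W x.+1 @^-1` [set m]) =
   alpha%:E * (if m is m'.+1 then P (W x @^-1` [set m']) else 0) +
   (1 - alpha)%:E * P (W x @^-1` [set m]))%E.
  rewrite -[LHS]law_indic //.
  rewrite (integral_stepS mZ iZ xi_le1 xi_P x
    (g := fun v => (\1_[set m] v : R)%:E)); last by move=> v; rewrite lee_fin.
  rewrite ge0_integralD //=; last 4 first.
  - by move=> w _; rewrite mule_ge0 ?lee_fin // ltW.
  - exact: (mI _ (fun v => alpha%:E * (\1_[set m] v.+1 : R)%:E)%E).
  - by move=> w _; rewrite mule_ge0 ?lee_fin // subr_ge0 ltW.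
  - exact: (mI _ (fun v => (1 - alpha)%:E * (\1_[set m] v : R)%:E)%E).
  have Zc (c : R) (f : nat -> R) : 0 <= c -> (forall v, 0 <= f v) ->
      (\int[P]_w (c%:E * (f (W x w))%:E) = c%:E * \int[P]_w (f (W x w))%:E)%E.
    move=> c0 f0; apply: ge0_integralZl_EFin => //.
      by move=> w _; rewrite lee_fin.
    exact: (mI _ (fun v => (f v)%:E)).
  rewrite (Zc _ (fun v => \1_[set m] v.+1)) ?ltW // (Zc _ (fun v => \1_[set m] v)) ?subr_ge0 ?ltW //.
  congr (_ * _ + _ * _)%E; last exact: law_indic.
  case: m => [|m].
    apply: integral0_eq => w _; rewrite indicE memNset //=.
  rewrite -(law_indic m) //; apply: eq_integral => w _; rewrite !indicE.
  by congr ((_ _)%:R%:E); apply/idP/idP => /set_mem /= h; apply/mem_set => /=; [case: h|rewrite h].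
rewrite /pW h; case: m {h} => [|m].
  by rewrite mule0 add0e mulr0 add0r fineM ?fin_num_measure //; exact: mW.
have f1 k : P (W x @^-1` [set k]) \is a fin_num by apply: fin_num_measure; exact: mW.
by rewrite fineD ?fineM ?fin_numM.
Qed.

(** The kernel summed up to m instead of min n m; the additional binomial coefficients vanish, and a
    range independent of n allows induction on n. *)
Let kk (n m : nat) : R := \sum_(i < m.+1)
  ('C(n, i)%:R * alpha ^+ i * (1 - alpha) ^+ (n - i) * p (m - i)%N).

Let kkE n m : inar_kernel alpha p n m = kk n m.
Proof.
rewrite /inar_kernel /kk.
rewrite (big_ord_widen_cond m.+1 xpredT
  (fun i => 'C(n, i)%:R * alpha ^+ i * (1 - alpha) ^+ (n - i) * p (m - i)%N)) /=; last first.
  by rewrite ltnS geq_minr.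
rewrite [RHS](bigID (fun i : 'I_m.+1 => (i < (minn n m).+1)%N)) /= [X in _ = _ + X]big1 ?addr0 //.
move=> i; rewrite -leqNgt => hi; rewrite bin_small ?mul0r //.
by have := ltn_ord i; move: hi; lia.
Qed.

Let kkS n m : kk n.+1 m =
  alpha * (if m is m'.+1 then kk n m' else 0) + (1 - alpha) * kk n m.
Proof.
(* For i > n the truncated subtraction would break the power law, but the binomial coefficient is
   zero. *)
have b1 i : ('C(n, i)%:R * (1 - alpha) ^+ (n.+1 - i) : R) =
    (1 - alpha) * ('C(n, i)%:R * (1 - alpha) ^+ (n - i)).
  have [hi|hi] := leqP i n; last by rewrite bin_small // !mul0r mulr0.
  by rewrite subSn // exprS; ring.
case: m => [|m]; rewrite /kk.
  rewrite !big_ord1 !bin0 !subn0 !expr0 exprS; ring.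
rewrite big_ord_recl [in X in _ = _ + X]big_ord_recl /= mulrDr.
rewrite !bin0 !subn0 !expr0 exprS.
rewrite (eq_bigr (fun i : 'I_m.+1 =>
  alpha * ('C(n, i)%:R * alpha ^+ i * (1 - alpha) ^+ (n - i) * p (m - i)%N)
  + (1 - alpha) * ('C(n, bump 0 i)%:R * alpha ^+ (bump 0 i) * (1 - alpha) ^+ (n - bump 0 i)
    * p (m.+1 - bump 0 i)%N))).
  rewrite big_split /= -!mulr_sumr; ring.
move=> i _; rewrite /bump leq0n add1n binS natrD !subSS exprS.
have := b1 i.+1; rewrite subSS => h.
transitivity (alpha * ('C(n, i)%:R * alpha ^+ i * (1 - alpha) ^+ (n - i) * p (m - i)%N) +
  ('C(n, i.+1)%:R * (1 - alpha) ^+ (n - i)) * (alpha * alpha ^+ i * p (m - i)%N)); first by ring.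
rewrite h; ring.
Qed.

(** Both sides satisfy the same recursion in the initial state: Pascal's rule on the left, one more
    Bernoulli variable on the right. *)
Lemma inar_kernelE x m : inar_kernel alpha p x m = fine (P (W x @^-1` [set m])).
Proof.
rewrite kkE -/(pW x m); elim: x m => [|x IH] m; last first.
  by rewrite kkS pWS IH; case: m => [|m] //; rewrite IH.
rewrite /kk big_ord_recl big1 ?addr0 => [|i _]; last by rewrite bin_small // !mul0r.
rewrite bin0 !expr0 subn0 !mul1r /eps_pmf /pW; congr (fine (P _)).
by apply/seteqP; split => w; rewrite /preimage /= /step big_ord0 add0n.
Qed.

(** Stationarity is given for point masses; interchanging two nonnegative series extends it to all
    nonnegative functions, in the form used by the ergodic theory. *)
Lemma stationary_law_ex pi : is_stationary (inar_kernel alpha p) pi ->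
  exists Q : probability nat R,
  (forall g : nat -> \bar R, (forall n, 0 <= g n)%E ->
    (\int[Q]_n g n = \sum_(0 <= n <oo) (pi n)%:E * g n)%E) /\
  (forall g : nat -> \bar R, (forall n, 0 <= g n)%E ->
    (\int[Q]_n \int[P]_w g (W n w) = \int[Q]_n g n)%E).
Proof.
move=> [pi0 [pi1 piK]]; have [Q QE] := discrete_law_ex pi0 pi1; exists Q; split => // g g0.
have f0 x m : 0 <= fine (P (W x @^-1` [set m])) by rewrite fine_ge0.
rewrite !QE //; last by move=> n; apply: integral_ge0.
under eq_eseriesr do rewrite (integral_law (mW _)) //.
transitivity (\sum_(0 <= n <oo) \sum_(0 <= m <oo)
    (pi n)%:E * ((fine (P (W n @^-1` [set m])))%:E * g m))%E.
  apply: eq_eseriesr => n _; rewrite nneseriesZl // => m _.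
  by rewrite mule_ge0 // lee_fin.
rewrite nneseries_interchange; last by move=> n m; rewrite !mule_ge0 // lee_fin.
apply: eq_eseriesr => m _; rewrite piK.
under [in RHS]eq_eseriesr do rewrite EFinM inar_kernelE.
rewrite -(QE (fun n => (fine (P (W n @^-1` [set m])))%:E)); last by move=> n; rewrite lee_fin.
rewrite -(QE (fun n => (fine (P (W n @^-1` [set m])))%:E * g m)%E); last first.
  by move=> n; rewrite mule_ge0 // lee_fin.
rewrite [RHS]muleC; under eq_integral do rewrite muleC.
by rewrite ge0_integralZl // => n _; rewrite lee_fin.
Qed.

End kernel.

Section transfer.
Context d (T : measurableType d) (R : realType) (P : probability T R).

(** Slutsky's argument under a weight. Closeness is required only where [rho] is nonzero, because
    [rho] will be the indicator of the conditioning event. *)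
Lemma exp_dist_cvg0 (rho : T -> R) (G G' : nat -> T -> R) (M l : R) :
  measurable_fun setT rho -> (forall w, `|rho w| <= 1) ->
  (forall n, measurable_fun setT (G n)) -> (forall n, measurable_fun setT (G' n)) ->
  (forall n w, `|G n w| <= M) -> (forall n w, `|G' n w| <= M) ->
  (forall e e', 0 < e -> 0 < e' -> exists N, forall n, (N <= n)%N -> exists2 A,
    measurable A /\ fine (P A) <= e' &
    forall w, ~ A w -> rho w != 0 -> `|G n w - G' n w| <= e) ->
  \int[P]_w (rho w * G' n w) @[n --> \oo] --> l ->
  \int[P]_w (rho w * G n w) @[n --> \oo] --> l.
Proof.
move=> mr r1 mG mG' GM G'M close cl.
have M0 : 0 <= M by exact: le_trans (GM 0%N point).
have iG (H : nat -> T -> R) n : (forall n, measurable_fun setT (H n)) ->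
    (forall n w, `|H n w| <= M) -> itg P (fun w => rho w * H n w).
  move=> mH HM; apply: (itg_bounded P (M := M)); first exact: measurable_funM.
  by move=> w; rewrite normrM -[leRHS]mul1r ler_pM.
have cd : \int[P]_w (rho w * G n w) - \int[P]_w (rho w * G' n w) @[n --> \oo] --> (0 : R).
  apply/cvgrPdist_le => e e0.
  have e20 : 0 < e / 2 by rewrite divr_gt0.
  have e'0 : 0 < e / 2 / (2 * M + 1) by rewrite divr_gt0 // ltr_wpDl // mulr_ge0.
  have [N hN] := close _ _ e20 e'0.
  near=> n.
  have [|A [mA PA] hA] := hN n; first by near: n; exact: nbhs_infty_ge.
  rewrite sub0r normrN -expB; [|exact: iG|exact: iG].
  have h1 w : `|rho w * G n w - rho w * G' n w| <= 2 * M.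
    rewrite -mulrBr normrM -[leRHS]mul1r ler_pM // (le_trans (ler_normB _ _)) //.
    by rewrite [leRHS]mulr_natl mulr2n lerD.
  have h2 w : ~ A w -> `|rho w * G n w - rho w * G' n w| <= e / 2.
    move=> Aw; rewrite -mulrBr normrM.
    have [->|r0] := eqVneq (rho w) 0; first by rewrite normr0 mul0r ltW.
    by rewrite -[leRHS]mul1r ler_pM // hA.
  have iD : itg P (fun w => rho w * G n w - rho w * G' n w).
    by apply: itgB; exact: iG.
  apply: le_trans (exp_norm iD) _.
  apply: le_trans (exp_norm_split iD mA h1 h2 (ltW e20)) _.
  rewrite [leRHS]splitr lerD2l.
  apply: le_trans (_ : (2 * M) * (e / 2 / (2 * M + 1)) <= _).
    by rewrite ler_wpM2l // mulr_ge0.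
  have M1 : 0 < 2 * M + 1 by rewrite ltr_wpDl // mulr_ge0.
  rewrite mulrCA ler_piMr ?(ltW e20) // ler_pdivrMr // mul1r; lra.
rewrite (_ : (fun n => _) = fun n => (\int[P]_w (rho w * G n w) -
  \int[P]_w (rho w * G' n w)) + \int[P]_w (rho w * G' n w)).
  by rewrite -[l]add0r; exact: cvgD.
by apply/funext => n; rewrite subrK.
Unshelve. all: by end_near.
Qed.

End transfer.

Section normal_law.
Context (R : realType).

(* [normal_prob] lives on [measurableTypeR R]; its image under the identity is
   the same law on the canonical measurable structure of [R]. *)
Definition to_real (x : measurableTypeR R) : R := x.

HB.instance Definition _ := isMeasurableFun.Build _ _ _ _ to_real
  (@measurable_id _ (measurableTypeR R) setT).

Definition normal_law (s : R) : probability R R :=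
  distribution (normal_prob 0 s) to_real.

Lemma is_normal0_law (v : R) : 0 < v -> is_normal0 (normal_law (Num.sqrt v)) v.
Proof. by move=> v0 A mA; rewrite v0. Qed.

Lemma exp_normal_law (s : R) (f : R -> R) (M : R) :
  measurable_fun setT f -> (forall z, `|f z| <= M) ->
  \int[normal_law s]_x f x = \int[normal_prob 0 s]_x f x.
Proof.
move=> mf fM; rewrite /Rintegral /normal_law integral_distribution //.
  exact/measurable_EFinP.
exact: (itg_bounded (normal_prob 0 s) (f := f) (M := M)).
Qed.

End normal_law.

(** An open set of the plane is the union of the countably many rational boxes it contains, and
    boxes are measurable for the product structure. *)
Lemma continuous_measurable_plane (R : realType) (g : R * R -> R) :
  continuous g -> measurable_fun setT g.
Proof.
move=> /continuousP cg; apply: (measurability _ (RGenOpens.measurableE R)).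
move=> _ [_ [a [b ->] <-]]; rewrite setTI.
set U := g @^-1` _; have oU : open U by exact/cg/interval_open.
pose box (q : rat * rat * rat * rat) : set (R * R) :=
  `]ratr q.1.1.1, ratr q.1.1.2[ `*` `]ratr q.1.2, ratr q.2[.
have -> : U = \bigcup_q (if pselect (box q `<=` U) then box q else set0).
  apply/seteqP; split => [z Uz|z [q _]]; last by case: pselect => // h; exact: h.
  have /nbhs_ballP[r /= r0 hr] : nbhs z U by exact: open_nbhs_nbhs.
  have lo (x : R) : x - r < x by rewrite ltrBlDr ltrDl.
  have hi (x : R) : x < x + r by rewrite ltrDl.
  have [a1 ha1] := rat_in_itvoo (lo z.1); have [b1 hb1] := rat_in_itvoo (hi z.1).
  have [a2 ha2] := rat_in_itvoo (lo z.2); have [b2 hb2] := rat_in_itvoo (hi z.2).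
  move: ha1 hb1 ha2 hb2; rewrite !in_itv /= => /andP[? ?] /andP[? ?] /andP[? ?] /andP[? ?].
  exists (a1, b1, a2, b2) => //; case: pselect => [h|h].
    by split; rewrite /= in_itv /=; apply/andP.
  case: h => y [] /=; rewrite !in_itv /= => /andP[? ?] /andP[? ?].
  by apply: hr; split; rewrite /ball /= ltr_norml; apply/andP; split; lra.
apply: countable_bigcupT_measurable => [|q]; first exact: countableP.
case: pselect => h /=; last exact: measurable0.
by apply: measurableX; exact: measurable_itv.
Qed.

Section plane.
Context (R : realType) (c1 c2 : R).

(** A bivariate normal law with covariance proportional to c c^T is carried by the line through c =
    (c1, c2), and is the image of a one-dimensional normal law under this map. *)
Definition line (x : R) : R * R := (c1 * x, c2 * x).

Let measurable_line : measurable_fun setT line.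
Proof. by apply/measurable_fun_pair; exact: measurable_funM. Qed.

HB.instance Definition _ := isMeasurableFun.Build _ _ _ _ line measurable_line.

Lemma continuous_line : continuous line.
Proof.
move=> x; apply: (@cvg_pair _ _ _ _ (nbhs (c1 * x)) (nbhs (c2 * x))).
  by apply: cvgM; [exact: cvg_cst|exact: cvg_id].
by apply: cvgM; [exact: cvg_cst|exact: cvg_id].
Qed.

Lemma heine_line (g : R * R -> R) (k e : R) : continuous g -> 0 < e ->
  exists2 r, 0 < r & forall x z, `|x| <= k ->
    `|z.1 - c1 * x| < r -> `|z.2 - c2 * x| < r -> `|g z - g (line x)| < e.
Proof.
move=> cg e0; have [r r0 hr] := @heine_along R (R * R)%type g line (- k) k e
  continuous_line (fun x _ => cg (line x)) e0.
exists r => // x z; rewrite ler_norml => xk h1 h2; rewrite distrC; apply: hr => //.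
by rewrite prod_normE /= gt_max distrC h1 distrC.
Qed.

Definition line_law (s : R) : probability (R * R)%type R :=
  distribution (normal_law s) line.

Lemma is_normal0_2_line (s : R) : 0 < s ->
  is_normal0_2 (line_law s) (s ^+ 2 * c1 ^+ 2) (s ^+ 2 * c1 * c2) (s ^+ 2 * c2 ^+ 2).
Proof.
move=> s0 t1 t2.
have -> : t1 ^+ 2 * (s ^+ 2 * c1 ^+ 2) + 2 * t1 * t2 * (s ^+ 2 * c1 * c2) +
  t2 ^+ 2 * (s ^+ 2 * c2 ^+ 2) = (t1 * c1 + t2 * c2) ^+ 2 * s ^+ 2 by ring.
move=> A mA; rewrite -is_normal0_scale // /line_law /distribution /pushforward.
congr (normal_prob 0 s _); apply/seteqP; split => x /=; rewrite !mulrA -mulrDl //.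
Qed.

Lemma exp_line_law (s : R) (g : R * R -> R) (M : R) :
  measurable_fun setT g -> (forall z, `|g z| <= M) ->
  \int[line_law s]_z g z = \int[normal_law s]_x g (line x).
Proof.
move=> mg gM; rewrite /Rintegral /line_law integral_distribution //.
  exact/measurable_EFinP.
apply: (itg_bounded (normal_law s) (f := fun x => g (line x)) (M := M)) => //.
exact: measurableT_comp.
Qed.

End plane.

(** A residual at k has its regressor at k - 1, so leaving out k = s, s + 1, s + 2 removes the terms
    at s - 1, s, s + 1. *)
Lemma sum_regular (V : zmodType) (s n : nat) (F : nat -> V) : (0 < s)%N ->
  (s.+2 <= n)%N -> \sum_(1 <= k < n.+1 | regular s k) F k.-1 =
  \sum_(0 <= j < n) F j - (F s.-1 + F s + F s.+1).
Proof.
case: s => // s _ sn; rewrite big_add1 /= !big_mkord.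
have h1 : (s < n)%N by lia. have h2 : (s.+1 < n)%N by lia.
rewrite [in RHS](bigD1 (Ordinal h1)) //= [in RHS](bigD1 (Ordinal h2)) /=; last by apply/eqP => /(congr1 val) /= ?; lia.
rewrite [in RHS](bigD1 (Ordinal sn)) /=; last first.
  by apply/andP; split; apply/eqP => /(congr1 val) /= ?; lia.
rewrite !addrA [RHS]addrC addKr; apply: eq_bigl => i.
by rewrite /regular -!val_eqE /= !eqSS.
Qed.

(** The three special residuals are present for every n, hence the maximum with s + 2. *)
Lemma Qn_local (R : realType) (mu : R) s n (y y' : nat -> R) :
  (forall k, (k <= maxn n s.+2)%N -> y k = y' k) -> Qn mu s n y = Qn mu s n y'.
Proof.
move=> yy; apply/funext => -[[a t1] t2]; rewrite /Qn.
have sle k : (k <= s.+2)%N -> y k = y' k by move=> h; apply: yy; lia.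
rewrite !(sle s) ?(sle s.-1) ?(sle s.+1) ?(sle s.+2) //; try by lia.
congr (_ + _ + _ + _); rewrite big_nat_cond [RHS]big_nat_cond.
apply: eq_bigr => k /andP[/andP[k1 kn] _].
by rewrite !yy //; lia.
Qed.

Lemma prob_fineU d (T : measurableType d) (R : realType) (P : probability T R)
  (A B : set T) : measurable A -> measurable B ->
  fine (P (A `|` B)) <= fine (P A) + fine (P B).
Proof.
move=> mA mB; rewrite -fineD ?fin_num_measure //.
apply: fine_le; rewrite ?fin_num_measure ?fin_numD ?fin_num_measure //; last exact: measureU2.
exact: measurableU.
Qed.

Lemma leq_outlier s : [/\ (s.-1 <= s.+2)%N, (s <= s.+2)%N & (s.+1 <= s.+2)%N].
Proof. by split; lia. Qed.

Lemma regular_pred s k : regular s k -> (0 < k)%N ->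
  [/\ (k == s) = false, (k == s.+1) = false, (k.-1 == s) = false & (k.-1 == s.+1) = false].
Proof. by rewrite /regular => h k0; split; lia. Qed.

(** * Asymptotics of the estimators *)

Section estimator.
Context d (T : measurableType d) (R : realType) (P : probability T R).
Context (alpha : R) (X0 : T -> nat) (eps : nat -> T -> nat).
Context (xi : nat -> nat -> T -> nat) (pi : nat -> R) (Q : probability nat R).
Notation Z := (inar_family X0 eps xi).
Notation X := (inar_X X0 eps xi).
Notation W := (step eps xi 0).
Hypothesis a01 : 0 < alpha < 1.
Hypothesis mZ : forall i, nat_rv (Z i).
Hypothesis iZ : mutually_independent P Z.
Hypothesis eps_id :
  forall k m, P (eps k @^-1` [set m]) = P (eps 0%N @^-1` [set m]).
Hypothesis xi_le1 : forall k j w, (xi k j w <= 1)%N.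
Hypothesis xi_P : forall k j, P (xi k j @^-1` [set 1%N]) = alpha%:E.
Hypothesis eps_neq0 : (0 < P (eps 0%N @^-1` [set m : nat | (m != 0)%N]))%E.
Hypothesis eps3 : (\int[P]_w ((eps 0%N w) ^ 3)%N%:R%:E < +oo)%E.
Hypothesis X03 : (\int[P]_w ((X0 w) ^ 3)%N%:R%:E < +oo)%E.
Hypothesis QE : forall g : nat -> \bar R, (forall n, 0 <= g n)%E ->
  (\int[Q]_n g n = \sum_(0 <= n <oo) (pi n)%:E * g n)%E.
Hypothesis stat : forall g : nat -> \bar R, (forall n, 0 <= g n)%E ->
  (\int[Q]_n \int[P]_w g (W n w) = \int[Q]_n g n)%E.

Let mu := fine (\int[P]_w (eps 0%N w)%:R%:E)%E.
Let sig2eps := fine (\int[P]_w ((eps 0%N w) ^ 2)%N%:R%:E)%E - mu ^+ 2.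
Let m2 := pmf_moment pi 2.
Let sig2 := sigma2_ae alpha sig2eps pi.

Let mW x : nat_rv (W x). Proof. exact: (nat_rv_step mZ). Qed.

Let pathM k (f : seq nat -> R) : measurable_fun setT (fun w => f (path_of X k w)).
Proof. exact: (path_measurable mZ). Qed.

Let markov k (G : seq nat -> nat -> \bar R) : (forall p v, 0 <= G p v)%E ->
  (\int[P]_w G (path_of X k w) (X k.+1 w) =
   \int[P]_w \int[P]_w' G (path_of X k w) (W (X k w) w'))%E.
Proof. exact: (markov_property mZ). Qed.

Let WS x (g : nat -> \bar R) : (forall v, 0 <= g v)%E ->
  (\int[P]_w g (W x.+1 w) =
   \int[P]_w (alpha%:E * g (W x w).+1 + (1 - alpha)%:E * g (W x w)))%E.
Proof. exact: (integral_stepS mZ). Qed.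

Let W0 w : W 0 w = eps 0%N w.
Proof. by rewrite /step big_ord0. Qed.

Let W3 : itg P (fun w => (W 0 w)%:R ^+ 3).
Proof.
apply: itg_ge0 => [|w|]; first exact: (nat_rv_measurable (fun n => (n%:R : R) ^+ 3) (mW 0)).
  by rewrite exprn_ge0.
by under eq_integral do rewrite W0 -natrX.
Qed.

Let X3 : itg P (fun w => (X 0 w)%:R ^+ 3).
Proof.
apply: itg_ge0 => [|w|].
- exact: (nat_rv_measurable (fun n => (n%:R : R) ^+ 3) (mZ I0)).
- by rewrite exprn_ge0.
- by under eq_integral do rewrite /= -natrX.
Qed.

Let e1E : \int[P]_w (W 0 w)%:R = mu.
Proof. by under eq_Rintegral do rewrite W0. Qed.

Let s2E : \int[P]_w (W 0 w)%:R ^+ 2 - (\int[P]_w (W 0 w)%:R) ^+ 2 = sig2eps.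
Proof. by rewrite e1E; under eq_Rintegral do rewrite W0 -natrX. Qed.

Let momentE p : \int[Q]_n n%:R ^+ p = pmf_moment pi p.
Proof.
rewrite /pmf_moment /Rintegral QE; last by move=> n; rewrite lee_fin exprn_ge0.
by under [in RHS]eq_eseriesr do rewrite EFinM.
Qed.

Let a0 : 0 < alpha. Proof. by case/andP: a01. Qed.
Let a1 : 0 < 1 - alpha. Proof. by rewrite subr_gt0; case/andP: a01. Qed.

(** In the stationary equation for the second moment the remaining terms are nonnegative, so (1 -
    alpha^2) m2 >= E eps^2 >= P(eps <> 0) > 0. *)
Let m2_gt0 : 0 < m2.
Proof.
have i2 : itg P (fun w => (W 0 w)%:R ^+ 2 : R).
  exact: (itg_W mW WS W3).
have e2_gt0 : 0 < \int[P]_w (W 0 w)%:R ^+ 2.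
  have mA : measurable (eps 0%N @^-1` [set m : nat | (m != 0)%N]).
    exact: (nat_rv_preimage (N := eps 0%N) _ (mZ (IE 0))).
  have : 0 < fine (P (eps 0%N @^-1` [set m : nat | (m != 0)%N])).
    by rewrite fine_gt0 // eps_neq0 ltey_eq fin_num_measure.
  move/lt_le_trans; apply; rewrite -exp_indic //; apply: exp_le => //.
    apply: (itg_bounded P (M := 1)); first exact: measurable_indicR.
    by move=> w; rewrite indicE ger0_norm // lern1; case: (_ \in _).
  move=> w; rewrite W0 indicE -natrX ler_nat.
  case: (boolP (w \in _)) => // /set_mem /=.
  by rewrite expn_gt0 lt0n => ->.
have q (p : nat) : (p <= 3)%N -> itg Q (fun n => n%:R ^+ p : R).
  exact: (Q_itgp a01 mW pathM markov WS stat W3 X3).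
have := mm_rec mW WS stat W3 (p := 2) isT.
rewrite (expq2 P alpha W); [|exact: (q 1%N)|exact: (q 2)].
rewrite momentE -/m2 => h.
have e1_ge0 : 0 <= \int[P]_w (W 0 w)%:R :> R by apply: exp_ge0.
have m1_ge0 : 0 <= \int[Q]_n n%:R :> R by apply: exp_ge0.
have c0 : 0 <= (2 * alpha * (\int[P]_w (W 0 w)%:R) + alpha - alpha ^+ 2) * \int[Q]_n n%:R.
  apply: mulr_ge0 => //; rewrite -addrA addr_ge0 ?mulr_ge0 ?(ltW a0) //.
  have -> : alpha - alpha ^+ 2 = alpha * (1 - alpha) by ring.
  by rewrite mulr_ge0 // ltW.
have : 0 < (1 - alpha ^+ 2) * m2 by lra.
rewrite pmulr_rgt0 // subr_gt0 expr_lt1 ?(ltW a0) //.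
by case/andP: a01.
Qed.

Let q_itg p : (p <= 3)%N -> itg Q (fun n => n%:R ^+ p : R).
Proof. exact: (Q_itgp a01 mW pathM markov WS stat W3 X3). Qed.

Let vE : \int[Q]_n Vx P alpha W n = m2 ^+ 2 * sig2.
Proof.
rewrite (_ : (fun n => _) = fun n : nat => alpha * (1 - alpha) * n%:R ^+ 3
    + sig2eps * n%:R ^+ 2); last first.
  by apply/funext => n; rewrite /Vx s2E; ring.
rewrite expD; [|exact/itgZ/q_itg|exact/itgZ/q_itg].
rewrite !expZ; [|exact: q_itg|exact: q_itg].
rewrite !momentE /sig2 /sigma2_ae -/m2 mulrCA mulfV ?mulr1 //.
by rewrite sqrf_eq0 gt_eqF.
Qed.

(** The term alpha (1 - alpha) E X^3 is positive since E X^3 >= E X^2 for an integer-valued X.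
    Positivity allows the limit to be taken as a normal law with a density. *)
Let sig2_gt0 : 0 < sig2.
Proof.
have s20 : 0 <= sig2eps by rewrite -s2E; exact: (s2_ge0 mW WS W3).
have m3 : m2 <= pmf_moment pi 3.
  rewrite /m2 -!momentE; apply: exp_le; [exact: q_itg|exact: q_itg|].
  by move=> n; rewrite -!natrX ler_nat; case: n => // n; rewrite leq_pexp2l.
rewrite /sig2 /sigma2_ae divr_gt0 ?exprn_gt0 // ltr_wpDr //.
  by rewrite mulr_ge0 // ltW.
by rewrite !mulr_gt0 // (lt_le_trans m2_gt0).
Qed.

Context (s th1 th2 : nat).
Hypothesis s_gt0 : (0 < s)%N.
Notation Y := (obs_Y R X s th1 th2).
Let est n w := unique_argmin (Qn mu s n (Y ^~ w)).
(** Started at s + 2, so that events about (Y_(s-1), Y_(s+2)) depend only on the path before the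
    first increment. *)
Let Sm n w := Smart P alpha W X s.+2 n w.

(** The path takes countably many values, so whatever factors through it is measurable. This settles
    measurability of the minimizer without any measurable selection. *)
Lemma path_determined_measurable k (G : T -> R) :
  (forall w w', (forall i, (i <= k)%N -> X i w = X i w') -> G w = G w') ->
  measurable_fun setT G.
Proof.
move=> dG.
pose F (p : seq nat) : R :=
  if pselect (exists w, path_of X k w = p) is left h then G (projT1 (cid h)) else 0.
rewrite (_ : G = fun w => F (path_of X k w)); first exact: pathM.
apply/funext => w; rewrite /F; case: pselect => [h|]; last by case; exists w.
case: (cid h) => w' /= e; apply: dG => i ik.
by rewrite -(nth_path_of X w ik) -e nth_path_of.
Qed.

Let Y_eq k w w' : X k w = X k w' -> Y k w = Y k w'.
Proof. by rewrite /obs_Y => ->. Qed.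

Let est_measurable n (g : R * R * R -> R -> R -> R -> R -> R) :
  measurable_fun setT (fun w => g (est n w) (Y s.-1 w) (Y s w) (Y s.+1 w) (Y s.+2 w)).
Proof.
apply: (@path_determined_measurable (maxn n s.+2)) => w w' e.
rewrite /est (Qn_local mu (fun k kn => Y_eq (e k kn))).
have [l0 l1 l2] := leq_outlier s.
by congr (g _ _ _ _ _); apply/Y_eq/e; rewrite leq_max ?leqnn ?l0 ?l1 ?l2 orbT.
Qed.

Let sumX2_3 w : R := (X s.-1 w)%:R ^+ 2 + (X s w)%:R ^+ 2 + (X s.+1 w)%:R ^+ 2.

Let Y_regular k w : regular s k -> (0 < k)%N ->
  Y k w = (X k w)%:R /\ Y k.-1 w = (X k.-1 w)%:R.
Proof.
move=> rk k0; have [e1 e2 e3 e4] := regular_pred rk k0.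
by rewrite /obs_Y e1 e2 e3 e4 !mul0r !addr0.
Qed.

Let reg_SE n w : (s.+2 <= n)%N ->
  reg_S s n (Y ^~ w) = \sum_(j < n) (X j w)%:R ^+ 2 - sumX2_3 w.
Proof.
move=> sn; rewrite -(big_mkord xpredT (fun j => (X j w)%:R ^+ 2)).
rewrite -(sum_regular (fun j => (X j w)%:R ^+ 2) s_gt0 sn) /reg_S.
rewrite big_nat_cond [RHS]big_nat_cond; apply: eq_bigr => k /andP[/andP[k1 _] rk].
by have [_ ->] := Y_regular w rk k1.
Qed.

Let zX j w := zeta P alpha W (X j w) (X j.+1 w).
(** The increments before the start of [Sm], minus those of the three special residuals. It does not
    depend on n, so it disappears after division by sqrt n. *)
Let head_N w : R := \sum_(0 <= j < s.+2) zX j w - (zX s.-1 w + zX s w + zX s.+1 w).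

Let reg_NE n w : (s.+2 <= n)%N -> reg_N mu s n (Y ^~ w) alpha = Sm n w + head_N w.
Proof.
move=> sn; rewrite /head_N /Sm /Smart addrA [X in X - _]addrC -big_cat_nat //=.
rewrite -(sum_regular (zX ^~ w) s_gt0 sn) /reg_N.
rewrite big_nat_cond [RHS]big_nat_cond; apply: eq_bigr => k /andP[/andP[k1 _] rk].
have [-> ->] := Y_regular w rk k1; rewrite /zX /zeta e1E prednK //; ring.
Qed.

(** The constant of [ls_bound] becomes random through (Y_(s-1), Y_(s+2)), but it does not depend on
    n and is therefore tight. *)
Let Mf (x z : R) : R := projT1 (cid (ls_bound_ex mu x z)).

Let MfP x z : ls_bound mu x z (Mf x z).
Proof. by rewrite /Mf; case: cid. Qed.

Let V n w : R := Sm n w / Num.sqrt n%:R.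

Let Sm_measurable n : measurable_fun setT (Sm n).
Proof.
apply: (@path_determined_measurable n) => w w' e; rewrite /Sm /Smart big_nat [RHS]big_nat.
by apply: eq_bigr => j /andP[_ jn]; rewrite !e // ltnW.
Qed.

Let V_tight e : 0 < e -> exists K : R, forall n, (s.+2 <= n)%N ->
  fine (P [set w | K <= `|V n w|]) <= e.
Proof.
move=> e0; have [B B0 hB] := E_VX_bounded a01 mW pathM markov WS W3 X3.
(* Chebyshev's inequality: B bounds the second moment of [V], and e times the square of this level
   is at least B. *)
exists (B / e + 1) => n sn.
have n0 : 0 < n%:R :> R by rewrite ltr0n (leq_trans _ sn).
have [iS ES] := Smart_sq a01 mW pathM markov WS W3 X3 s.+2 (n - s.+2).
rewrite subnKC // in iS ES.
have Be : 0 <= B / e by rewrite divr_ge0 // ltW.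
have iV : itg P (fun w => V n w ^+ 2).
  have -> : (fun w => V n w ^+ 2) = fun w => n%:R^-1 * Sm n w ^+ 2.
    by apply/funext => w; rewrite /V exprMn exprVn sqr_sqrtr // mulrC.
  exact: itgZ.
have EV : \int[P]_w `|V n w ^+ 2| <= B.
  have -> : (fun w => `|V n w ^+ 2|) = fun w => n%:R^-1 * Sm n w ^+ 2.
    by apply/funext => w; rewrite ger0_norm ?sqr_ge0 // /V exprMn exprVn sqr_sqrtr // mulrC.
  rewrite expZ // ES mulrC ler_pdivrMr //.
  apply: le_trans (_ : \sum_(s.+2 <= j < n) B <= _); first by apply: ler_sum => j _.
  by rewrite sumr_const_nat -[leLHS]mulr_natr ler_wpM2l // ler_nat leq_subr.
have c0 : 0 < (B / e + 1) ^+ 2 by rewrite exprn_gt0 // ltr_wpDl.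
have mV : measurable_fun setT (V n) by apply: measurable_funM => //; exact: Sm_measurable.
have mV2 : measurable_fun setT (fun w => V n w ^+ 2) by exact: itg_measurable iV.
apply: le_trans (_ : fine (P [set w | (B / e + 1) ^+ 2 <= `|V n w ^+ 2|]) <= _).
  apply: prob_fine_le; [exact: measurable_norm_ge|exact: measurable_norm_ge|].
  by move=> w /= h; rewrite normrX lerXn2r // nnegrE addr_ge0.
apply: le_trans (markov_norm iV c0) _; rewrite ler_pdivrMr //; apply: le_trans EV _.
have : B <= e * (B / e + 1) by rewrite mulrDr mulrC divfK ?gt_eqF // mulr1 lerDl ltW.
move/le_trans; apply; rewrite ler_pM2l // expr2 ler_peMr ?addr_ge0 //.
by rewrite lerDr.
Qed.

Let dop1 w := dopt1 mu (Y s.-1 w) (Y s.+2 w) alpha.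
Let dop2 w := dopt2 mu (Y s.-1 w) (Y s.+2 w) alpha.

(** The order of quantifiers matters: [K] depends on the probability e' only, so the accuracy e can
    be chosen afterwards, from the uniform continuity of the test function on [-K, K]. *)
Lemma good_event e' : 0 < e' -> exists K : R, forall e, 0 < e -> exists N, forall n,
  (N <= n)%N -> exists2 A, measurable A /\ fine (P A) <= e' & forall w, ~ A w ->
  [/\ `|V n w / m2| <= K,
      `|Num.sqrt n%:R * ((est n w).1.1 - alpha) - V n w / m2| <= e,
      `|Num.sqrt n%:R * ((est n w).1.2 - (Y s w + opt1 mu (Y s.-1 w) (Y s.+2 w) alpha))
        - dop1 w * (V n w / m2)| <= e &
      `|Num.sqrt n%:R * ((est n w).2 - (Y s.+1 w + opt2 mu (Y s.-1 w) (Y s.+2 w) alpha))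
        - dop2 w * (V n w / m2)| <= e].
Proof.
move=> e'0; have e4 : 0 < e' / 4 by rewrite divr_gt0.
have [K1 hK1] := V_tight e4.
have mdop : measurable_fun setT (fun w => `|dop1 w| + `|dop2 w|).
  exact: (est_measurable 0 (fun _ x _ _ z => `|dopt1 mu x z alpha| + `|dopt2 mu x z alpha|)).
have [K2 hK2] := rv_tight P mdop e4.
pose K := `|K1| + K2%:R.
have K0 : 0 <= K by rewrite addr_ge0.
exists (K / m2) => e e0.
have [del del0 [c hc]] := argmin_expansion mu a01 m2_gt0 K0 e0.
pose Z0 w := `|head_N w| + sumX2_3 w + Mf (Y s.-1 w) (Y s.+2 w).
have mZ0 : measurable_fun setT Z0.
  apply: (@path_determined_measurable s.+2) => w w' E.
  have EE i : (i <= s.+2)%N -> X i w = X i w' by exact: E.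
  have zz j : (j < s.+2)%N -> zX j w = zX j w' by move=> ?; rewrite /zX !EE // ltnW.
  have [l0 l1 l2] := leq_outlier s.
  have Es : [/\ X s.-1 w = X s.-1 w', X s w = X s w' & X s.+1 w = X s.+1 w'].
    by split; apply: EE.
  rewrite /Z0 /sumX2_3 /head_N (Y_eq (EE s.-1 _)) ?(Y_eq (EE s.+2 _)) //.
  case: Es => -> -> ->; congr (`|_ - _| + _ + _).
    by rewrite big_nat [RHS]big_nat; apply: eq_bigr => j /andP[_]; exact: zz.
  by congr (_ + _ + _); apply: zz; rewrite ltnS ?leqnn // leqW // leq_pred.
have Z0ge w : [/\ `|head_N w| <= Z0 w, 0 <= sumX2_3 w <= Z0 w & Mf (Y s.-1 w) (Y s.+2 w) <= Z0 w].
  have M0 : 0 <= Mf (Y s.-1 w) (Y s.+2 w) by case: (MfP (Y s.-1 w) (Y s.+2 w)).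
  have S0 : 0 <= sumX2_3 w by rewrite !addr_ge0 ?sqr_ge0.
  have H0 := normr_ge0 (head_N w); rewrite /Z0; split; lra.
have [N1 hN1] := rv_tight P mZ0 e4; have {hN1} hN1 := hN1 N1 (leqnn _).
pose lln n w := n%:R^-1 * \sum_(j < n) (X j w)%:R ^+ 2 - m2.
have illn n : itg P (lln n).
  apply: itgB; last exact: itg_cst.
  by apply/itgZ/itg_sum => j _; exact: (X_i mW pathM markov WS W3 X3).
have hlln : \forall n \near \oo, fine (P [set w | del / 2 <= `|lln n w|]) <= e' / 4.
  have := lln_sq a01 mW pathM markov WS stat W3 X3; rewrite momentE -/m2.
  have d2 : 0 < e' / 4 * (del / 2) by rewrite mulr_gt0 // divr_gt0.
  move=> /cvgrPdist_le/(_ _ d2) [N' _ h]; exists N' => // n /h.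
  rewrite sub0r normrN => h'; have dd : 0 < del / 2 by rewrite divr_gt0.
  apply: le_trans (markov_norm (illn n) dd) _; rewrite ler_pdivrMr //.
  exact: le_trans (ler_norm _) h'.
have nat_big (b : R) : \forall n \near \oo, b < n%:R.
  by have /cvgryPgt h := @cvgr_idn R; exact: h.
have sqrt_big (b : R) : \forall n \near \oo, b < Num.sqrt n%:R.
  apply: filterS (nat_big (b ^+ 2)) => n bn; apply: le_lt_trans (ler_norm _) _.
  by rewrite -sqrtr_sqr ltr_sqrt // (le_lt_trans _ bn) ?sqr_ge0.
have : \forall n \near \oo, (fun n : nat => exists2 A, measurable A /\ fine (P A) <= e' &
    forall w, ~ A w -> [/\ `|V n w / m2| <= K / m2,
      `|Num.sqrt n%:R * ((est n w).1.1 - alpha) - V n w / m2| <= e,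
      `|Num.sqrt n%:R * ((est n w).1.2 - (Y s w + opt1 mu (Y s.-1 w) (Y s.+2 w) alpha))
        - dop1 w * (V n w / m2)| <= e &
      `|Num.sqrt n%:R * ((est n w).2 - (Y s.+1 w + opt2 mu (Y s.-1 w) (Y s.+2 w) alpha))
        - dop2 w * (V n w / m2)| <= e]) n; last first.
  by move=> [N _ hN]; exists N => n /hN.
near=> n.
have sn : (s.+2 <= n)%N by near: n; exact: nbhs_infty_ge.
have cn : c < Num.sqrt n%:R by near: n; exact: sqrt_big.
have dn : N1%:R / del < Num.sqrt n%:R by near: n; exact: sqrt_big.
have dn2 : N1%:R / (del / 2) < n%:R by near: n; exact: nat_big.
have n0 : 0 < n%:R :> R by rewrite ltr0n (leq_trans _ sn).
have q0 : 0 < Num.sqrt n%:R :> R by rewrite sqrtr_gt0.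
have mV : measurable_fun setT (V n) by apply: measurable_funM => //; exact: Sm_measurable.
have mA1 := measurable_norm_ge K1 mV.
have mA2 := measurable_norm_ge K2%:R mdop.
have mA3 := measurable_norm_ge N1%:R mZ0.
have mA4 := measurable_norm_ge (del / 2) (itg_measurable (illn n)).
(* Four bad events of probability at most e'/4: a large martingale, large derivatives at alpha,
   large quantities independent of n, and a failure of the law of large numbers. The last uses
   del/2, leaving del/2 for the three missing squares. *)
exists ((([set w | K1 <= `|V n w|] `|` [set w | K2%:R <= `| `|dop1 w| + `|dop2 w| |])
  `|` [set w | N1%:R <= `|Z0 w|]) `|` [set w | del / 2 <= `|lln n w|]).
  split; first by do 3 apply: measurableU => //.
  have p1 := hK1 n sn; have p2 := hK2 K2 (leqnn _).
  have p4 : fine (P [set w | del / 2 <= `|lln n w|]) <= e' / 4 by near: n; exact: hlln.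
  apply: le_trans (prob_fineU P _ mA4) _; first by do 2 apply: measurableU => //.
  have := prob_fineU P (measurableU _ _ mA1 mA2) mA3; have := prob_fineU P mA1 mA2.
  lra.
move=> w /not_orP[/not_orP[/not_orP[]]] /= /negP + /negP + /negP + /negP.
rewrite -!ltNge => v1 v2 v3 v4.
have {v2} v2 : `|dop1 w| + `|dop2 w| < K2%:R by apply: le_lt_trans (ler_norm _) v2.
have {v3} v3 : Z0 w < N1%:R by apply: le_lt_trans (ler_norm _) v3.
have K20 : 0 <= K2%:R :> R by [].
have [z1 /andP[z20 z2] z3] := Z0ge w.
have VK : `|V n w| <= K.
  by rewrite (le_trans (ltW v1)) // (le_trans (ler_norm _)) // lerDl.
have d1K : `|dop1 w| <= K.
  by have := normr_ge0 (dop2 w); have := normr_ge0 K1; rewrite /K; lra.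
have d2K : `|dop2 w| <= K.
  by have := normr_ge0 (dop1 w); have := normr_ge0 K1; rewrite /K; lra.
have N1q : N1%:R <= del * Num.sqrt n%:R by rewrite mulrC -ler_pdivrMr // ltW.
have [||||c1 c2 c3] := hc n s (Y ^~ w) (Mf (Y s.-1 w) (Y s.+2 w)) (V n w)
    (head_N w / Num.sqrt n%:R) cn (MfP _ _) _ _ VK _ _ d1K d2K.
- rewrite reg_SE // mulrBl.
  have -> : (\sum_(j < n) (X j w)%:R ^+ 2) / n%:R - sumX2_3 w / n%:R - m2 =
    lln n w - sumX2_3 w / n%:R by rewrite /lln; ring.
  rewrite (le_trans (ler_normB _ _)) // [leRHS]splitr lerD ?ltW //.
  rewrite ger0_norm ?divr_ge0 // ltr_pdivrMr // mulrC.
  by rewrite (le_lt_trans z2) // (lt_trans v3) // -ltr_pdivrMr // divr_gt0.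
- by rewrite reg_NE // /V mulrDr mulrC divfK ?gt_eqF // mulrC divfK ?gt_eqF.
- rewrite normrM normfV (gtr0_norm q0) ler_pdivrMr //.
  by rewrite (le_trans z1) // (le_trans (ltW v3)).
- by rewrite (le_trans z3) // (le_trans (ltW v3)).
split => //.
by rewrite normrM normfV (gtr0_norm m2_gt0) ler_pM2r // invr_gt0.
Unshelve. all: by end_near.
Qed.

Let V_measurable n : measurable_fun setT (fun w => V n w / m2).
Proof. by do 2 apply: measurable_funM => //; exact: Sm_measurable. Qed.

(** The limit factorizes: the normalized martingale is asymptotically independent of the path up to
    s + 2. The frequency t/m2 in [clt_cos] turns the variance m2^2 sig2 of [vE] into sig2. *)
Let V_law (b : seq nat -> R) (g : R -> R) (M : R) :
  (forall p, `|b p| <= 1) -> continuous g -> (forall x, `|g x| <= M) ->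
  \int[P]_w (b (path_of X s.+2 w) * g (V n w / m2)) @[n --> \oo] -->
  \int[P]_w b (path_of X s.+2 w) * \int[normal_law (Num.sqrt sig2)]_x g x.
Proof.
move=> b1 cg gM.
have ib : itg P (fun w => b (path_of X s.+2 w)).
  by apply: (itg_bounded P (M := 1)) => // w; exact: pathM.
apply: (levy (H := fun n w => V n w / m2) (rho := fun w => b (path_of X s.+2 w))
  V_measurable _ _ _ _ _ cg gM) => //.
- by rewrite -[leRHS](exp_cst P 1); apply: exp_norm_le => //; exact: itg_cst.
- move=> t th.
  rewrite (exp_normal_law _ (f := fun x => cos (t * x + th)) (M := 1)); last 2 first.
  + have h : continuous (fun x : R => cos (t * x + th)).
      move=> x; apply: continuous_comp; last exact: continuous_cos.
      by apply: cvgD; [apply: cvgM; [exact: cvg_cst|exact: cvg_id]|exact: cvg_cst].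
    exact: continuous_measurable_fun.
  + by move=> x; rewrite ler_norml cos_geN1 cos_le1.
  rewrite normal_cos ?sqrtr_gt0 // sqr_sqrtr ?(ltW sig2_gt0) //.
  have := clt_cos a01 mW pathM markov WS stat W3 X3 (k0 := s.+2) (b := b) (theta := th) b1 (t := t / m2).
  rewrite vE.
  have -> : (t / m2) ^+ 2 / 2 * (m2 ^+ 2 * sig2) = t ^+ 2 / 2 * sig2.
    by field; rewrite gt_eqF.
  rewrite -mulrA [cos th * _]mulrC; apply: cvg_trans; apply: near_eq_cvg.
  apply: nearW => n; apply: eq_Rintegral => w _; congr (_ * cos (_ + _)).
  by rewrite /V /Sm; ring.
- move=> e /V_tight[K hK]; exists (K / m2), s.+2 => n sn; apply: le_trans (hK n sn).
  apply: prob_fine_le.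
  + exact: measurable_norm_ge.
  + by apply: measurable_norm_ge; apply: measurable_funM => //; exact: Sm_measurable.
  + by move=> w /=; rewrite normrM normfV (gtr0_norm m2_gt0) ler_pM2r // invr_gt0.
Qed.

(** The common end of both assertions: [G] is a test function of the estimators, and its
    approximation [g] is a function of the one-dimensional variable V/m2. Conditioning is the weight
    1_B followed by division by P(B). *)
Let cond_limit (B : set T) (G : nat -> T -> R) (g : R -> R) (M : R) :
  (forall w w', (forall i, (i <= s.+2)%N -> X i w = X i w') -> B w -> B w') ->
  (0 < P B)%E -> (forall n, measurable_fun setT (G n)) ->
  (forall n w, `|G n w| <= M) -> continuous g -> (forall x, `|g x| <= M) ->
  (forall e e', 0 < e -> 0 < e' -> exists N, forall n, (N <= n)%N -> exists2 A,
    measurable A /\ fine (P A) <= e' &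
    forall w, ~ A w -> B w -> `|G n w - g (V n w / m2)| <= e) ->
  (fun n => fine (\int[P]_(w in B) (G n w)%:E)%E / fine (P B)) @ \oo -->
    \int[normal_law (Num.sqrt sig2)]_x g x.
Proof.
move=> dB PB mG GM cg gM close.
have dI w w' : (forall i, (i <= s.+2)%N -> X i w = X i w') -> \1_B w = \1_B w' :> R.
  move=> e; rewrite !indicE; congr (nat_of_bool _)%:R; apply/idP/idP => /set_mem h; apply/mem_set.
    exact: dB h.
  by apply: dB h => i /e.
have mI : measurable_fun setT (\1_B : T -> R) by exact: (path_determined_measurable dI).
have mB : measurable B.
  rewrite (_ : B = [set w | 1 <= `|\1_B w : R|]); first exact: measurable_norm_ge.
  apply/seteqP; split => w /=; rewrite indicE.
    by move=> Bw; rewrite mem_set // normr1.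
  by case: (boolP (w \in B)) => [/set_mem //|_]; rewrite normr0 ler10.
pose b (p : seq nat) : R :=
  if pselect (exists2 w, path_of X s.+2 w = p & B w) then 1 else 0.
have bE w : \1_B w = b (path_of X s.+2 w).
  rewrite /b indicE; case: pselect => [[w' e Bw']|h].
    rewrite mem_set //; apply: dB Bw' => i i2.
    by rewrite -(nth_path_of X w' i2) e nth_path_of.
  by rewrite memNset // => Bw; apply: h; exists w.
have b1 p : `|b p| <= 1 by rewrite /b; case: pselect => h; rewrite ?normr1 ?normr0.
have p0 : fine (P B) != 0 by rewrite gt_eqF // fine_gt0 // PB ltey_eq fin_num_measure.
have := V_law b1 cg gM.
under eq_Rintegral do rewrite -bE; under eq_fun do under eq_Rintegral do rewrite -bE.
rewrite exp_indic // => lim.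
have {}lim : \int[P]_w (\1_B w * G n w) @[n --> \oo] -->
    fine (P B) * \int[normal_law (Num.sqrt sig2)]_x g x.
  apply: (exp_dist_cvg0 (M := M) mI _ mG _ GM _ _ lim) => //.
  - by move=> w; rewrite indicE ger0_norm // lern1; case: (_ \in _).
  - move=> n; apply: measurableT_comp; last exact: V_measurable.
    exact: continuous_measurable_fun.
  - move=> e e' e0 e'0; have [N hN] := close _ _ e0 e'0; exists N => n /hN[A mA hA].
    exists A => // w Aw; rewrite indicE.
    by case: (boolP (w \in B)) => [/set_mem Bw _|_]; [exact: hA|rewrite eqxx].
have -> : \int[normal_law (Num.sqrt sig2)]_x g x =
    fine (P B) * \int[normal_law (Num.sqrt sig2)]_x g x / fine (P B).
  by rewrite mulrAC mulfV // mul1r.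
rewrite (_ : (fun n => _) = fun n => \int[P]_w (\1_B w * G n w) / fine (P B)).
  by apply: cvgMl; exact: lim.
by apply/funext => n; rewrite -exp_on.
Qed.

Lemma alpha_estimator_cvg : exists nu : probability R R, is_normal0 nu sig2 /\
  cond_cvg_law P setT (fun n w => Num.sqrt n%:R * ((est n w).1.1 - alpha)) nu.
Proof.
exists (normal_law (Num.sqrt sig2)); split; first exact: is_normal0_law.
move=> g cg [M gM]; apply: (cond_limit (M := M)) => //.
- by rewrite probability_setT.
- exact: (fun n => est_measurable n (fun e _ _ _ _ => g (Num.sqrt n%:R * (e.1.1 - alpha)))).
move=> e e' e0 e'0; have [K hK] := good_event e'0.
have [r r0 hr] := @heine R g (- K) K e (fun x _ => cg x) e0.
have r20 : 0 < r / 2 by rewrite divr_gt0.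
have [N hN] := hK _ r20; exists N => n /hN[A mA hA]; exists A => // w /hA[VK h _ _] _.
rewrite distrC ltW // hr -?ler_norml // distrC (le_lt_trans h) //.
by rewrite ltr_pdivrMr // ltr_pMr // ltr1n.
Qed.

(** On B the derivatives of the optimal outlier sizes are the constants f1 and f2, so the pair of
    normalized errors is close to the point [line f1 f2] of V/m2. *)
Lemma outlier_estimators_cvg (x z : R) (f1 f2 : R) :
  let B := [set w | Y s.-1 w = x /\ Y s.+2 w = z] in
  f1 = dopt1 mu x z alpha -> f2 = dopt2 mu x z alpha -> (0 < P B)%E ->
  exists nu : probability (R * R)%type R,
  is_normal0_2 nu (sig2 * f1 ^+ 2) (sig2 * f1 * f2) (sig2 * f2 ^+ 2) /\
  cond_cvg_law2 P B (fun n w =>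
    (Num.sqrt n%:R * ((est n w).1.2 - (Y s w + opt1 mu (Y s.-1 w) (Y s.+2 w) alpha)),
     Num.sqrt n%:R * ((est n w).2 - (Y s.+1 w + opt2 mu (Y s.-1 w) (Y s.+2 w) alpha))))
    nu.
Proof.
move=> B f1E f2E PB; exists (line_law f1 f2 (Num.sqrt sig2)); split.
  have q0 : 0 < Num.sqrt sig2 by rewrite sqrtr_gt0.
  by have := is_normal0_2_line f1 f2 q0; rewrite sqr_sqrtr // ltW.
move=> g cg [M gM].
have mg : measurable_fun setT g by exact: continuous_measurable_plane.
rewrite [X in _ --> X](exp_line_law _ _ _ mg gM).
apply: (cond_limit (g := fun v => g (line f1 f2 v)) (M := M)) => //.
- move=> w w' e [h1 h2]; have [l0 l1 l2] := leq_outlier s.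
  by split; [rewrite -h1|rewrite -h2]; apply/esym/Y_eq/e.
- move=> n; exact: (est_measurable n (fun e y0 y1 y2 y3 =>
    g (Num.sqrt n%:R * (e.1.2 - (y1 + opt1 mu y0 y3 alpha)),
       Num.sqrt n%:R * (e.2 - (y2 + opt2 mu y0 y3 alpha))))).
- move=> v; exact: (cvg_comp _ _ (@continuous_line R f1 f2 v) (cg (line f1 f2 v))).
move=> e e' e0 e'0; have [K hK] := good_event e'0.
have [r r0 hr] := heine_line f1 f2 K cg e0.
have r20 : 0 < r / 2 by rewrite divr_gt0.
have rr : r / 2 < r by rewrite ltr_pdivrMr // ltr_pMr // ltr1n.
have [N hN] := hK _ r20; exists N => n /hN[A mA hA]; exists A => // w /hA[VK _ h1 h2] [Y1 Y2].
move: h1 h2; rewrite /dop1 /dop2 Y1 Y2 -f1E -f2E => h1 h2.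
by rewrite ltW // hr //=; [exact: le_lt_trans h1 rr|exact: le_lt_trans h2 rr].
Qed.

End estimator.

Lemma opt1E (R : realType) (mu x z a : R) : opt1 mu x z a =
  (- a * (1 + a ^+ 2) * x - a ^+ 2 * z - (1 - a ^+ 3) * mu) / (1 + a ^+ 2 + a ^+ 4).
Proof. by have := wsum_neq0 a; rewrite /opt1 /cres /wsum => h; field. Qed.

Lemma opt2E (R : realType) (mu x z a : R) : opt2 mu x z a =
  (- a ^+ 2 * x - a * (1 + a ^+ 2) * z - (1 - a ^+ 3) * mu) / (1 + a ^+ 2 + a ^+ 4).
Proof. by have := wsum_neq0 a; rewrite /opt2 /cres /wsum => h; field. Qed.

Lemma dopt1E (R : realType) (mu x z a : R) : dopt1 mu x z a =
  ((a ^+ 2 - 1) * (a ^+ 4 + 3 * a ^+ 2 + 1) * x + 2 * a * (a ^+ 4 - 1) * z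
   + a * (2 - a) * (1 + a + a ^+ 2) ^+ 2 * mu) / (1 + a ^+ 2 + a ^+ 4) ^+ 2.
Proof.
by have := wsum_neq0 a; rewrite /dopt1 /dquot /dcres /cres /wsum => h; field.
Qed.

Lemma dopt2E (R : realType) (mu x z a : R) : dopt2 mu x z a =
  (2 * a * (a ^+ 4 - 1) * x + (a ^+ 2 - 1) * (a ^+ 4 + 3 * a ^+ 2 + 1) * z
   + a * (2 - a) * (1 + a + a ^+ 2) ^+ 2 * mu) / (1 + a ^+ 2 + a ^+ 4) ^+ 2.
Proof.
by have := wsum_neq0 a; rewrite /dopt2 /dquot /dcres /cres /wsum => h; field.
Qed.

Theorem theorem3p5p2 (d : measure_display) (T : measurableType d)
  (R : realType) (P : probability T R)
  (alpha : R) (X0 : T -> nat) (eps : nat -> T -> nat)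
  (xi : nat -> nat -> T -> nat) (s th1 th2 : nat) (pi : nat -> R) :
  0 < alpha < 1 ->
  (* measurability and mutual independence of X_0, (eps_k), (xi_{k,j}) *)
  (forall i, nat_rv (inar_family X0 eps xi i)) ->
  mutually_independent P (inar_family X0 eps xi) ->
  (* eps_k identically distributed *)
  (forall k m, P (eps k @^-1` [set m]) = P (eps 0%N @^-1` [set m])) ->
  (* xi_{k,j} Bernoulli(alpha) *)
  (forall k j w, (xi k j w <= 1)%N) ->
  (forall k j, P (xi k j @^-1` [set 1%N]) = alpha%:E) ->
  (0 < P (eps 0%N @^-1` [set m : nat | (m != 0)%N]))%E ->
  (* moment assumptions *)
  (\int[P]_w ((eps 0%N w) ^ 2)%N%:R%:E < +oo)%E ->
  (\int[P]_w ((X0 w) ^ 2)%N%:R%:E < +oo)%E ->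
  (\int[P]_w ((eps 0%N w) ^ 3)%N%:R%:E < +oo)%E ->
  (\int[P]_w ((X0 w) ^ 3)%N%:R%:E < +oo)%E ->
  (* outliers *)
  (0 < s)%N -> (0 < th1)%N -> (0 < th2)%N ->
  (* pi is the stationary distribution of the chain *)
  is_stationary (inar_kernel alpha (eps_pmf P eps)) pi ->
  let mu := fine (\int[P]_w (eps 0%N w)%:R%:E)%E in
  let sig2eps := fine (\int[P]_w ((eps 0%N w) ^ 2)%N%:R%:E)%E - mu ^+ 2 in
  let sig2 := sigma2_ae alpha sig2eps pi in
  let Y := obs_Y R (inar_X X0 eps xi) s th1 th2 in
  let est := fun (n : nat) (w : T) => unique_argmin (Qn mu s n (Y ^~ w)) in
  let D := 1 + alpha ^+ 2 + alpha ^+ 4 in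
  let L1 := fun w => Y s w + (- alpha * (1 + alpha ^+ 2) * Y s.-1 w
              - alpha ^+ 2 * Y s.+2 w - (1 - alpha ^+ 3) * mu) / D in
  let L2 := fun w => Y s.+1 w + (- alpha ^+ 2 * Y s.-1 w
              - alpha * (1 + alpha ^+ 2) * Y s.+2 w - (1 - alpha ^+ 3) * mu) / D in
  let f := fun (y1 y2 : R) =>
    ((((alpha ^+ 2 - 1) * (alpha ^+ 4 + 3 * alpha ^+ 2 + 1) * y1
       + 2 * alpha * (alpha ^+ 4 - 1) * y2
       + alpha * (2 - alpha) * (1 + alpha + alpha ^+ 2) ^+ 2 * mu) / D ^+ 2),
     (((2 * alpha * (alpha ^+ 4 - 1) * y1
       + (alpha ^+ 2 - 1) * (alpha ^+ 4 + 3 * alpha ^+ 2 + 1) * y2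
       + alpha * (2 - alpha) * (1 + alpha + alpha ^+ 2) ^+ 2 * mu) / D ^+ 2))) in
  (exists nu : probability R R,
     is_normal0 nu sig2 /\
     cond_cvg_law P setT
       (fun n w => Num.sqrt (n%:R) * ((est n w).1.1 - alpha)) nu) /\
  (forall m1 m2 : nat,
     let B := [set w | Y s.-1 w = m1%:R /\ Y s.+2 w = m2%:R] in
     (0 < P B)%E ->
     exists nu : probability (R * R)%type R,
       is_normal0_2 nu (sig2 * (f m1%:R m2%:R).1 ^+ 2)
         (sig2 * (f m1%:R m2%:R).1 * (f m1%:R m2%:R).2)
         (sig2 * (f m1%:R m2%:R).2 ^+ 2) /\
       cond_cvg_law2 P B
         (fun n w => (Num.sqrt (n%:R) * ((est n w).1.2 - L1 w),
                      Num.sqrt (n%:R) * ((est n w).2 - L2 w))) nu).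
Proof.
move=> a01 mZ iZ eps_id xi_le1 xi_P eps_neq0 _ _ eps3 X03 s_gt0 _ _ st.
move=> mu sig2eps sig2 Y est D L1 L2 f.
have [Q [QE stat]] := stationary_law_ex mZ iZ xi_le1 xi_P a01 st.
split.
  exact: (alpha_estimator_cvg a01 mZ iZ eps_id xi_le1 xi_P eps_neq0 eps3 X03 QE stat
    th1 th2 s_gt0).
move=> m1 m2 B PB.
have [nu [nuN nuC]] := outlier_estimators_cvg a01 mZ iZ eps_id xi_le1 xi_P eps_neq0
  eps3 X03 QE stat s_gt0 (esym (dopt1E mu m1%:R m2%:R alpha))
  (esym (dopt2E mu m1%:R m2%:R alpha)) PB.
exists nu; split; first exact: nuN.
rewrite (_ : (fun n w => _) = fun n w =>
  (Num.sqrt n%:R * ((est n w).1.2 - (Y s w + opt1 mu (Y s.-1 w) (Y s.+2 w) alpha)),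
   Num.sqrt n%:R * ((est n w).2 - (Y s.+1 w + opt2 mu (Y s.-1 w) (Y s.+2 w) alpha)))).
  exact: nuC.
by apply/funext => n; apply/funext => w; rewrite /L1 /L2 /D -opt1E -opt2E.
Qed.
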